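(* Fix an integer $M\ge 1$. Then: (i) The entropy plateaus of $H$ contained in $(q_T,M+1]$ are exactly the irreducible intervals that lie inside $(q_{KL},M+1]$. (ii) For each $n\in\mathbb N$, the entropy plateaus of $H$ contained in $I_n=(q_{n+1}',q_n']$ are exactly the $n$-irreducible intervals that lie inside $(q_{KL},M+1]$.
   Context: Notation. $\Omega_M=\{0,1,\dots,M\}^{\mathbb N}$ with left shift $\sigma$. Order. Sequences are ordered lexicographically: $(c_i)\prec(d_i)$ if for some $n$, $c_1\dots c_{n-1}=d_1\dots d_{n-1}$ and $c_n<d_n$; $\preceq$ means $\prec$ or $=$. Finite words are compared by $\mathbf c\prec\mathbf d$ iff $\mathbf c0^\infty\prec\mathbf d0^\infty$. Word operations. For a word $c_1\dots c_k$: - if $c_k<M$, then $c_1\dots c_k^+:=c_1\dots c_{k-1}(c_k+1)$; - if $c_k>0$, then $c_1\dots c_k^-:=c_1\dots c_{k-1}(c_k-1)$; - the reflection is $\overline{c_1\dots c_k}:=(M-c_1)\dots(M-c_k)$. Quasi-greedy expansion. For $q\in(1,M+1]$, $\alpha(q)$ is the lexicographically largest $(a_i)\in\Omega_M$ not ending in $0^\infty$ with $\sum_i a_iq^{-i}=1$. The map $q\mapsto\alpha(q)$ is strictly increasing. We write $\alpha^*$ for the case $M=1$. The set $\mathbf V$. $\mathbf V=\{(c_i)\in\Omega_M:\overline{(c_i)}\preceq\sigma^n((c_i))\preceq(c_i)\ \forall n\ge0\}$, where $\overline{(c_i)}=(M-c_i)$. Fundamental words. A word $a_1\dots a_m$ with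 $m\ge2$ is fundamental if $\overline{a_1\dots a_{m-i}}\preceq a_{i+1}\dots a_m\prec a_1\dots a_{m-i}$ for all $1\le i<m$. When $M\ge2$, a one-letter word $a_1$ is fundamental if $M-a_1\le a_1<M$. $\mathcal A_M$ is the set of fundamental words ($\mathcal A_1$ when $M=1$; every word of $\mathcal A_1$ begins with $1$). For $\mathbf a\in\mathcal A_M$, $J_{\mathbf a}=[q_L(\mathbf a),q_R(\mathbf a)]$ is defined by $\alpha(q_L(\mathbf a))=\mathbf a^\infty$ and $\alpha(q_R(\mathbf a))=\mathbf a^+(\overline{\mathbf a})^\infty$. The graph. Let $G$ be the graph with vertices Start, $A$, $B$ and edges - $e_0$: Start$\to A$, - $e_1$: $A\to B$, - $e_2$: $B\to B$, - $e_3$: $B\to A$, - $e_4$: $A\to A$. It carries two labelings: - $\mathcal L_{\mathbf a}$: $e_0,e_3\mapsto\mathbf a^+$; $e_1\mapsto\overline{\mathbf a^+}$; $e_2\mapsto\mathbf a$; $e_4\mapsto\overline{\mathbf a}$; - $\mathcal L^*$: $e_0,e_3,e_4\mapsto1$; $e_1,e_2\mapsto0$. $X_{\mathbf a}$ is the set of concatenations $\mathcal L_{\mathbf a}(e_{i_1})\mathcal L_{\mathbf a}(e_{i_2})\cdots$ along infinite paths with $i_1=0$. $X^*=\{x\in\{0,1\}^{\mathbb N}:x_1=1\}$. The map $\Phi_{\mathbf a}$. Define $\Phi_{\mathbf a}$ by replacing each $\mathcal L_{\mathbf a}$-label on the path by its $\mathcal L^*$-label. The path is determined by the block word, and $\Phi_{\mathbf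 a}$ is a bijection onto $X^*$. The same rule applies to finite block words along paths starting with $e_0$. Composition. For $\mathbf a\in\mathcal A_M$ and $\mathbf b\in\mathcal A_1$, $\mathbf a\circ\mathbf b:=\Phi_{\mathbf a}^{-1}(\mathbf b)$: the unique word of length $|\mathbf a||\mathbf b|$ that is a prefix of a sequence in $X_{\mathbf a}$ and is mapped by $\Phi_{\mathbf a}$ to $\mathbf b$. Write $(10)^{\circ k}$ for the $k$-fold composition of $10$ with itself, with $(10)^{\circ 0}$ omitted. Irreducibility. $\mathbf a\in\mathcal A_M$ is irreducible if there are no $\mathbf c\in\mathcal A_M$, $\mathbf d\in\mathcal A_1$ with $\mathbf a=\mathbf c\circ\mathbf d$. The unit lift is $\mathbf u=k$ if $M=2k$, and $\mathbf u=(k+1)k$ if $M=2k+1$. $\mathbf a$ is $n$-irreducible ($n\in\mathbb N$) if $\mathbf a=\mathbf u\circ(10)^{\circ(n-1)}\circ\mathbf b$ for some irreducible $\mathbf b\in\mathcal A_1$. $J_{\mathbf a}$ is called irreducible (resp. $n$-irreducible) if $\mathbf a$ is. Special bases. Let $(\tau_i)_{i\ge0}$ with $\tau_i$ = parity of the binary digit sum of $i$ (so $\tau_0=0$ and $\tau_1\tau_2\dots=1101\,0011\dots$). Define \[ \lambda_i=\begin{cases} k+\tau_i-\tau_{i-1}, & M=2k,\\ k+\tau_i, & M=2k+1.\end{cases} \] $q_{KL}$ is defined by $\alpha(q_{KL})=(\lambda_i)$. For $n\ge1$, $q_n'$ is defined by \[ \alpha(q_n')=\lambda_1\dots\lambda_{N}\big(\overline{\lambda_1\dots\lambda_{N}}^+\big)^\infty,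 \] with $N=2^{n-1}$ if $M$ is even and $N=2^n$ if $M$ is odd. Set $q_T:=q_1'$, $q_0':=M+1$, and $I_n:=(q_{n+1}',q_n']$. Entropy. The topological entropy of $X\subset\Omega_M$ is $h(X)=\lim_n\frac1n\log\#B_n(X)$, where $B_n(X)$ is the set of length-$n$ prefixes of sequences in $X$. $\mathbf U_q$ is the set of $(x_i)\in\Omega_M$ such that $\sum x_iq^{-i}$ has a unique expansion $\sum_i y_iq^{-i}$ with $(y_i)\in\Omega_M$. Set $H(q)=h(\mathbf U_q)$ for $q\in(1,M+1]$. An entropy plateau is a maximal (under inclusion) interval on which $H$ is positive and constant. *)

(* Defs.v *)
From HB Require Import structures.
From mathcomp Require Import all_boot all_order all_algebra.
From mathcomp Require Import all_classical all_reals all_analysis.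
Unset Printing Implicit Defensive.
Import Order.TTheory GRing.Theory Num.Theory.
Import numFieldNormedType.Exports.
Local Open Scope classical_set_scope.
Local Open Scope ring_scope.

(* A sequence (c_i)_{i>=1} is represented by c : nat -> nat with c i = c_{i+1}. *)
Definition sq := nat -> nat.
Definition word := seq nat.

Definition inOmega (M : nat) (c : sq) : Prop := forall i, (c i <= M)%N.

Definition lex_lt (c d : sq) : Prop :=
  exists n, (forall i, (i < n)%N -> c i = d i) /\ (c n < d n)%N.
Definition lex_le (c d : sq) : Prop := lex_lt c d \/ (forall i, c i = d i).

Definition pad (w : word) : sq := fun i => nth 0%N w i.
Definition word_lt (c d : word) : Prop := lex_lt (pad c) (pad d).
Definition word_le (c d : word) : Prop := word_lt c d \/ pad c = pad d.

Definition wplus (w : word) : word := rcons (take (size w).-1 w) (last 0%N w).+1.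
Definition wminus (w : word) : word := rcons (take (size w).-1 w) (last 0%N w).-1.
Definition wrefl (M : nat) (w : word) : word := map (fun c => M - c)%N w.

Definition periodic (w : word) : sq := fun i => nth 0%N w (i %% size w).
Definition pre_periodic (u v : word) : sq :=
  fun i => if (i < size u)%N then nth 0%N u i else nth 0%N v ((i - size u) %% size v).

Definition psum (R : realType) (q : R) (c : sq) (n : nat) : R :=
  \sum_(0 <= i < n) (c i)%:R / q ^+ i.+1.
Definition expansion (R : realType) (q : R) (c : sq) (s : R) : Prop :=
  psum R q c @ \oo --> s.

Definition not_end0 (c : sq) : Prop := forall n, exists i, (n <= i)%N /\ c i <> 0%N.

Definition is_alpha (R : realType) (M : nat) (q : R) (a : sq) : Prop :=
  [/\ 1 < q <= (M.+1)%:R, inOmega M a, not_end0 a, expansion R q a 1 &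
      forall b, inOmega M b -> not_end0 b -> expansion R q b 1 -> lex_le b a].

(* the base q with alpha(q) = a (alpha is strictly increasing, hence injective) *)
Definition alpha_inv (R : realType) (M : nat) (a : sq) : R :=
  xget 0 [set q : R | is_alpha R M q a].

Definition fundamental (M : nat) (a : word) : Prop :=
  all (fun c => c <= M)%N a /\
  ( ((2 <= size a)%N /\
      forall i, (1 <= i < size a)%N ->
        word_le (wrefl M (take (size a - i) a)) (drop i a) /\
        word_lt (drop i a) (take (size a - i) a))
  \/ ((2 <= M)%N /\ exists a1, a = [:: a1] /\ (M - a1 <= a1 < M)%N) ).

Definition qL (R : realType) (M : nat) (a : word) : R := alpha_inv R M (periodic a).
Definition qR (R : realType) (M : nat) (a : word) : R :=
  alpha_inv R M (pre_periodic (wplus a) (wrefl M a)).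
Definition Jint (R : realType) (M : nat) (a : word) : set R :=
  [set q | qL R M a <= q <= qR R M a].

Inductive vertex := VStart | VA | VB.
Inductive edge := e0 | e1 | e2 | e3 | e4.
Definition src (e : edge) : vertex :=
  match e with e0 => VStart | e1 => VA | e2 => VB | e3 => VB | e4 => VA end.
Definition tgt (e : edge) : vertex :=
  match e with e0 => VA | e1 => VB | e2 => VB | e3 => VA | e4 => VA end.
Definition La (M : nat) (a : word) (e : edge) : word :=
  match e with
  | e0 | e3 => wplus a
  | e1 => wrefl M (wplus a)
  | e2 => a
  | e4 => wrefl M a
  end.
Definition Lstar (e : edge) : nat :=
  match e with e0 | e3 | e4 => 1%N | e1 | e2 => 0%N end.
(* the (unique) edge leaving v whose L^*-label is x *)
Definition step (v : vertex) (x : nat) : option edge :=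
  match v, x with
  | VStart, 1%N => Some e0
  | VA, 0%N => Some e1
  | VA, 1%N => Some e4
  | VB, 0%N => Some e2
  | VB, 1%N => Some e3
  | _, _ => None
  end.
Fixpoint path_from (v : vertex) (b : word) : seq edge :=
  match b with
  | [::] => [::]
  | x :: b' => match step v x with
               | Some e => e :: path_from (tgt e) b'
               | None => [::]
               end
  end.
(* a o b = Phi_a^{-1}(b): replace the L^*-labels of the path by its L_a-labels *)
Definition compose (M : nat) (a b : word) : word :=
  flatten (map (La M a) (path_from VStart b)).

Definition irreducible (M : nat) (a : word) : Prop :=
  fundamental M a /\
  ~ (exists c d, fundamental M c /\ fundamental 1 d /\ a = compose M c d).

Definition unit_lift (M : nat) : word :=
  if odd M then [:: (M./2).+1; M./2] else [:: M./2].

Definition n_irreducible (M n : nat) (a : word) : Prop :=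
  fundamental M a /\
  exists b, irreducible 1 b /\
    a = compose M (iter n.-1 (fun w => compose M w [:: 1%N; 0%N]) (unit_lift M)) b.

Fixpoint tm_aux (fuel i : nat) : nat :=
  match fuel with
  | 0 => 0
  | f.+1 => if i == 0%N then 0%N else (((odd i : nat) + tm_aux f i./2) %% 2)%N
  end.
Definition tau (i : nat) : nat := tm_aux i i.

(* lambda j = lambda_{j+1} *)
Definition lambda (M : nat) : sq := fun j =>
  if odd M then (M./2 + tau j.+1)%N else (M./2 + tau j.+1 - tau j)%N.

Definition qKL (R : realType) (M : nat) : R := alpha_inv R M (lambda M).

Definition qprime (R : realType) (M n : nat) : R :=
  if n == 0%N then (M.+1)%:R else
  let N := if odd M then (2 ^ n)%N else (2 ^ n.-1)%N in
  let w := mkseq (lambda M) N in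
  alpha_inv R M (pre_periodic w (wplus (wrefl M w))).

Definition qT (R : realType) (M : nat) : R := qprime R M 1.

Definition Ucal (R : realType) (M : nat) (q : R) : set sq :=
  [set x | inOmega M x /\
     forall y s, inOmega M y -> expansion R q x s -> expansion R q y s ->
       forall i, y i = x i].

Definition Bn (M : nat) (X : set sq) (n : nat) : {set n.-tuple 'I_M.+1} :=
  [set w : n.-tuple 'I_M.+1 |
     `[< exists x, X x /\ forall i : 'I_n, x i = val (tnth w i) >]].

Definition entropy (R : realType) (M : nat) (X : set sq) : R :=
  limn (fun n : nat => ln ((#|Bn M X n|)%:R : R) / n%:R).

Definition Hent (R : realType) (M : nat) (q : R) : R := entropy R M (Ucal R M q).

Definition is_interval (R : realType) (I : set R) : Prop :=
  forall x y z : R, I x -> I z -> x <= y <= z -> I y.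

Definition pos_const_interval (R : realType) (M : nat) (I : set R) : Prop :=
  [/\ is_interval R I,
      I `<=` [set q | 1 < q <= (M.+1)%:R],
      (exists x y, I x /\ I y /\ x < y),
      (forall x, I x -> 0 < Hent R M x) &
      (forall x y, I x -> I y -> Hent R M x = Hent R M y)].

Definition plateau (R : realType) (M : nat) (I : set R) : Prop :=
  pos_const_interval R M I /\
  forall J, pos_const_interval R M J -> I `<=` J -> J = I.

(* Main.v *)
Require Import Defs.
From HB Require Import structures.
From mathcomp Require Import all_boot all_order all_algebra.
From mathcomp Require Import all_classical all_reals all_analysis.
From mathcomp Require Import zify ring lra.
Import Order.TTheory GRing.Theory Num.Theory.
Import numFieldNormedType.Exports.

(** A base q is studied through alpha = alpha(q). Up to prefixes that do not affect the
entropy, U_q is the subshift of the sequences all of whose shifts lie between the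
reflection of alpha and alpha. If alpha lies between a^oo and a^+ (refl a)^oo, a
sequence of this subshift either stays between refl(a^oo) and a^oo, or is eventually
coded by a binary sequence through the block substitution of a. For a irreducible the
first kind wins, because its entropy is at least log 2 / |a|: so H is constant on J_a.
Irreducibility also gives the subshift of a^oo a specification property, by which
forbidding one of its words strictly lowers the entropy: so H is strictly smaller to the
left of J_a. For a word c o b, where c is one of the Thue-Morse words u o (10)^k, the
subshift of c^oo has entropy zero, and the same two arguments apply to the binary words
b coding the second kind.

Finally, between two bases of (q'_{n+1}, q'_n] that do not lie in one common
n-irreducible interval there is the left end point of such an interval; this forces the
plateaus to be the n-irreducible intervals. The words u o (10)^k, whose intervals
contain q_KL in their interior, are the only irreducible or n-irreducible ones that have
to be excluded. *)

Set Implicit Arguments.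
Unset Strict Implicit.
(* [all_analysis] also defines a [periodic] *)
Local Notation periodic := Defs.periodic.
Local Open Scope nat_scope.

(** * Lexicographic order *)

(** Strict growth of [H] is proved only on one side of an interval: lowering alpha below a^oo
    forbids a prefix of a^oo. Beyond the right end no comparison of entropies is made. Instead a
    further left end is found before the given base, and there [H] is strictly larger than at all
    bases to its left. Hence the weight of the search for fundamental words between two sequences.
    The candidates are the truncations a_1 .. a_N^- of the larger sequence; when none of them lies
    between the two, both sequences lie between c^oo and (c o 10)^oo for some fundamental c, hence
    in the interval of c.

    The obstacle to specification is a word ending in a prefix a_1 .. a_j whose lowered form w = a_1
    .. a_j^- is itself fundamental: there the last letter may not be lowered. Irreducibility places
    a^oo strictly beyond the right end of the interval of w, so that w^+ followed by reflected
    copies of w is a way out.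

    Existence of the entropy limit comes from Fekete's lemma, U_q being invariant under the shift;
    all the rest is inequalities between numbers of words. *)

Definition sh (n : nat) (x : sq) : sq := fun i => x (n + i).
Definition rf (M : nat) (x : sq) : sq := fun i => M - x i.
(** The deciding position is part of the relation: when sequences are glued, it matters that a
    comparison is settled before a given index. *)
Definition lt_at (x y : sq) (k : nat) : Prop :=
  (forall i, i < k -> x i = y i) /\ x k < y k.
Definition lle (x y : sq) : Prop := forall k, ~ lt_at y x k.

Lemma shE n x i : sh n x i = x (n + i). Proof. by []. Qed.

Lemma sh0 x : sh 0 x = x. Proof. by apply: funext. Qed.

Lemma sh_sh i j x : sh i (sh j x) = sh (j + i) x.
Proof. by apply: funext => k; rewrite /sh addnA. Qed.

Lemma sh_rf M n x : sh n (rf M x) = rf M (sh n x).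
Proof. by []. Qed.

Lemma rfK M x : inOmega M x -> rf M (rf M x) = x.
Proof. by move=> h; apply: funext => i; rewrite /rf; have := h i; lia. Qed.

Lemma rf_le M x : inOmega M (rf M x).
Proof. by move=> i; rewrite /rf leq_subr. Qed.

Lemma sh_le M n x : inOmega M x -> inOmega M (sh n x).
Proof. by move=> h i; apply: h. Qed.

Lemma cmpn x y n : (exists2 k, k < n & lt_at x y k) \/ (exists2 k, k < n & lt_at y x k)
   \/ (forall k, k < n -> x k = y k).
Proof.
elim: n => [|n IH]; first by right; right.
case: IH => [[k kn h]|[[k kn h]|h]].
- by left; exists k => //; lia.
- by right; left; exists k => //; lia.
case: (ltngtP (x n) (y n)) => hn.
- by left; exists n.
- right; left; exists n => //; split => // i hi; by rewrite h.
- right; right => k; rewrite ltnS leq_eqVlt => /orP[/eqP ->//|]; exact: h.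
Qed.

Lemma lt_at_asym x y k l : lt_at x y k -> lt_at y x l -> False.
Proof.
move=> [h1 h2] [h3 h4]; case: (ltngtP k l) => kl.
- by have := h3 _ kl; lia.
- by have := h1 _ kl; lia.
- by subst; lia.
Qed.

Lemma lt_at_ext x y x' y' k : lt_at x y k -> (forall i, i <= k -> x i = x' i) ->
  (forall i, i <= k -> y i = y' i) -> lt_at x' y' k.
Proof.
move=> [h1 h2] hx hy; split; last by rewrite -hx// -hy.
by move=> i ik; rewrite -hx ?(ltnW ik)// -hy ?(ltnW ik)//; exact: h1.
Qed.

(** The first inequality is needed only up to the place [n] that decides the second one, and the
    conclusion is decided no later. *)
Lemma trans_n x y z n : (forall k, k <= n -> ~ lt_at y x k) -> lt_at y z n ->
  exists2 k, k <= n & lt_at x z k.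
Proof.
move=> h [h1 h2].
case: (cmpn x y n.+1) => [[k kn [h3 h4]]|[[k kn h3]|h3]].
- exists k => //; case: (ltngtP k n) => kn'.
  + split => [i ik|]; first by rewrite h3 // h1 //; lia.
    by rewrite -h1.
  + lia.
  + subst k; split => [i ik|]; first by rewrite h3 // h1.
    lia.
- by case: (h k).
- exists n => //; split => [i ik|]; first by rewrite h3 ?h1//; lia.
  by rewrite h3.
Qed.

Lemma trans_n2 x y z n : lt_at x y n -> (forall k, k <= n -> ~ lt_at z y k) ->
  exists2 k, k <= n & lt_at x z k.
Proof.
move=> [h1 h2] h.
case: (cmpn y z n.+1) => [[k kn [h3 h4]]|[[k kn h3]|h3]].
- exists k => //; case: (ltngtP k n) => kn'.
  + split => [i ik|]; first by rewrite h1 ?h3//; lia.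
    by rewrite h1.
  + lia.
  + subst k; split => [i ik|]; first by rewrite h1 // h3.
    lia.
- by case: (h k).
- exists n => //; split => [i ik|]; first by rewrite h1 ?h3//; lia.
  by rewrite -h3.
Qed.

Lemma llt_trich x y : lex_lt x y \/ x = y \/ lex_lt y x.
Proof.
have [h|h] := pselect (exists n, x n <> y n); last first.
  right; left; apply: funext => n; apply: contrapT => hn; apply: h; by exists n.
have [n hn] := h.
case: (cmpn x y n.+1) => [[k _ hk]|[[k _ hk]|hk]].
- by left; exists k.
- by right; right; exists k.
- by case: hn; apply: hk.
Qed.

Lemma lleP x y : lle x y <-> lex_lt x y \/ x = y.
Proof.
split=> [h|[[k hk]|-> k]].
- case: (llt_trich x y) => [|[->|[k hk]]]; [by left|by right|].
  by case: (h k).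
- move=> l hl; exact: (lt_at_asym hk hl).
- by case; lia.
Qed.

Lemma lle_refl x : lle x x. Proof. by apply/lleP; right. Qed.

Lemma lltW x y : lex_lt x y -> lle x y. Proof. by move=> h; apply/lleP; left. Qed.

Lemma llt_nle x y : lex_lt x y <-> ~ lle y x.
Proof.
split=> [[k hk] h|h]; first by case: (h k).
by apply: contrapT => h'; apply: h => k hk; apply: h'; exists k.
Qed.

Lemma lle_nlt x y : lle x y <-> ~ lex_lt y x.
Proof.
split=> [h [k hk]|h k hk]; first by case: (h k).
by apply: h; exists k.
Qed.

Lemma lle_lt_trans x y z : lle x y -> lex_lt y z -> lex_lt x z.
Proof. by move=> h [n hn]; have [//|k _ hk] := @trans_n x y z n _ hn; exists k. Qed.

Lemma llt_le_trans x y z : lex_lt x y -> lle y z -> lex_lt x z.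
Proof. by move=> [n hn] h; have [//|k _ hk] := @trans_n2 x y z n hn; exists k. Qed.

Lemma lle_trans x y z : lle x y -> lle y z -> lle x z.
Proof. move=> h /lleP[h'|<-//]; apply/lltW; exact: lle_lt_trans h h'. Qed.

Lemma llt_trans x y z : lex_lt x y -> lex_lt y z -> lex_lt x z.
Proof. by move=> /lltW; exact: lle_lt_trans. Qed.

Lemma lle_anti x y : lle x y -> lle y x -> x = y.
Proof. by move=> /lleP[/llt_nle|//]. Qed.

Lemma llt_irr x : ~ lex_lt x x.
Proof. by move=> [k []]; lia. Qed.

Lemma lle_total x y : lle x y \/ lex_lt y x.
Proof. by have [|/llt_nle] := pselect (lle x y); [left|right]. Qed.

Lemma lex_leE x y : lex_le x y <-> lle x y.
Proof.
rewrite lleP /lex_le; split=> -[h|h]; [by left|by right; apply: funext|by left|].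
by right; rewrite h.
Qed.

Lemma lt_at_rf M x y k : inOmega M x -> inOmega M y ->
  lt_at x y k -> lt_at (rf M y) (rf M x) k.
Proof.
move=> hx hy [h1 h2]; split => [i ik|]; rewrite /rf; first by rewrite h1.
by have := hx k; have := hy k; lia.
Qed.

Lemma llt_rf M x y : inOmega M x -> inOmega M y -> lex_lt x y -> lex_lt (rf M y) (rf M x).
Proof. by move=> hx hy [k /(lt_at_rf hx hy)]; exists k. Qed.

Lemma lle_rf M x y : inOmega M x -> inOmega M y -> lle x y -> lle (rf M y) (rf M x).
Proof.
by move=> hx hy /lleP[/(llt_rf hx hy) /lltW//|->]; exact: lle_refl.
Qed.

Lemma lt_at_sh n x y k : (forall i, i < n -> x i = y i) ->
  lt_at (sh n x) (sh n y) k -> lt_at x y (n + k).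
Proof.
move=> h [h1 h2]; split => // i ik; case: (ltnP i n) => [|hi]; first exact: h.
by have := h1 (i - n); rewrite /sh subnKC//; apply; lia.
Qed.

Lemma lt_at_shE n x y k : (forall i, i < n -> x i = y i) ->
  lt_at x y k -> n <= k /\ lt_at (sh n x) (sh n y) (k - n).
Proof.
move=> h [h1 h2]; have nk : n <= k by case: (leqP n k) => // /h; lia.
split => //; split => [i ik|]; rewrite /sh; first by apply: h1; lia.
by rewrite subnKC.
Qed.

Lemma lle_sh n x y : (forall i, i < n -> x i = y i) -> lle x y <-> lle (sh n x) (sh n y).
Proof.
move=> h; have h' i : i < n -> y i = x i by move/h.
split=> [hl k hk|hl k hk].
- by case: (hl _ (lt_at_sh h' hk)).
- by have [_ /hl] := lt_at_shE h' hk.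
Qed.

Lemma llt_sh n x y : (forall i, i < n -> x i = y i) -> lex_lt x y <-> lex_lt (sh n x) (sh n y).
Proof.
move=> h; have h' i : i < n -> y i = x i by move/h.
have e := lle_sh h'; split=> /llt_nle h1; apply/llt_nle => h2; apply: h1; exact/e.
Qed.

Lemma lle_sh1 x y : lle x y -> x 0 = y 0 -> lle (sh 1 x) (sh 1 y).
Proof. move=> h h0; apply: (lle_sh (n := 1) (x := x) _).1 => // -[] //. Qed.

Lemma lle_head x y : lle x y -> x 0 <= y 0.
Proof. by move=> h; rewrite leqNgt; apply/negP => h0; apply: (h 0). Qed.

Lemma llt_head x y : x 0 < y 0 -> lex_lt x y.
Proof. by exists 0. Qed.

(** * Fundamental words and block substitution *)

(* [x] is the periodic extension of a fundamental word of length [m]. *)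
Record fund (M m : nat) (x : sq) : Prop := Fund {
  fund_m : 0 < m;
  fund_per : sh m x = x;
  fund_le : inOmega M x;
  fund_up : forall l, 0 < l < m -> exists2 k, l + k < m & lt_at (sh l x) x k;
  fund_lo : forall l k, 0 < l < m -> l + k < m -> ~ lt_at (sh l x) (rf M x) k;
  fund_last : x m.-1 < M;
  fund_1 : m = 1 -> M - x 0 <= x 0 }.

Lemma sh_per m x k : sh m x = x -> sh (m * k) x = x.
Proof.
move=> h; elim: k => [|k IH]; first by rewrite muln0 sh0.
by rewrite mulnS -sh_sh h.
Qed.

Lemma sh_mod m x l : sh m x = x -> sh l x = sh (l %% m) x.
Proof. by move=> h; rewrite {1}(divn_eq l m) -sh_sh mulnC sh_per. Qed.

Lemma per_mod m x i : sh m x = x -> x i = x (i %% m).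
Proof. by move=> h; have := congr1 (fun f => f 0) (sh_mod i h); rewrite /sh !addn0. Qed.

Section FundTheory.
Variables (M m : nat) (c : sq).
Hypothesis F : fund M m c.

Lemma fund_shlt l : l %% m != 0 -> exists2 k, l %% m + k < m & lt_at (sh l c) c k.
Proof.
move=> h; have m0 := fund_m F.
rewrite (sh_mod l (fund_per F)); apply: (fund_up F).
by rewrite lt0n h ltn_mod.
Qed.

Lemma fund_shle l : lle (sh l c) c.
Proof.
have [h|/fund_shlt[k _ hk]] := eqVneq (l %% m) 0; last by apply/lltW; exists k.
by rewrite (sh_mod l (fund_per F)) h sh0; apply: lle_refl.
Qed.

(** The definition gives the lower bound only inside one period. A violation running past the end of
    the period becomes, after reflection, a violation by another shift at a smaller position; hence
    the induction on the position [t]. *)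
Lemma fund_rf l : lle (rf M c) (sh l c).
Proof.
move=> t; elim/ltn_ind: t l => t IH l; have m0 := fund_m F.
rewrite (sh_mod l (fund_per F)).
have [->|h] := eqVneq (l %% m) 0; last first.
  have lm : 0 < l %% m < m by rewrite lt0n h ltn_mod.
  case: (ltnP (l %% m + t) m) => ht; first exact: (fund_lo F).
  move=> hc; case: (@lt_at_shE (m - l %% m) _ _ _ _ hc).
    by move=> i hi; case: hc => h1 _; apply: h1; lia.
  move=> _; rewrite sh_sh subnKC ?(fund_per F); last by lia.
  rewrite sh_rf => /(lt_at_rf (fund_le F) (@rf_le M _)).
  rewrite rfK; last exact/sh_le/(fund_le F).
  by apply: IH; lia.
rewrite sh0; have [m1|m1] := eqVneq m 1.
  have h0 i : c i = c 0.
    by rewrite (per_mod i (fund_per F)) m1 modn1.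
  by move=> [_]; rewrite /rf h0; have := fund_1 F m1; lia.
have l1 : 0 < 1 < m by lia.
have [k k1 hk] := fund_up F l1.
have [|k' _ hk'] := @trans_n (rf M c) (sh 1 c) c k _ hk.
  by move=> k' kk'; apply: (fund_lo F) => //; lia.
exact: lt_at_asym hk'.
Qed.

Lemma fund_rfle l : lle (sh l (rf M c)) c.
Proof.
rewrite sh_rf -[X in lle _ X](@rfK M); last exact: fund_le F.
apply: lle_rf; [exact: rf_le|exact/sh_le/(fund_le F)|exact: fund_rf].
Qed.

Lemma fund_rfrf l : lle (rf M c) (sh l (rf M c)).
Proof.
rewrite sh_rf; apply: lle_rf; [exact/sh_le/(fund_le F)|exact: fund_le F|exact: fund_shle].
Qed.

End FundTheory.
Arguments fund_shle [M m c] F l _ _.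
Arguments fund_rf [M m c] F l _ _.
Arguments fund_rfle [M m c] F l _ _.
Arguments fund_rfrf [M m c] F l _ _.

Lemma fund_eq_len M m m' x : fund M m x -> fund M m' x -> m = m'.
Proof.
wlog h : m m' / m < m'.
  by move=> W F F'; case: (ltngtP m m') => // h; [exact: W|symmetry; exact: W].
move=> F F'; have [|k _ hk] := @fund_up _ _ _ F' m; first by rewrite (fund_m F).
by move: hk; rewrite (fund_per F) => -[]; lia.
Qed.

Definition prevd (p : nat) (d : sq) (j : nat) : nat := if j is j'.+1 then d j' else p.

(* [psi M m c p d] is the concatenation of the blocks coded by [d], starting at
   the vertex B if [p = 0] and A if [p = 1]; the vertex reached before the block
   [j] is B or A according to the previous code letter. *)
Definition psi (M m : nat) (c : sq) (p : nat) (d : sq) : sq := fun i =>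
  let q := prevd p d (i %/ m) in
  let e := c (i %% m) + ((d (i %/ m) != q) && (i %% m == m.-1)) in
  if q == 0 then e else M - e.

Definition bin (d : sq) := inOmega 1 d.
Definition k0 : sq := fun _ => 0.
Definition k1 : sq := fun _ => 1.

Lemma bin_k1 d : bin d -> lle d k1.
Proof. by move=> bd t [_]; have := bd t; rewrite /k1; lia. Qed.

Lemma bink1 : bin k1. Proof. by []. Qed.
Lemma bin_sh n d : bin d -> bin (sh n d). Proof. by move=> h; apply: sh_le. Qed.
Lemma bin_rf d : bin (rf 1 d). Proof. by apply: rf_le. Qed.
Lemma bin_prevd p d j : p <= 1 -> bin d -> prevd p d j <= 1.
Proof. by case: j => //= j _ h; apply: h. Qed.
Lemma bin01 d i : bin d -> d i = 0 \/ d i = 1.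
Proof. by move=> h; have := h i; case: (d i) => [|[|]]; auto. Qed.

Section Psi.
Variables (M m : nat) (c : sq).
Hypothesis F : fund M m c.
Let m0 : 0 < m := fund_m F.

Lemma psi_sh p d n : sh (m * n) (psi M m c p d) = psi M m c (prevd p d n) (sh n d).
Proof.
have e j : prevd p d (n + j) = prevd (prevd p d n) (sh n d) j.
  by case: j => [|j] /=; rewrite ?addn0 // addnS.
by apply: funext => i; rewrite /sh /psi mulnC divnMDl // modnMDl e.
Qed.

Lemma psi_lt p d i : i < m -> psi M m c p d i =
  let e := c i + ((d 0 != p) && (i == m.-1)) in if p == 0 then e else M - e.
Proof. by move=> im; rewrite /psi divn_small // modn_small. Qed.

Lemma psi_le p d : inOmega M (psi M m c p d).
Proof.
move=> i; rewrite /psi; have := fund_le F (i %% m); have := fund_last F.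
by case: (eqVneq (i %% m) m.-1) => [->|_]; case: (prevd _ _ _ == 0);
  case: (d _ != _) => /=; lia.
Qed.

Lemma psi_rf p d : p <= 1 -> bin d -> rf M (psi M m c p d) = psi M m c (1 - p) (rf 1 d).
Proof.
move=> hp hd; apply: funext => i; rewrite /rf /psi.
have := fund_le F (i %% m); have hl := fund_last F.
have -> : prevd (1 - p) (fun i0 => 1 - d i0) (i %/ m) = 1 - prevd p d (i %/ m).
  by case: (i %/ m).
have := bin_prevd (i %/ m) hp hd; have := hd (i %/ m).
move: (prevd _ _ _) (d _) => q e he hq hc.
case: (eqVneq (i %% m) m.-1) => h; rewrite ?h ?andbT ?andbF ?addn0; last by case: q hq => [|[|]] //= _; lia.
by move: q e he hq => [|[|q]] [|[|e]] //= _ _; lia.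
Qed.

(** Up to the first difference of the codes the two paths visit the same vertices. The two blocks
    leaving a vertex differ only in the last letter, and from either vertex the one coded by 1 is
    the larger. *)
Lemma psi_mono p d d' k : p <= 1 -> bin d -> bin d' -> lt_at d d' k ->
  lt_at (psi M m c p d) (psi M m c p d') (m * k + m.-1).
Proof.
move=> hp bd bd' [h1 h2].
have hpr j : j <= k -> prevd p d j = prevd p d' j by case: j => //= j; exact: h1.
have [dk dk'] : d k = 0 /\ d' k = 1 by have := bd k; have := bd' k; lia.
split=> [i hi|].
  have ik : i %/ m <= k by rewrite -ltnS ltn_divLR // mulSn; lia.
  rewrite /psi -hpr //; case: (ltngtP (i %/ m) k) ik => // [ik _|ik _]; first by rewrite h1.
  have -> : (i %% m == m.-1) = false.
    by apply/eqP => e; move: hi; rewrite {1}(divn_eq i m) ik e mulnC; lia.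
  by rewrite !andbF.
rewrite /psi [m * k]mulnC divnMDl // modnMDl modn_small ?prednK// divn_small ?prednK// addn0.
rewrite dk dk' -hpr // eqxx !andbT; have := bin_prevd k hp bd; have := fund_last F.
by case: (prevd p d k) => [|[|]] //=; lia.
Qed.

Lemma psi_llt p d d' : p <= 1 -> bin d -> bin d' ->
  lex_lt (psi M m c p d) (psi M m c p d') <-> lex_lt d d'.
Proof.
move=> hp bd bd'; have W e e' : bin e -> bin e' -> lex_lt e e' ->
  lex_lt (psi M m c p e) (psi M m c p e').
  by move=> be be' [k /(psi_mono hp be be') h]; exists (m * k + m.-1).
split; last exact: W.
case: (llt_trich d d') => [//|[->/llt_irr//|/(W _ _ bd' bd)]].
by move=> /lltW/lle_nlt.
Qed.

Lemma psi_lle p d d' : p <= 1 -> bin d -> bin d' ->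
  lle (psi M m c p d) (psi M m c p d') <-> lle d d'.
Proof.
move=> hp bd bd'; have e := psi_llt hp bd' bd.
by split=> /lle_nlt h; apply/lle_nlt => /e.
Qed.

Lemma psi_inj p d d' : p <= 1 -> bin d -> bin d' ->
  psi M m c p d = psi M m c p d' -> d = d'.
Proof.
move=> hp bd bd' e; apply: lle_anti; apply/(psi_lle hp) => //; rewrite e; exact: lle_refl.
Qed.

Lemma psi_agree p d d' n : (forall i, i < n -> d i = d' i) ->
  forall i, i < m * n -> psi M m c p d i = psi M m c p d' i.
Proof.
move=> h i hi; have ik : i %/ m < n by rewrite ltn_divLR // mulnC.
rewrite /psi h //; have -> // : prevd p d (i %/ m) = prevd p d' (i %/ m).
by case: (i %/ m) ik => //= j jn; rewrite h //; lia.
Qed.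

Lemma psi0 : psi M m c 0 k0 = c.
Proof.
apply: funext => i; rewrite /psi /=; have -> : prevd 0 k0 (i %/ m) = 0 by case: (i %/ m).
by rewrite eqxx addn0 -(per_mod i (fund_per F)).
Qed.

(* [cR] is [c^+] followed by the periodic reflection of [c], that is [alpha(q_R)]. *)
Definition cR : sq := psi M m c 0 k1.

Lemma cR_lt i : i < m -> cR i = c i + (i == m.-1).
Proof. by move=> im; rewrite /cR psi_lt. Qed.

Lemma cR_sh : sh m cR = rf M c.
Proof.
by have := psi_sh 0 k1 1; rewrite muln1 => ->; rewrite -{2}psi0 psi_rf.
Qed.

Lemma c_cR : lex_lt c cR.
Proof. by rewrite -psi0; apply/psi_llt => //; exists 0; split. Qed.

Lemma rfc_c : lle (rf M c) c.
Proof. by have := fund_rfle F 0; rewrite sh0. Qed.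

(* Away from the block boundaries, every window of length [m] is strictly between
   the reflection of [c^+] and [c^+]. *)
Lemma NB_up p d i : p <= 1 -> bin d -> i %% m != 0 ->
  exists2 k, k < m & lt_at (sh i (psi M m c p d)) cR k.
Proof.
move=> hp bd hi.
rewrite {1}(divn_eq i m) mulnC -sh_sh psi_sh.
have := bin_prevd (i %/ m) hp bd; have := bin_sh (i %/ m) bd.
move: (prevd _ _ _) (sh _ _) => q {}d {}bd hq {hp p}.
move: (i %% m) hi (ltn_pmod i m0) => r r0 rm {i}.
have [|k0 hk0 [hk1 hk2]] := @fund_up _ _ _ F r; first by rewrite lt0n r0.
have digX k : k < m - r -> sh r (psi M m c q d) k = let e := c (r + k) + ((d 0 != q) && (r + k == m.-1)) in
   if q == 0 then e else M - e.
  by move=> hk; rewrite /sh psi_lt //; lia.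
have digY k : m - r <= k -> k < m -> sh r (psi M m c q d) k = if d 0 == 0 then c (k - (m - r)) else M - c (k - (m - r)).
  move=> h1 h2; rewrite /sh.
  have -> : r + k = m * 1 + (k - (m - r)) by lia.
  rewrite -shE psi_sh psi_lt /=; last by lia.
  have -> : (k - (m - r) == m.-1) = false by apply/eqP; lia.
  by rewrite andbF addn0.
have up k : k < m -> c k <= cR k by move=> h; rewrite cR_lt // leq_addr.
have upE k : k < m.-1 -> cR k = c k.
  by move=> h; rewrite cR_lt; [rewrite (_ : (k == m.-1) = false) ?addn0 //; apply/eqP; lia|lia].
(* the case where the end of the first block reproduces a prefix of [c^+] *)
have tie : (forall k, k < m - r -> sh r (psi M m c q d) k = c k) -> d 0 = 1 ->
    exists2 k, k < m & lt_at (sh r (psi M m c q d)) cR k.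
  move=> hX d1; have lo := fund_rf F (m - r).
  case: (cmpn (rf M c) (sh (m - r) c) r) => [[t tr [ht1 ht2]]|[[t tr /lo//]|hE]].
  - exists (m - r + t); first by lia.
    split=> [k hk|].
      case: (ltnP k (m - r)) => hk'; first by rewrite hX // upE //; lia.
      rewrite digY // ?d1 /=; last by lia.
      rewrite upE; last by lia.
      have := ht1 (k - (m - r)); rewrite /rf /sh; have -> : m - r + (k - (m - r)) = k by lia.
      by apply; lia.
    rewrite digY ?d1 /=; try lia.
    have := up (m - r + t); move: ht2; rewrite /rf /sh addnC addnK; lia.
  (* Even if all these letters agree, [cR] wins at the last place of the window, where it exceeds
     [c] by one. *)
  - exists m.-1; first by lia.
    split=> [k hk|].
      case: (ltnP k (m - r)) => hk'; first by rewrite hX // upE //; lia.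
      rewrite digY // ?d1 /=; last by lia.
      rewrite upE; last by lia.
      have := hE (k - (m - r)); rewrite /rf /sh; have -> : m - r + (k - (m - r)) = k by lia.
      by apply; lia.
    rewrite digY ?d1 /=; try lia.
    have -> : m.-1 - (m - r) = r.-1 by lia.
    have := hE r.-1; rewrite /rf /sh; have -> : m - r + r.-1 = m.-1 by lia.
    by rewrite cR_lt ?eqxx; lia.
case: q hq digX digY tie => [|[|]] //= _ digX digY tie.
- have [d0|d1] := bin01 0 bd.
    exists k0; first by lia.
    split=> [k hk|]; rewrite digX ?d0 ?addn0; try lia.
      by rewrite upE; [exact: hk1|lia].
    by apply: leq_trans hk2 _; apply: up; lia.
  case: (ltngtP (r + k0) m.-1) => hk3.
  + exists k0; first by lia.
    split=> [k hk|]; rewrite digX ?d1 /=; try lia.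
      have -> : (r + k == m.-1) = false by apply/eqP; lia.
      by rewrite addn0 upE; [exact: hk1|lia].
    have -> : (r + k0 == m.-1) = false by apply/eqP; lia.
    by rewrite addn0 upE; [exact: hk2|lia].
  + lia.
  + case: (ltnP (c m.-1).+1 (c k0)) => hc.
      exists k0; first by lia.
      split=> [k hk|]; rewrite digX ?d1 /=; try lia.
        have -> : (r + k == m.-1) = false by apply/eqP; lia.
        by rewrite addn0 upE; [exact: hk1|lia].
      by rewrite hk3 eqxx addn1 upE //; lia.
    apply: tie => // k hk; rewrite digX ?d1 //=.
    case: (ltngtP k k0) => hk4; last 1 first.
    - subst k; rewrite hk3 eqxx addn1; move: hk2; rewrite /sh hk3; lia.
    - have -> : (r + k == m.-1) = false by apply/eqP; lia.
      by rewrite addn0; exact: hk1.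
    - lia.
- have lo := fund_rf F r.
  have lo' := fund_rfle F r.
  have digX' k : k < m - r -> sh r (psi M m c 1 d) k <= sh r (rf M c) k.
    by move=> hk; rewrite digX // /sh /rf; lia.
  have digX2 k : r + k < m.-1 -> sh r (psi M m c 1 d) k = sh r (rf M c) k.
    move=> hk; rewrite digX // ?/sh ?/rf; last by lia.
    have -> : (r + k == m.-1) = false by apply/eqP; lia.
    by rewrite andbF addn0.
  case: (cmpn (sh r (rf M c)) c (m - r)) => [[t tr [ht1 ht2]]|[[t tr /lo'//]|hE]].
    exists t; first by lia.
    split=> [k hk|]; first by rewrite digX2 ?ht1 ?upE //; lia.
    by apply: leq_ltn_trans (digX' _ tr) _; apply: leq_trans ht2 _; apply: up; lia.
  have [d0|d1] := bin01 0 bd; last first.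
    apply: tie => // k hk; rewrite -hE // digX // d1 /=; by rewrite addn0.
  exists (m - r.+1); first by lia.
  split=> [k hk|]; first by rewrite digX2 ?hE ?upE //; lia.
  rewrite upE; last by lia.
  rewrite -hE; last by lia.
  rewrite digX ?d0 /=; last by lia.
  have -> : r + (m - r.+1) = m.-1 by lia.
  rewrite eqxx addn1 /sh /rf; have -> : r + (m - r.+1) = m.-1 by lia.
  by have := fund_last F; lia.
Qed.

Lemma NB_lo p d i : p <= 1 -> bin d -> i %% m != 0 ->
  exists2 k, k < m & lt_at (rf M cR) (sh i (psi M m c p d)) k.
Proof.
move=> hp bd hi.
have [|k km hk] := @NB_up (1 - p) (rf 1 d) i _ (bin_rf d) hi; first by lia.
exists k => //; have := lt_at_rf (sh_le i (@psi_le _ _)) (@psi_le _ _) hk.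
by rewrite -[X in lt_at _ X]sh_rf (psi_rf (leq_subr _ _) (bin_rf d)) rfK // subKn.
Qed.

End Psi.

(** * Subshifts between the reflection of a sequence and the sequence *)

Definition W (M : nat) (a x : sq) : Prop :=
  forall i, lle (sh i x) a /\ lle (rf M a) (sh i x).
(** For [a] = alpha(q) these two sets enclose U_q: [Ws] is contained in it, and a sequence of U_q
    that is not constantly 0 or [M] falls into [W] after an initial run of one of these digits and
    one further digit. *)
Definition Ws (M : nat) (a x : sq) : Prop :=
  forall i, lex_lt (sh i x) a /\ lex_lt (rf M a) (sh i x).

Lemma W_le M a x : inOmega M a -> W M a x -> inOmega M x.
Proof.
move=> ha h i; have [/lle_head + _] := h i; rewrite /sh addn0.
by move/leq_trans; apply.
Qed.

Lemma W_sh M a x n : W M a x -> W M a (sh n x).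
Proof. by move=> h i; rewrite sh_sh; apply: h. Qed.

Lemma W_rf M a x : inOmega M a -> W M a x -> W M a (rf M x).
Proof.
move=> ha h i; have hx := W_le ha h; have [h1 h2] := h i; rewrite sh_rf; split.
  by rewrite -[X in lle _ X](rfK ha); apply: lle_rf h2; [exact: rf_le|exact: sh_le].
by apply: lle_rf h1 => //; exact: sh_le.
Qed.

Lemma WsW M a x : Ws M a x -> W M a x.
Proof. by move=> h i; have [/lltW + /lltW] := h i. Qed.

Lemma W_mono M a b x : inOmega M a -> inOmega M b -> lle a b -> W M a x -> W M b x.
Proof.
move=> ha hb ab h i; have [h1 h2] := h i; split; first exact: lle_trans h1 ab.
exact: lle_trans (lle_rf ha hb ab) h2.
Qed.

Lemma W_Ws M a b x : inOmega M a -> inOmega M b -> lex_lt a b -> W M a x -> Ws M b x.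
Proof.
move=> ha hb ab h i; have [h1 h2] := h i; split; first exact: lle_lt_trans h1 ab.
exact: llt_le_trans (llt_rf ha hb ab) h2.
Qed.

Lemma Ws_mono M a b x : inOmega M a -> inOmega M b -> lle a b -> Ws M a x -> Ws M b x.
Proof.
move=> ha hb ab h i; have [h1 h2] := h i; split; first exact: llt_le_trans h1 ab.
exact: lle_lt_trans (lle_rf ha hb ab) h2.
Qed.

Lemma fund_W M m x : fund M m x -> W M x x.
Proof. by move=> F i; split; [exact: (fund_shle F i)|exact: (fund_rf F i)]. Qed.

Lemma fund_of M m x : 0 < m -> sh m x = x -> inOmega M x ->
  (forall l, 0 < l < m -> lex_lt (sh l x) x) -> W M x x -> x m.-1 < M -> fund M m x.
Proof.
move=> m0 hp hl hu hW hlast; split => //.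
- move=> l lm; have [t ht] := hu l lm; exists t => //.
  rewrite ltnNge; apply/negP => tl.
  have [|_] := @lt_at_shE (m - l) _ _ _ _ ht; first by move=> i hi; apply: ht.1; lia.
  rewrite sh_sh subnKC ?hp; last by lia.
  by move=> h; have [/(_ _ h)] := hW (m - l).
- by move=> l k lm lk h; have [_ /(_ _ h)] := hW l.
- by move=> m1; have [_ /lle_head] := hW 0; rewrite sh0.
Qed.

Lemma bin_sh1 b : bin b -> b 0 = 1 -> lle (sh 1 b) b.
Proof.
move=> bb b0 k [h1 h2].
have H j : j <= k -> b j = 1.
  elim: j => // j IH jk; rewrite -IH; last by lia.
  by have := h1 j jk; rewrite /sh add1n => ->.
by have := H k (leqnn _); have := bb k.+1; rewrite /sh add1n in h2; lia.
Qed.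

(** At each vertex the coded sequence yields only one of the two bounds on the code. The other
    follows from the bounds one place earlier: the letter just read equals the first letter of the
    bound and can be cancelled, and [sh 1 b] is at most [b]. *)
Lemma codeW b d : bin b -> b 0 = 1 -> bin d -> d 0 = 1 ->
  (forall i, prevd 0 d i = 0 -> lle (sh i d) b) ->
  (forall i, prevd 0 d i = 1 -> lle (rf 1 b) (sh i d)) -> W 1 b d.
Proof.
move=> bb b0 bd d0 hu hl; elim=> [|i [IH1 IH2]].
  split; first exact: hu.
  by rewrite sh0; apply/lltW/llt_head; rewrite /rf b0 d0.
have e : sh i.+1 d = sh 1 (sh i d) by rewrite sh_sh addn1.
have sb := bin_sh1 bb b0; have [h|h] := bin01 i bd; split.
- exact: hu.
- rewrite e; apply: (@lle_trans _ (sh 1 (rf 1 b))).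
    rewrite sh_rf; apply: lle_rf sb => //; exact: bin_sh.
  by apply: lle_sh1 => //; rewrite /rf /sh addn0 h b0.
- rewrite e; apply: (lle_trans _ sb); apply: lle_sh1 => //.
  by rewrite /sh addn0 h b0.
- exact: hl.
Qed.

Section Comp.
Variables (M m : nat) (c : sq).
Hypothesis F : fund M m c.
Let m0 : 0 < m := fund_m F.
Notation psi := (psi M m c).
Notation cR := (cR M m c).

Lemma cR_le : inOmega M cR. Proof. exact: psi_le. Qed.

Lemma block_step y : lle c y -> lle y cR ->
  (forall i, i < m.-1 -> y i = c i) /\
  (y m.-1 = c m.-1 /\ lle c (sh m y) \/ y m.-1 = (c m.-1).+1 /\ lle (sh m y) (rf M c)).
Proof.
move=> h1 h2.
have hR i : i < m.-1 -> cR i = c i.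
  move=> hi; rewrite cR_lt //; last by lia.
  by rewrite (_ : (i == m.-1) = false) ?addn0 //; apply/eqP; lia.
have hE i : i < m.-1 -> y i = c i.
  elim/ltn_ind: i => i IH hi; case: (ltngtP (y i) (c i)) => // hc.
  - by case: (h1 i); split => // j ji; rewrite IH //; lia.
  - case: (h2 i); split; last by rewrite hR.
    by move=> j ji; rewrite IH ?hR //; lia.
split=> //.
have l1 : c m.-1 <= y m.-1.
  by rewrite leqNgt; apply/negP => hc; apply: (h1 m.-1); split.
have l2 : y m.-1 <= (c m.-1).+1.
  rewrite leqNgt; apply/negP => hc; apply: (h2 m.-1); split.
    by move=> j ji; rewrite hE ?hR.
  by rewrite cR_lt ?eqxx ?addn1 //; lia.
have [e|e] : y m.-1 = c m.-1 \/ y m.-1 = (c m.-1).+1 by lia.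
- left; split=> //; rewrite -{1}(fund_per F); apply: (lle_sh (n := m) _).1 => // i im.
  by case: (ltngtP i m.-1) => hi; [rewrite hE|lia|rewrite hi].
- right; split=> //; rewrite -(cR_sh F); apply: (lle_sh (n := m) _).1 => // i im.
  case: (ltngtP i m.-1) => hi; [by rewrite hE // hR|lia|].
  by rewrite hi cR_lt ?eqxx ?addn1 //; lia.
Qed.

(** The vertex before block [j], with 0 for B and 1 for A. It is kept exactly when the last letter
    of the block is that of [c] (at B) or of its reflection (at A). *)
Fixpoint dec (x : sq) (j : nat) : nat :=
  if j is j'.+1 then
    let q := dec x j' in
    if x (m * j' + m.-1) == (if q == 0 then c m.-1 else M - c m.-1) then q else 1 - q
  else 0.

(* Between [c] and [cR] a sequence is forced to follow the paths of the graph: the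
   first [m] digits of the two bounds differ only in the last one. *)
Lemma psi_dec x : W M cR x -> lle c x -> exists2 d, bin d & x = psi 0 d.
Proof.
move=> hW hx; have hxl := W_le cR_le hW.
pose d j := dec x j.+1; exists d.
  have H j : dec x j <= 1 by elim: j => //= j IH; case: eqP => //; lia.
  by move=> j; apply: H.
have pd j : prevd 0 d j = dec x j by case: j.
have blk j : dec x j <= 1 /\
    ((dec x j = 0 -> lle c (sh (m * j) x)) /\ (dec x j = 1 -> lle (sh (m * j) x) (rf M c))).
  elim: j => [|j [IH1 [IH2 IH3]]]; first by rewrite muln0 sh0.
  have [hu hl] := hW (m * j).
  move dj : (dec x j) IH1 IH2 IH3 => q; case: q dj => [|[|//]] dj _ IH2 IH3.
    have IH := IH2; have [_ ] := block_step (IH erefl) hu.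
    rewrite sh_sh -mulnSr /= dj /= /sh; case=> -[-> h]; rewrite ?eqxx; first by split.
    by rewrite (_ : _ == _ = false); [split|apply/eqP; lia].
  have IH := IH3; have hxl' := sh_le (m * j) hxl.
  have [||_] := @block_step (rf M (sh (m * j) x)).
  - rewrite -[X in lle X](rfK (fund_le F)); apply: lle_rf (IH erefl) => //; exact: rf_le.
  - rewrite -[X in lle _ X](rfK cR_le); apply: lle_rf hl => //; exact: rf_le.
  rewrite sh_rf sh_sh -mulnSr /= dj /= /sh /rf.
  have := fund_last F; have := hxl' m.-1; rewrite /sh => h3 h4.
  case=> -[h1 h2].
    rewrite (_ : _ == _ = true); last by apply/eqP; lia.
    split=> //; split=> // _; rewrite -[X in lle X](rfK (sh_le (m * j.+1) hxl)).
    by apply: lle_rf h2; [exact: (fund_le F)|exact: rf_le].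
  rewrite (_ : _ == _ = false); last by apply/eqP; lia.
  split=> //; split=> // _; rewrite -[X in lle X](rfK (fund_le F)) -[X in lle _ X](rfK (sh_le (m * j.+1) hxl)).
  by apply: lle_rf h2; exact: rf_le.
apply: funext => i; rewrite /(psi 0 d) pd.
have [h0 [h1 h2]] := blk (i %/ m).
have [hu hl] := hW (m * (i %/ m)).
have r := ltn_pmod i m0.
have xi : x i = sh (m * (i %/ m)) x (i %% m) by rewrite /sh mulnC -divn_eq.
rewrite xi /d [dec x _.+1]/= .
case: (dec x (i %/ m)) h0 h1 h2 => [_ h _|[_ _ h|//]].
  have [e1 e2] := block_step (h erefl) hu.
  case: (ltngtP (i %% m) m.-1) => hi; [by rewrite e1 //= andbF addn0|lia|].
  rewrite hi /=; rewrite /sh in e2; rewrite /sh; case: e2 => -[-> _]; rewrite ?eqxx ?addn0 //.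
  by rewrite (_ : (c m.-1).+1 == c m.-1 = false) ?addn1 //; apply/eqP; lia.
have hxl' := sh_le (m * (i %/ m)) hxl.
have [||e1 e2] := @block_step (rf M (sh (m * (i %/ m)) x)).
- rewrite -[X in lle X](rfK (fund_le F)); apply: lle_rf (h erefl) => //; exact: rf_le.
- rewrite -[X in lle _ X](rfK cR_le); apply: lle_rf hl => //; exact: rf_le.
have h5 := hxl' (i %% m).
case: (ltngtP (i %% m) m.-1) => hi; [|lia|].
  by rewrite andbF addn0 -e1 // /rf /=; lia.
rewrite hi /= in h5 *; have h4 := fund_last F.
case: e2 => -[+ _]; rewrite /rf /sh; rewrite /sh in h5 => e2.
  rewrite (_ : x (m * (i %/ m) + m.-1) == M - c m.-1 = true) /=; [lia|apply/eqP; lia].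
rewrite (_ : x (m * (i %/ m) + m.-1) == M - c m.-1 = false) /=; [lia|apply/eqP; lia].
Qed.

(** Decided within the first block: [psi 0 b] starts with [c^+], whose reflection is smaller in the
    last letter than that of [c], and the latter is at most [c]. *)
Lemma block_lt b d : b 0 = 1 -> lex_lt (rf M (psi 0 b)) (psi 0 d).
Proof.
move=> b0; have h := rfc_c F; have hl := fund_last F.
have e1 i : i < m -> rf M (psi 0 b) i = M - (c i + (i == m.-1)).
  by move=> im; rewrite /rf psi_lt // b0.
have e2 i : i < m -> c i <= psi 0 d i by move=> im; rewrite psi_lt // leq_addr.
have e3 i : i < m.-1 -> psi 0 d i = c i.
  move=> im; rewrite psi_lt /=; last by lia.
  by rewrite (_ : i == _ = false) ?andbF ?addn0 //; apply/eqP; lia.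
have e4 i : i < m.-1 -> rf M (psi 0 b) i = rf M c i.
  move=> im; rewrite e1; last by lia.
  by rewrite (_ : i == _ = false) ?addn0 //; apply/eqP; lia.
case: (cmpn (rf M c) c m) => [[t tm [h1 h2]]|[[t tm /h//]|hE]].
  exists t; split=> [i it|]; first by rewrite e4 ?e3 ?h1 //; lia.
  apply: leq_trans (e2 _ tm); apply: leq_ltn_trans h2; rewrite e1 // /rf; lia.
exists m.-1; split=> [i it|]; first by rewrite e4 ?e3 ?hE //; lia.
have := hE m.-1; have := e2 m.-1; rewrite e1 ?eqxx /rf; lia.
Qed.

Lemma block_gt b d : b 0 = 1 -> bin d -> lex_lt (psi 1 d) (psi 0 b).
Proof.
move=> b0 bd; have := block_lt (rf 1 d) b0.
move/(llt_rf (@rf_le _ _) (psi_le F _ _)).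
by rewrite (rfK (psi_le F _ _)) (psi_rf F) ?rfK //; exact: bin_rf.
Qed.

Lemma psi_cR_agree b i : b 0 = 1 -> i < m -> psi 0 b i = cR i.
Proof. by move=> b0 im; rewrite cR_lt // psi_lt // b0. Qed.

Section Bounds.
Variables (b d : sq) (p : nat).
Hypotheses (bb : bin b) (b0 : b 0 = 1) (bd : bin d) (hp : p <= 1).

Lemma psi_NB i : i %% m != 0 ->
  lex_lt (sh i (psi p d)) (psi 0 b) /\ lex_lt (rf M (psi 0 b)) (sh i (psi p d)).
Proof.
move=> hi; split.
  have [k km hk] := NB_up F hp bd hi; exists k; apply: lt_at_ext hk _ _ => // j jk.
  by rewrite psi_cR_agree //; lia.
have [k km hk] := NB_lo F hp bd hi; exists k; apply: lt_at_ext hk _ _ => // j jk.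
by rewrite /rf psi_cR_agree //; lia.
Qed.

Lemma psi_bdry n : exists2 q, q <= 1 & sh (m * n) (psi p d) = psi q (sh n d).
Proof. by exists (prevd p d n); [exact: bin_prevd|exact: psi_sh]. Qed.

(** Off the block boundaries both bounds are strict by [psi_NB]. At a boundary one bound is that of
    the code, because coding from a fixed vertex preserves the order, and the other is decided by
    the first block. *)
Lemma psi_W : W 1 b d -> W M (psi 0 b) (psi p d).
Proof.
move=> hW i; have [h|h] := eqVneq (i %% m) 0; last first.
  by have [/lltW + /lltW] := psi_NB h.
rewrite (divn_eq i m) h addn0 mulnC; have [q q1 ->] := psi_bdry (i %/ m).
have bd' : bin (sh (i %/ m) d) by exact: bin_sh.
have [h1 h2] := hW (i %/ m).
case: q q1 => [|[|//]] _; split; [exact/psi_lle|exact/lltW/block_lt|exact/lltW/block_gt|].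
by rewrite (psi_rf F) //; apply/(psi_lle F) => //; exact: bin_rf.
Qed.

Lemma psi_Ws : Ws 1 b d -> Ws M (psi 0 b) (psi p d).
Proof.
move=> hW i; have [h|h] := eqVneq (i %% m) 0; last exact: psi_NB.
rewrite (divn_eq i m) h addn0 mulnC; have [q q1 ->] := psi_bdry (i %/ m).
have bd' : bin (sh (i %/ m) d) by exact: bin_sh.
have [h1 h2] := hW (i %/ m).
case: q q1 => [|[|//]] _; split; [exact/psi_llt|exact/block_lt|exact/block_gt|].
by rewrite (psi_rf F) //; apply/(psi_llt F) => //; exact: bin_rf.
Qed.

End Bounds.

Lemma psi_W_inv b d : bin b -> b 0 = 1 -> bin d -> d 0 = 1 ->
  W M (psi 0 b) (psi 0 d) -> W 1 b d.
Proof.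
move=> bb b0 bd d0 hW; apply: codeW => // i hi; have [h1 h2] := hW (m * i);
  rewrite (psi_sh F) hi in h1 h2.
  by apply: (psi_lle F (p := 0) _ _ _).1 h1 => //; exact: bin_sh.
rewrite (psi_rf F) // in h2.
by apply: (psi_lle F (p := 1) _ _ _).1 h2 => //; [exact: bin_rf|exact: bin_sh].
Qed.

End Comp.

Lemma fund1_head k d : fund 1 k d -> d 0 = 1.
Proof.
move=> F; have /lle_head := fund_rf F 0; have := fund_le F 0.
by rewrite sh0 /rf; lia.
Qed.

Lemma fund1_last k d : fund 1 k d -> d k.-1 = 0.
Proof. by move=> F; have := fund_last F; lia. Qed.

Lemma fund1_size k d : fund 1 k d -> 1 < k.
Proof.
move=> F; have := fund_m F; have := fund1_head F; have := fund1_last F.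
by case: k F => [|[|k]] //= _ ->.
Qed.

Lemma fund_comp M m c k d : fund M m c -> fund 1 k d ->
  fund M (m * k) (psi M m c 0 d).
Proof.
move=> F G; have m0 := fund_m F; have k1' := fund1_size G; have bd := fund_le G.
have d0 := fund1_head G; have dl := fund1_last G.
apply: fund_of.
- by rewrite muln_gt0 m0; lia.
- rewrite (psi_sh F) (fund_per G); case: k G k1' dl => // k G _ /= -> //.
- exact: psi_le.
- move=> l lm; have [h|h] := eqVneq (l %% m) 0; last by have [] := psi_NB F d0 bd (leq0n 1) h.
  have e : l = m * (l %/ m) by rewrite {1}(divn_eq l m) h addn0 mulnC.
  rewrite e (psi_sh F); have := bin_prevd (l %/ m) (leq0n 1) bd.
  have bd' := bin_sh (l %/ m) bd.
  case: (prevd _ _ _) => [|[|//]] _; last exact: block_gt.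
  apply/(psi_llt F) => //.
  have [|t _ ht] := @fund_up _ _ _ G (l %/ m); last by exists t.
  apply/andP; split; last by rewrite ltn_divLR // mulnC; lia.
  by rewrite lt0n; apply/eqP => h0; rewrite h0 muln0 in e; lia.
- by apply: (psi_W F) => //; exact: fund_W G.
have -> : (m * k).-1 = m * k.-1 + m.-1 by case: k k1' {G dl} => // k _; rewrite mulnS; lia.
rewrite -shE (psi_sh F) psi_lt; last by lia.
have := bin_prevd k.-1 (leq0n 1) bd; rewrite /sh addn0 dl eqxx andbT.
by have := fund_last F; case: (prevd _ _ _) => [|[|]] //=; lia.
Qed.

(* A fundamental word in the interval of [c] is a composition: [c^+] can only occur
   at block boundaries, so the periods are commensurable. *)
Lemma fund_factor M m c l x : fund M m c -> fund M l x -> lex_lt c x ->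
  lle x (cR M m c) -> exists k d, [/\ l = m * k, fund 1 k d & x = psi M m c 0 d].
Proof.
move=> F G cx xR; have m0 := fund_m F.
have [d bd xd] : exists2 d, bin d & x = psi M m c 0 d.
  apply: (psi_dec F) (lltW cx).
  by apply: W_mono (fund_W G) => //; [exact: fund_le G|exact: cR_le].
(* If the code started with 0, its first 1 would be read from B at some [j > 0], and the shift of
   [x] to that block would exceed [x]. *)
have d0 : d 0 = 1.
  apply: contrapT => hd; have {}hd : d 0 = 0 by have := bd 0; lia.
  have [j [hj1 hj2]] : lex_lt k0 d.
    by apply/(psi_llt F (p := 0)) => //; rewrite psi0 // -xd.
  have j0 : 0 < j by case: j hj1 hj2 => //; rewrite hd.
  have h := fund_shle G (m * j); rewrite {1}xd (psi_sh F) in h.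
  have e : prevd 0 d j = 0 by case: j j0 hj1 {hj2 h} => // j _ hj1 /=; rewrite -hj1.
  rewrite e xd in h; move/(psi_lle F (p := 0)): h => /(_ isT (bin_sh _ bd) bd) /lle_head.
  by rewrite hd /sh addn0; move: hj2; rewrite /k0; lia.
have lm : l %% m = 0.
  apply/eqP/negPn/negP => h; have [h1 _] := psi_NB F d0 bd (leq0n 1) h.
  by move: h1; rewrite -xd (fund_per G) => /llt_irr.
pose k := l %/ m; have lk : l = m * k by rewrite {1}(divn_eq l m) lm addn0 mulnC.
have k0' : 0 < k by have := fund_m G; rewrite lk; case: k {lk} => //; rewrite muln0.
have e := fund_per G; rewrite lk xd (psi_sh F) in e.
(* A block sequence read from A is smaller than one starting with [c^+], so the period can only
   close at B. *)
have pk : prevd 0 d k = 0.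
  have := bin_prevd k (leq0n 1) bd; case: (prevd _ _ _) e => [//|[|//]] e _.
  by have := block_gt F d0 (bin_sh k bd); rewrite e => /llt_irr.
rewrite pk in e; have dk := psi_inj F (leq0n 1) (bin_sh k bd) bd e.
have dlast : d k.-1 = 0 by move: pk; case: k k0' {lk e dk}.
have hW : W 1 d d by apply: (psi_W_inv F) => //; rewrite -xd; exact: fund_W G.
exists k, d; split=> //; apply: fund_of => //; last by rewrite dlast.
move=> i ik; have [/lleP[//|hi] _] := hW i.
have il : 0 < m * i < l by rewrite lk; nia.
have [t _ [_ ht]] := fund_up G il.
have := psi_sh F 0 d i; rewrite hi.
have [h|h] : prevd 0 d i = 0 \/ prevd 0 d i = 1 by have := bin_prevd i (leq0n 1) bd; lia.
  by rewrite h -xd => e'; rewrite e' in ht; lia.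
(* [d] would start with [1 d] *)
have i0 : 0 < i by lia.
have hi' : prevd 0 d i = d i.-1 by case: i i0 {ik hi il ht h}.
have [h1 _] := hW i.-1.
have c1 j : d j = 1.
  have hs : sh 1 d = d.
    apply: lle_anti; first exact: (bin_sh1 bd d0).
    have : lle (sh 1 (sh i.-1 d)) (sh 1 d).
      by apply: lle_sh1 h1 _; rewrite /sh addn0 -hi' h d0.
    by rewrite sh_sh (_ : i.-1 + 1 = i) ?hi //; lia.
  by elim: j => // j <-; have := congr1 (fun f => f j) hs; rewrite /sh add1n.
by rewrite c1 in dlast.
Qed.

(** The vertex before letter [s] of the block [t]: a block read from the outer vertex A visits the
    reflected inner vertices. At the block ends this uses that [d] ends in 0. *)
Lemma prevd_psi k d p e t s : fund 1 k d -> p <= 1 -> bin e -> s < k ->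
  prevd p (psi 1 k d p e) (t * k + s) =
  if prevd p e t == 0 then prevd 0 d s else 1 - prevd 0 d s.
Proof.
move=> G hp be sk; have k0' := fund_m G; have dl := fund1_last G.
case: s sk => [|s] sk; last first.
  rewrite addnS /= /psi divnMDl // modnMDl divn_small ?modn_small ?addn0; try lia.
  by rewrite (_ : s == _ = false) ?andbF ?addn0 //; apply/eqP; lia.
rewrite addn0; case: t => [|t] /=.
  by case: p hp => [|[|]].
have -> : t.+1 * k = (t * k + k.-1).+1 by rewrite mulSn; lia.
rewrite /= /psi divnMDl // modnMDl divn_small ?modn_small ?addn0; try lia.
rewrite eqxx andbT dl add0n; have := bin_prevd t hp be; have := be t.
by case: (prevd _ _ _) => [|[|]] //; case: (e t) => [|[|]].
Qed.

(** Associativity of the composition, for arbitrary outer codes [e]. The inner vertices being known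
    from [prevd_psi], it is a check letter by letter. *)
Lemma psi_comp M m c k d p e : fund M m c -> fund 1 k d -> p <= 1 -> bin e ->
  psi M (m * k) (psi M m c 0 d) p e = psi M m c p (psi 1 k d p e).
Proof.
move=> F G hp be; apply: funext => i; have m0 := fund_m F; have k0' := fund_m G.
have dl := fund1_last G; have bd := fund_le G.
set j := i %/ m; set r := i %% m; set t := j %/ k; set s := j %% k.
have rm : r < m by exact: ltn_pmod.
have sk : s < k by exact: ltn_pmod.
have ij : i = j * m + r := divn_eq i m.
have jt : j = t * k + s := divn_eq j k.
have e1 : i %/ (m * k) = t by rewrite divnMA.
have e2 : i %% (m * k) = s * m + r.
  have -> : i = t * (m * k) + (s * m + r) by rewrite ij jt; lia.
  rewrite modnMDl modn_small //; apply: (@leq_trans (s.+1 * m)); first by rewrite mulSn; lia.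
  by rewrite [m * k]mulnC leq_mul2r sk orbT.
have hmk : (m * k).-1 = k.-1 * m + m.-1 by rewrite -{1}(prednK k0') mulnS; lia.
have e3 : (s * m + r == (m * k).-1) = (s == k.-1) && (r == m.-1).
  rewrite hmk; apply/eqP/andP => [h|[/eqP -> /eqP ->//]].
  have mm : m.-1 < m by lia.
  have := congr1 (fun z => z %/ m) h; have := congr1 (fun z => z %% m) h.
  rewrite /= !divnMDl // !modnMDl (modn_small rm) (modn_small mm) (divn_small rm) (divn_small mm).
  by move=> /eqP-> ; rewrite !addn0 => /eqP ->.
rewrite /psi e1 e2 e3 -/j -/r.
have -> : (s * m + r) %/ m = s by rewrite divnMDl // divn_small // addn0.
have -> : (s * m + r) %% m = r by rewrite modnMDl modn_small.
have pj := prevd_psi t G hp be sk; rewrite -jt /psi in pj; rewrite pj -/t -/s.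
have hq := bin_prevd t hp be; have he := be t.
have hd' := bin_prevd s (leq0n 1) bd; have hd := bd s.
have hc := fund_le F r; have hcl := fund_last F.
move: (prevd p e t) (e t) (prevd 0 d s) hq he hd' => q e' d' hq he hd'.
have [->|hs] := eqVneq s k.-1; have [->|hr] := eqVneq r m.-1;
  rewrite ?dl ?andbT ?andbF ?addn0 //=.
- move: (c m.-1) hcl => z hcl; clear -hcl hq he hd'.
  by move: q e' d' hq he hd' => [|[|q]] [|[|e']] [|[|d']] //= _ _ _; lia.
- move: (c r) hc => z hc; clear -hc hq he hd'.
  by move: q e' d' hq he hd' => [|[|q]] [|[|e']] [|[|d']] //= _ _ _; lia.
- move: (c m.-1) (d s) hcl hd => z ds hcl hd; clear -hcl hq hd hd'.
  by move: q d' ds hq hd' hd => [|[|q]] [|[|d']] [|[|ds]] //= _ _ _; lia.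
- move: (c r) (d s) hc hd => z ds hc hd; clear -hc hq hd hd'.
  by move: q d' ds hq hd' hd => [|[|q]] [|[|d']] [|[|ds]] //= _ _ _; lia.
Qed.

Lemma cR_comp M m c k d : fund M m c -> fund 1 k d ->
  cR M (m * k) (psi M m c 0 d) = psi M m c 0 (cR 1 k d).
Proof. by move=> F G; exact: psi_comp. Qed.

Lemma cR_comp_le M m c k d : fund M m c -> fund 1 k d ->
  lle (cR M (m * k) (psi M m c 0 d)) (cR M m c).
Proof.
move=> F G; rewrite cR_comp //; apply/(psi_lle F) => //; first exact: cR_le.
have b1 := cR_le G; move=> t [_]; have := b1 t; rewrite /k1; lia.
Qed.

Lemma comp_lt M m c k d : fund M m c -> fund 1 k d -> lex_lt c (psi M m c 0 d).
Proof.
move=> F G; rewrite -{1}(psi0 F); apply/(psi_llt F) => //; first exact: fund_le G.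
by apply: llt_head; rewrite (fund1_head G).
Qed.

(** * Irreducible words *)

(* [us] is [u^oo] for the unit lift [u], of length [um]; [uR] is [alpha(q_T)]. *)
Definition um (M : nat) : nat := if odd M then 2 else 1.
Definition us (M : nat) : sq := fun i => if odd M && ~~ odd i then M./2.+1 else M./2.
Definition uR (M : nat) : sq := cR M (um M) (us M).

Lemma fund_u M : 0 < M -> fund M (um M) (us M).
Proof.
move=> M0; have e := odd_double_half M.
have per : sh (um M) (us M) = us M.
  by apply: funext => i; rewrite /sh /us /um; case: (odd M) => //=; rewrite negbK.
have le : inOmega M (us M).
  by move=> i; rewrite /us; move: e; case: (odd M); case: (odd i) => /=; lia.
have rfu : rf M (us M) = sh (odd M) (us M).
  by apply: funext => i; rewrite /rf /sh /us; move: e; case: (odd M) => /=; case: (odd i) => /=; lia.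
have up i : lle (sh i (us M)) (us M).
  have [->|h] : sh i (us M) = us M \/ us M (i + 0) < us M 0; last by apply/lltW/llt_head.
    rewrite /us addn0; case: (boolP (odd M)) => oM /=.
      case: (boolP (odd i)) => oi /=; [by right|left].
      by apply: funext => j; rewrite /sh oddD (negbTE oi).
    by left; apply: funext.
  exact: lle_refl.
apply: fund_of => //.
- by rewrite /um; case: odd.
- rewrite /um => l; case: (boolP (odd M)) => oM; last by lia.
  move=> l2; have -> : l = 1 by lia.
  by apply: llt_head; rewrite /sh /us oM addn0 /= ltnS.
- move=> i; split => //.
  have -> : sh i (us M) = rf M (sh (odd M + i) (us M)).
    by rewrite -sh_sh -rfu sh_rf rfK //; exact: sh_le.
  by apply: lle_rf => //; exact: sh_le.
- by rewrite /um /us; move: e; case: (odd M) => /=; lia.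
Qed.

(** The unit lift with its last letter raised, padded with zeros. It is a lower bound common to all
    ranges of bases considered, and the only one that the search for fundamental words requires. *)
Definition uP (M : nat) : sq := fun i => if i < um M then M./2.+1 else 0.

Lemma uP_uR M : 0 < M -> lle (uP M) (uR M).
Proof.
move=> M0 t [h1 h2]; move: h2; rewrite /uP; case: ifP => // tu.
rewrite /uR cR_lt // /us /um; move: tu; rewrite /um.
by case: (odd M) => /=; case: t {h1} => [|[|t]] //= _; rewrite ?addn0 ?addn1 ltnn.
Qed.

Lemma uP_head M a : lle (uP M) a ->
  M./2.+1 <= a 0 /\ (odd M -> a 0 = M./2.+1 -> M./2.+1 <= a 1).
Proof.
move=> h; have u0 : 0 < um M by rewrite /um; case: odd.
have h0 := lle_head h; rewrite /uP u0 in h0; split=> // oM e.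
have /lle_head : lle (sh 1 (uP M)) (sh 1 a) by apply: lle_sh1 => //; rewrite /uP u0.
by rewrite /sh !addn0 /uP /um oM.
Qed.

(** * Truncations that are fundamental words *)

Section GoodIndex.
Variables (M : nat) (a : sq).
Hypotheses (ale : inOmega M a) (amax : forall l, lle (sh l a) a).

(* [gidx N] says that [a_1 .. a_N^-] is a fundamental word; [cw N] is its periodic extension. *)
Definition good (l N : nat) : Prop := exists2 k, l + k < N & lt_at (rf M a) (sh l a) k.
Definition gidx (N : nat) : Prop := (forall l, 0 < l < N -> good l N) /\
  (N = 1 -> M - (a 0).-1 <= (a 0).-1 /\ 0 < a 0).
Definition cw (N : nat) : sq := fun j => a (j %% N) - (j %% N == N.-1).

Lemma good_mono l N N' : N <= N' -> good l N -> good l N'.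
Proof. by move=> h [k hk]; exists k => //; lia. Qed.

Lemma cw_lt N i : i < N.-1 -> cw N i = a i.
Proof.
move=> iN; rewrite /cw modn_small; last by lia.
by rewrite (_ : _ == _ = false) ?subn0 //; apply/eqP; lia.
Qed.

Lemma cw_last N : 0 < N -> cw N N.-1 = (a N.-1).-1.
Proof. by move=> N0; rewrite /cw modn_small ?eqxx ?subn1 //; lia. Qed.

Lemma gidx_pos N : 0 < N -> gidx N -> 0 < a N.-1.
Proof.
move=> N0 [h h1]; have [e|N1] := eqVneq N 1; first by rewrite e; have [] := h1 e.
have [|k hk [_ h2]] := h N.-1; first by lia.
have e : k = 0 by lia.
by rewrite e /sh addn0 in h2; apply: leq_ltn_trans h2.
Qed.

Lemma cw_a N : 0 < N -> gidx N -> lt_at (cw N) a N.-1.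
Proof.
move=> N0 g; split=> [i iN|]; first by rewrite cw_lt.
by rewrite cw_last //; have := gidx_pos N0 g; lia.
Qed.

Lemma gidx_fund N : 0 < N -> gidx N -> fund M N (cw N).
Proof.
move=> N0 g; have pos := gidx_pos N0 g; have [h h1] := g.
have cle : inOmega M (cw N).
  by move=> i; rewrite /cw; apply: leq_trans (leq_subr _ _) (ale _).
have digs l k : 0 < l -> l + k < N.-1 -> sh l (cw N) k = sh l a k.
  by move=> l0 lk; rewrite /sh cw_lt.
have digl l k : 0 < l -> l + k < N -> sh l (cw N) k <= sh l a k.
  by move=> l0 lk; rewrite /sh /cw modn_small //; lia.
split=> //.
- by apply: funext => i; rewrite /sh /cw modnDl.
- move=> l lN; case: (cmpn (sh l a) a (N - l)) => [[t tN [h2 h3]]|[[t _ /amax//]|hE]].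
    exists t; first by lia.
    split=> [i it|]; first by rewrite digs ?h2 ?cw_lt //; lia.
    rewrite cw_lt; last by lia.
    by apply: leq_ltn_trans h3; apply: digl; lia.
  exists (N.-1 - l); first by lia.
  split=> [i it|]; first by rewrite digs ?hE ?cw_lt //; lia.
  rewrite cw_lt; last by lia.
  rewrite -hE; last by lia.
  by rewrite /sh subnKC ?cw_last; lia.
- move=> l k lN lk; have [k' hk' [h2 h3]] := h l lN.
  have rfc j : j < N.-1 -> rf M (cw N) j = rf M a j by move=> hj; rewrite /rf cw_lt.
  move=> [h4 h5]; rewrite rfc in h5; last by lia.
  case: (ltngtP k k') => kk.
  + by move: h5; rewrite digs ?h2 //; lia.
  + by have := h4 _ kk; rewrite rfc ?digs //; lia.
  + subst k'; move: h5; case: (ltngtP (l + k) N.-1) => hl; [|by lia|].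
      by rewrite digs //; lia.
    by rewrite /sh hl cw_last //; move: h3; rewrite /sh hl; lia.
- by rewrite cw_last //; have := ale N.-1; lia.
- by move=> e; rewrite /cw e /= subn1; have [] := h1 e.
Qed.

Lemma cw_cR_agree N i : 0 < N -> gidx N -> i < N -> cR M N (cw N) i = a i.
Proof.
move=> N0 g iN; rewrite cR_lt //.
case: (ltngtP i N.-1) => h; [by rewrite cw_lt ?addn0|by lia|].
by rewrite h cw_last //; have := gidx_pos N0 g; lia.
Qed.

Definition t10 : sq := fun i => ~~ odd i.
Lemma bin_t10 : bin t10. Proof. by move=> i; rewrite /t10; case: odd. Qed.
Lemma t10_rf : sh 1 t10 = rf 1 t10.
Proof. by apply: funext => i; rewrite /sh /rf /t10 /=; case: odd. Qed.

(** The right-hand side is [a_1 .. a_N] followed by its own reflection. Were it below [a],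
    cancelling the common first [N] letters and reflecting would give two opposite inequalities
    between the reflections. *)
Lemma cw_t10 N : 0 < N -> gidx N -> lle (sh N a) (rf M a) -> lle a (psi M N (cw N) 0 t10).
Proof.
move=> N0 g h; have F := gidx_fund N0 g; apply/lle_nlt => hg.
set ga := psi M N _ _ _ in hg.
have gaN : sh N ga = rf M ga.
  by have := psi_sh F 0 t10 1; rewrite muln1 /= t10_rf /ga (psi_rf F) //; exact: bin_t10.
have agr i : i < N -> ga i = a i by move=> iN; rewrite -(cw_cR_agree N0 g iN) /ga psi_cR_agree.
have h1 := (llt_sh agr).1 hg; rewrite gaN in h1.
have h2 := llt_rf (psi_le F _ _) ale hg.
exact: llt_irr (llt_trans (llt_le_trans h1 h) h2).
Qed.

(* The crucial step in the search for fundamental words between two sequences: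
   [i] is the first unresolved comparison with the reflection of [a]. *)
Lemma good_resolve i N : 0 < i -> i <= N ->
  (forall l, 0 < l < i -> good l N) -> (i < N -> ~ good i N) ->
  (forall l, 0 < l < i -> good l i) /\
  (forall k, lt_at (rf M a) (sh i a) k ->
    N < (i + k).+1 /\ (forall l, 0 < l < (i + k).+1 -> good l (i + k).+1)).
Proof.
move=> i0 iN hl hb.
have rfmin s : lle (rf M a) (sh s (rf M a)).
  rewrite sh_rf; apply: lle_rf; [exact: sh_le|exact: ale|exact: amax].
have gi l : 0 < l < i -> good l i.
  move=> li; have [k hk hk2] := hl l li.
  have [lki|lki] := ltnP (l + k) i; first by exists k.
  case: (ltngtP i N) iN hb => // [iN _ /(_ isT)|-> _ _]; last by exists k.
  case.
  have [|_ hk3] := @lt_at_shE (i - l) _ _ _ _ hk2.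
    by move=> j hj; case: hk2 => h1 _; apply: h1; lia.
  rewrite sh_sh subnKC in hk3; last by lia.
  have [|k' hk' hk4] := @trans_n (rf M a) (sh (i - l) (rf M a)) _ _ _ hk3.
    by move=> k' _; apply: rfmin.
  by exists k' => //; lia.
split=> // k hk; have Nk : N < (i + k).+1.
  case: (ltngtP i N) iN hb => // [iN _ /(_ isT) hb|-> _ _]; last by lia.
  by rewrite ltnS leqNgt; apply/negP => h; apply: hb; exists k.
split=> // l lk; case: (ltngtP l i) => li.
- by apply: good_mono (gi l _); lia.
- have [||k' hk' hk4] := @trans_n (rf M a) (sh (l - i) (rf M a)) (sh l a) (k - (l - i)).
  + by move=> k' _; apply: rfmin.
  + have [|_] := @lt_at_shE (l - i) _ _ _ _ hk.
      by move=> j hj; case: hk => h1 _; apply: h1; lia.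
    by rewrite sh_sh subnKC //; lia.
  by exists k' => //; lia.
- by subst l; exists k.
Qed.

End GoodIndex.

(** A truncation of [a2] longer than the first difference with [a1] stays above [a1] when its last
    letter is lowered. Let [i] be the first shift whose comparison with the reflection is still open
    at that length. If it is decided later in the right sense, the truncation just after that place
    works. Otherwise [cw_t10] applies to the truncation at [i], which is either above [a1] or gives
    the second alternative. *)
Lemma fund_between M (a1 a2 : sq) : 0 < M -> inOmega M a2 -> (forall l, lle (sh l a2) a2) ->
  lle (uP M) a1 -> lex_lt a1 a2 ->
  (exists m a, [/\ fund M m a, lex_lt a1 a & lle a a2]) \/
  (exists m c, [/\ fund M m c, lle c a1 & lle a2 (psi M m c 0 t10)]).
Proof.
move=> M0 ale amax hu [n hn].
have hu2 : lle (uP M) a2 by apply: lle_trans hu _; apply/lltW; exists n.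
have [u0 u1] := uP_head hu2; have [v0 _] := uP_head hu.
have [i [i0 iN hl hb]] : exists i, [/\ 0 < i, i <= n.+1,
    forall l, 0 < l < i -> good M a2 l n.+1 & i < n.+1 -> ~ good M a2 i n.+1].
  have : exists i, (0 < i) && ((i == n.+1) || `[< ~ good M a2 i n.+1 >]) by exists n.+1; rewrite eqxx.
  move=> h; case: (ex_minnP h) => i /andP[i0 hi] imin; exists i; split=> //.
  - by apply: imin; rewrite eqxx.
  - move=> l li; apply: contrapT => hg.
    have := imin l; rewrite (asboolT hg) orbT andbT; case/andP: li => -> li /(_ isT).
    by rewrite leqNgt li.
  - move=> iN; by case/orP: hi => [/eqP e|/asboolP//]; move: iN; rewrite e ltnn.
have [h1 h2] := good_resolve ale amax i0 iN hl hb.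
(* Only [i = 1] needs an argument, because of the extra condition on one-letter words. It follows
   from the lower bound [uP M], except when [M] is odd and [a2] starts with (M+1)/2; then the second
   letter settles the comparison, so [i = 1] does not occur. *)
have gi : gidx M a2 i.
  split=> // i1; subst i; have e := odd_double_half M.
  have [oM|oM] := boolP (odd M); last by move: e; rewrite (negbTE oM) /=; lia.
  have [h|h] := ltnP M./2.+1 (a2 0); first by move: e; rewrite oM /=; lia.
  have h' : a2 0 = M./2.+1 by lia.
  have n0 : n != 0 by apply/eqP => n0; subst n; case: hn => _; lia.
  case: (hb _); first by lia.
  exists 0; first by lia.
  split=> //; rewrite /rf /sh addn0 h'; move: e; have := u1 oM h'; rewrite oM /=; lia.
have [hle|[k hk]] := lle_total (sh i a2) (rf M a2); last first.
  left.
  have [Nk hg] := h2 k hk; have g : gidx M a2 (i + k).+1 by split=> //; lia.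
  exists (i + k).+1, (cw a2 (i + k).+1); split; first exact: (gidx_fund ale).
    by exists n; apply: lt_at_ext hn _ _ => // j jn; rewrite cw_lt //; lia.
  by apply/lltW; eexists; apply: (cw_a _ g).
have ht := cw_t10 ale amax i0 gi hle.
have ca := cw_a i0 gi; have F := gidx_fund ale amax i0 gi.
have [h|h] := lle_total (cw a2 i) a1; first by right; exists i, (cw a2 i).
by left; exists i, (cw a2 i); split=> //; apply/lltW; eexists; exact: ca.
Qed.

Definition irr (M m : nat) (x : sq) : Prop := fund M m x /\
  ~ exists m' c k d, [/\ fund M m' c, fund 1 k d, m = m' * k & x = psi M m' c 0 d].

Lemma irr_cover M m a : fund M m a ->
  exists m' c, [/\ irr M m' c, lle c a & lle (cR M m a) (cR M m' c)].
Proof.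
elim/ltn_ind: m a => m IH a F.
have [[m' [c [k [d [Fc Fd em ea]]]]]|h] := pselect (exists m' c k d, [/\ fund M m' c, fund 1 k d, m = m' * k & a = psi M m' c 0 d]); last first.
  by exists m, a; split; [split|exact: lle_refl|exact: lle_refl].
have [|m'' [c' [I h1 h2]]] := IH m' _ c Fc.
  by rewrite em; have := fund1_size Fd; have := fund_m Fc; nia.
exists m'', c'; split=> //.
  by apply: lle_trans h1 _; rewrite ea; exact/lltW/(comp_lt Fc Fd).
by apply: lle_trans h2; rewrite em ea; exact: (cR_comp_le Fc Fd).
Qed.

Lemma irr_disjoint M m x m' x' : irr M m x -> fund M m' x' -> lex_lt x' x ->
  lle x (cR M m' x') -> False.
Proof.
move=> [F I] F' h1 h2; apply: I; exists m', x'.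
by have [k [d [e1 Fd e2]]] := fund_factor F' F h1 h2; exists k, d.
Qed.

(** * A dichotomy for classes of fundamental words *)

Section Dichotomy.
Variables (M : nat) (E : nat -> sq -> Prop) (L U : sq).
Hypothesis M0 : 0 < M.
Hypothesis EF : forall m e, E m e -> fund M m e.
Hypothesis Ecover : forall m a, fund M m a -> lex_lt L a -> lle a U ->
  exists m' e, [/\ E m' e, lle e a & lle (cR M m a) (cR M m' e)].
Hypothesis Egap : forall m c a1 a2, fund M m c -> lle L a1 -> lex_lt a1 a2 -> lle a2 U ->
  lle c a1 -> lle a2 (psi M m c 0 t10) ->
  exists m' e, [/\ E m' e, lle e a1 & lle a2 (cR M m' e)].
Hypothesis Edisj : forall m e m' e', E m e -> E m' e' -> lex_lt e' e ->
  lle e (cR M m' e') -> False.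
Hypothesis LU : lle (uP M) L.

(** A fundamental word between [a1] and [a2] is covered by some [e] of the class. If [e] starts at
    or before [a1] and ends before [a2], a second search, to the right of its end, yields another
    [e']; disjointness forces [e'] to start beyond the end of [e], hence after [a1]. *)
Lemma dichotomy a1 a2 : inOmega M a2 -> (forall l, lle (sh l a2) a2) ->
  lle L a1 -> lex_lt a1 a2 -> lle a2 U ->
  (exists m e, [/\ E m e, lex_lt a1 e & lle e a2]) \/
  (exists m e, [/\ E m e, lle e a1 & lle a2 (cR M m e)]).
Proof.
move=> ale amax La1 a12 a2U.
have [[m [a [F h1 h2]]]|[m [c [F h1 h2]]]] := fund_between M0 ale amax (lle_trans LU La1) a12; last first.
  by right; apply: (Egap F).
have [m' [e [Ee h3 h4]]] := Ecover F (lle_lt_trans La1 h1) (lle_trans h2 a2U).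
have [ea1|h5] := lle_total e a1; last by left; exists m', e; split=> //; exact: lle_trans h3 h2.
have aR : lex_lt a (cR M m' e) by apply: llt_le_trans (c_cR F) h4.
have [a2R|h5] := lle_total a2 (cR M m' e); first by right; exists m', e.
have LR : lle L (cR M m' e) by apply: lle_trans La1 _; apply/lltW; apply: llt_trans h1 aR.
(* The interval of [e] contains [a1] but not [a2]: search between its right end and [a2]. *)
have [[n [b [G h6 h7]]]|[n [c [G h6 h7]]]] := fund_between M0 ale amax (lle_trans LU LR) h5; last first.
  have [n' [e' [Ee' h8 h9]]] := Egap G LR h5 a2U h6 h7.
  case: (llt_trich e e') => [h|[h|h]].
  - by case: (Edisj Ee' Ee h).
  - subst e'; have en := fund_eq_len (EF Ee) (EF Ee'); subst n'.
    by case: (llt_irr (lle_lt_trans h9 h5)).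
  - by case: (Edisj Ee Ee' h); apply: lle_trans h9; apply: lle_trans ea1 (lltW a12).
have [n' [e' [Ee' h8 h9]]] := Ecover G (lle_lt_trans LR h6) (lle_trans h7 a2U).
have [h|h] := lle_total e' (cR M m' e); last first.
  left; exists n', e'; split=> //; last exact: lle_trans h8 h7.
  by apply: llt_trans h; apply: llt_trans h1 aR.
case: (llt_trich e e') => [h'|[h'|h']].
- by case: (Edisj Ee' Ee h').
- subst e'; have en := fund_eq_len (EF Ee) (EF Ee'); subst n'.
  have := llt_le_trans (llt_trans h6 (c_cR G)) h9; by move/llt_irr.
- case: (Edisj Ee Ee' h'); apply: lle_trans h9; apply: lle_trans (lltW (c_cR G)).
  by apply: lle_trans (lltW h6); apply: lltW (c_cR (EF Ee)).
Qed.

End Dichotomy.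

(** * Specification *)

Section Specification.
Variables (M m : nat) (a : sq).
Hypotheses (M0 : 0 < M) (I : irr M m a) (hu : lex_lt (uR M) a).
Let F : fund M m a := I.1.
Let m0 : 0 < m := fund_m F.
Let ale : inOmega M a := fund_le F.
Let amax l : lle (sh l a) a := fund_shle F l.

Lemma irr_head : M./2.+1 <= a 0 /\ (odd M -> a 0 = M./2.+1 -> M./2.+1 <= a 1).
Proof. exact: uP_head (lle_trans (uP_uR M0) (lltW hu)). Qed.

Lemma irr_rf0 : rf M a 0 < a 0.
Proof.
have [h _] := irr_head; have := odd_double_half M; have := ale 0; rewrite /rf.
by case: (odd M) => /=; lia.
Qed.

(** Otherwise [a] would lie in the interval of the shorter word [cw a N] and be a composition. This
    is how irreducibility enters the gluing argument. *)
Lemma gidx_cR_lt N : 0 < N < m -> gidx M a N -> lex_lt (cR M N (cw a N)) a.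
Proof.
move=> /andP[N0 Nm] g; have [h|//] := lle_total a (cR M N (cw a N)).
case: (irr_disjoint I (gidx_fund ale amax N0 g) _ h).
by exists N.-1; exact: cw_a g.
Qed.

(* the windows of [a] reproducing a prefix of the reflection of [a] are short *)
Lemma gidx_short i k : 0 < i < m -> gidx M a i -> (forall t, t < k -> a (i + t) = rf M a t) ->
  k < i.
Proof.
move=> /andP[i0 im] g h; rewrite ltnNge; apply/negP => ik.
have G := gidx_fund ale amax i0 g.
have hR : lex_lt (cR M i (cw a i)) a by apply: gidx_cR_lt; rewrite ?i0.
have agr t : t < i -> cR M i (cw a i) t = a t by exact: (cw_cR_agree i0 g).
move: ((llt_sh agr).1 hR); rewrite (cR_sh G) => /llt_nle; apply; apply/lltW.
have pos := gidx_pos i0 g.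
exists i.-1; split=> [t ti|]; rewrite /sh h /rf; try lia; first by rewrite cw_lt.
by rewrite cw_last //; have := ale i.-1; lia.
Qed.

(** With M = 2k+1 and first letter k+1, lowering the one-letter prefix gives k, whose reflection k+1
    is larger: the index 1 is not good and is treated by hand. *)
Definition special := odd M && (a 0 == M./2.+1).

Lemma gidx1 : ~~ special -> M - (a 0).-1 <= (a 0).-1 /\ 0 < a 0.
Proof.
rewrite /special; have [h _] := irr_head; have := odd_double_half M.
by case: (odd M) => /=; lia.
Qed.

(** The least [i] from which [x0] reproduces the reflection of [a] up to [N]. Apart from the special
    case, [i < N] is itself a good index, hence below [j], and [gidx_short] gives [N - i <= i]. This
    decrease drives the induction in [Q_all]. *)
Lemma state_drop N x0 j : 0 < j <= N -> N <= m -> fund M N x0 ->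
  (forall i, i < N.-1 -> x0 i = a i) -> (forall i, i < N -> x0 i <= a i) ->
  (forall i, j <= i < N -> ~ gidx M a i) -> ~~ (special && (j == 1)) ->
  (N = m -> x0 = a) ->
  exists i, [/\ 0 < i <= N, N - i < j, (forall k, k < N - i -> x0 (i + k) = rf M a k) &
    forall l, 0 < l < i -> exists2 k, l + k < N & lt_at (rf M a) (sh l x0) k].
Proof.
move=> /andP[j0 jN] Nm G xa xla nog nsp xm.
pose P i := (0 < i) && `[< forall k, k < N - i -> x0 (i + k) = rf M a k >].
have exP : exists i, P i by exists N; rewrite /P; apply/andP; split; [lia|apply/asboolP => k; lia].
case: (ex_minnP exP) => i /andP[i0 /asboolP hi] imin.
have iN : i <= N by apply: imin; rewrite /P; apply/andP; split; [lia|apply/asboolP => k; lia].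
have xrf k : k < N.-1 -> rf M x0 k = rf M a k by move=> h; rewrite /rf xa.
have res l : 0 < l < i -> exists2 k, l + k < N & lt_at (rf M a) (sh l x0) k.
  move=> li; case: (cmpn (rf M a) (sh l x0) (N - l)) => [[k hk hk2]|[[k hk hk2]|hE]].
  - by exists k => //; lia.
  - case: (@fund_lo _ _ _ G l k); [lia|lia|].
    by apply: lt_at_ext hk2 _ _ => // t tk; rewrite xrf //; lia.
  - have : P l by apply/andP; split; [lia|apply/asboolP => k hk; rewrite -[LHS]hE].
    by move/imin; lia.
exists i; split=> //; first by rewrite i0.
case: (ltngtP i N) iN => // [iN _|-> _]; last by lia.
have gl l : 0 < l < i -> good M a l i.
  move=> li; have [k hk hk2] := res l li.
  have [lki|lki] := ltnP (l + k) i.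
    exists k => //; apply: lt_at_ext hk2 _ _ => // t tk.
    by rewrite /sh xa //; lia.
  have [|_ hk3] := @lt_at_shE (i - l) _ _ _ _ hk2.
    by move=> t ht; case: hk2 => h1 _; apply: h1; lia.
  rewrite sh_sh subnKC in hk3; last by lia.
  have [|k' hk' [_ hk4]] := @trans_n (rf M a) (sh (i - l) (rf M a)) _ _ _ hk3.
    by move=> k' _; exact: (fund_rfrf F).
  by move: hk4; rewrite /sh hi; lia.
have [i1|i1] := boolP (special && (i == 1)).
  case/andP: i1 => sp /eqP i1; subst i; case/andP: (sp) => oM /eqP a0.
  have a1 := irr_head.2 oM a0; have e := odd_double_half M; rewrite oM /= in e.
  have j1 : j != 1 by move: nsp; rewrite sp.
  have [N2|N2] := ltnP 2 N.
    by have := hi 0; rewrite addn0 xa /rf; lia.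
  have N2' : N = 2 by lia.
  by subst N; lia.
have g : gidx M a i.
  split=> // e; apply: gidx1; move: i1; rewrite e eqxx andbT => //.
have ij : i < j by rewrite ltnNge; apply/negP => ji; apply: (nog i) => //; rewrite ji.
apply: leq_ltn_trans ij.
case: (ltngtP N m) Nm => // [Nm _|Nm _].
  (* For [N < m] the last letters of [x0] and [a] may differ, so one letter of the match is given
     up. *)
  have : (N - i).-1 < i.
    apply: gidx_short => //; first by lia.
    by move=> t ht; rewrite -xa ?hi //; lia.
  by lia.
have : N - i < i.
  apply: gidx_short => //; first by lia.
  by move=> t ht; rewrite -hi ?xm.
by lia.
Qed.

(** Otherwise a shift of [a] by some [o'] is its reflection and [m] is twice [o']. The [i] of
    [state_drop] is then a good index with [i <= o'], whereas [gidx_short] gives [m - i < i]. *)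
Lemma irr_norf o : exists2 k, k < m & lt_at (rf M a) (sh o a) k.
Proof.
case: (cmpn (rf M a) (sh o a) m) => [//|[[k _ /(fund_rf F)//]|hE]].
exfalso.
have e : sh o a = rf M a.
  apply: funext => t.
  have p1 : sh m (sh o a) = sh o a by rewrite sh_sh addnC -sh_sh (fund_per F).
  have p2 : sh m (rf M a) = rf M a by rewrite sh_rf (fund_per F).
  by rewrite (per_mod t p1) (per_mod t p2) hE // ltn_pmod.
pose o' := o %% m; have e' : sh o' a = rf M a by rewrite -(sh_mod o (fund_per F)).
have o0 : 0 < o'.
  rewrite lt0n; apply/eqP => o0; move: e'; rewrite o0 sh0 => e'.
  by have := irr_rf0; rewrite -e' ltnn.
have om : o' < m by exact: ltn_pmod.
have e2 : sh (o' + o') a = a by rewrite -sh_sh e' sh_rf e' rfK.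
have m2 : m = o' + o'.
  have : (o' + o') %% m = 0.
    apply: contrapT => /eqP h; have [k _ ] := fund_shlt F h.
    by rewrite e2 => -[]; rewrite ltnn.
  move=> /eqP/dvdnP[q hq]; case: q hq => [|[|q]] hq; nia.
have nosp : ~ (special /\ o' = 1).
  move=> [/andP[oM /eqP a0] o1]; have := irr_head.2 oM a0; have := irr_rf0.
  by have := congr1 (fun f => f 0) e'; rewrite /sh o1 addn0 => ->; rewrite a0; lia.
have [|||i [/andP[i0 im] hij hi hl]] := @state_drop m a m _ (leqnn m) F (fun _ _ => erefl) (fun _ _ => leqnn _) _ _ (fun _ => erefl).
- by rewrite m0 leqnn.
- by move=> i /andP[h1 h2]; lia.
- by apply/negP => /andP[_ /eqP m1]; lia.
have io : i <= o'.
  rewrite leqNgt; apply/negP => oi; have [|k _] := hl o'; first by rewrite o0 oi.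
  by rewrite e' => -[]; rewrite ltnn.
have g : gidx M a i.
  split=> [l li|i1].
    have [k hk hk2] := hl l li.
    have [lki|lki] := ltnP (l + k) i; first by exists k.
    have [|_ hk3] := @lt_at_shE (i - l) _ _ _ _ hk2.
      by move=> t ht; case: hk2 => h1 _; apply: h1; lia.
    rewrite sh_sh subnKC in hk3; last by lia.
    have [|k' hk' [_ hk4]] := @trans_n (rf M a) (sh (i - l) (rf M a)) _ _ _ hk3.
      by move=> k' _; exact: (fund_rfrf F).
    by move: hk4; rewrite /sh hi; lia.
  apply: gidx1; apply/negP => sp; subst i; case/andP: (sp) => oM /eqP a0.
  have := irr_head.2 oM a0; have := hi 0; have := irr_rf0; rewrite addn0 /rf a0; lia.
have : m - i < i by apply: gidx_short => //; lia.
by lia.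
Qed.

Definition glued (n : nat) (x z : sq) : sq := fun i => if i < n then x i else z (i - n).

Lemma glued_lt n x z i : i < n -> glued n x z i = x i.
Proof. by rewrite /glued => ->. Qed.

Lemma glued_sh n k x z : sh (n + k) (glued n x z) = sh k z.
Proof. by apply: funext => i; rewrite /sh /glued ltnNge -addnA leq_addr /= addKn. Qed.

(* The comparison of [sh i x] with [a] is decided before [n], or [x] follows [a] from [i]
   on for whole periods, up to a position [e >= n - j]. *)
Definition resolvedU n j x i := (exists2 k, i + k < n & lt_at (sh i x) a k) \/
  (exists e, [/\ n - j <= e, i <= e, m %| e - i, e <= n & forall k, k < e - i -> x (i + k) = a k]).
Definition resolvedL n x i := exists2 k, i + k < n & lt_at (rf M a) (sh i x) k.

(** The sequences overlap in [j] letters, so comparisons decided in [x] before [n] survive. A window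
    that follows [a] for whole periods is reduced, after cancelling them, to a shift of [z]. *)
Lemma glueW n j x z : j <= n -> W M a z -> (forall i, i < j -> z i = x (n - j + i)) ->
  (forall i, i < n - j -> resolvedU n j x i /\ resolvedL n x i) ->
  let x' := glued (n - j) x z in
  W M a x' /\ (forall i, i < n -> x' i = x i).
Proof.
move=> jn hz zx hr x'.
have agr i : i < n -> x' i = x i.
  move=> im; rewrite /x' /glued; case: ltnP => // h; rewrite zx; last by lia.
  by congr x; lia.
split=> // i; case: (leqP (n - j) i) => hi.
  have -> : sh i x' = sh (i - (n - j)) z by rewrite -{1}(subnKC hi) /x' glued_sh.
  exact: hz.
have [hU [k hk hL]] := hr i hi; split; last first.
  apply/lltW; exists k; apply: lt_at_ext hL _ _ => // t tk.
  by rewrite /sh agr //; lia.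
case: hU => [[t ht hU]|[e [h1 h2 h3 h4 h5]]].
  apply/lltW; exists t; apply: lt_at_ext hU _ _ => // s st.
  by rewrite /sh agr //; lia.
apply/(lle_sh (n := e - i)).
  by move=> s hs; rewrite /sh agr ?h5 //; lia.
rewrite sh_sh subnKC // (sh_mod (e - i) (fund_per F)) (eqP h3) sh0.
have -> : sh e x' = sh (e - (n - j)) z by rewrite -{1}(subnKC h1) /x' glued_sh.
by have [] := hz (e - (n - j)).
Qed.

(** The state of the gluing process: [j] letters of [a] are pending at the end of the word read so
    far, and every [y] can follow after at most [K] connecting letters. By [Q_rf] the same holds for
    pending letters of the reflection. *)
Definition Q j := exists K, forall y, W M a y -> exists l z,
  [/\ l <= K, W M a z, (forall i, i < j -> z i = a i) & sh (j + l) z = y].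

Lemma Q_rf j : Q j -> exists K, forall y, W M a y -> exists l z,
  [/\ l <= K, W M a z, (forall i, i < j -> z i = rf M a i) & sh (j + l) z = y].
Proof.
move=> [K h]; exists K => y hy; have [l [z [h1 h2 h3 h4]]] := h _ (W_rf ale hy).
exists l, (rf M z); split=> //; first exact: W_rf.
  by move=> i ij; rewrite /rf h3.
by rewrite sh_rf h4 rfK //; exact: W_le hy.
Qed.

(** With k = [M./2], the first letter of [y] is k or k+1. A single k is inserted after the initial
    k+1 when [y] starts with k+1, and nothing otherwise; as the second letter of [a] is at least
    k+1, two letters decide all new comparisons. *)
Lemma Q_special : special -> Q 1.
Proof.
case/andP=> oM /eqP a0; have a1 := irr_head.2 oM a0; have e := odd_double_half M.
rewrite oM /= in e; exists 1 => y hy.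
have y0 : M./2 <= y 0 <= M./2.+1.
  have [/lle_head h1 /lle_head h2] := hy 0; move: h1 h2; rewrite sh0 a0 /rf a0; lia.
have le1 : rf M a 0 < a 0 by exact: irr_rf0.
have [y1|y1] : y 0 = M./2 \/ y 0 = M./2.+1 by lia.
  exists 0, (glued 1 a y); split=> //; last by rewrite glued_sh sh0.
    move=> [|i]; last by rewrite -add1n glued_sh; exact: hy.
    rewrite sh0; split; apply/lltW; last by apply: llt_head; rewrite glued_lt.
    exists 1; split=> [[|//] _|]; first by rewrite glued_lt.
    by rewrite /glued /= subnn y1.
  by move=> i i1; rewrite glued_lt.
exists 1, (glued 2 (fun i => if i == 0 then a 0 else M./2) y); split=> //; last by rewrite -[1 + 1]addn0 glued_sh sh0.
  move=> [|[|i]].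
  - rewrite sh0; split; apply/lltW; last by apply: llt_head; rewrite glued_lt.
    by exists 1; split=> [[|//] _|]; rewrite glued_lt.
  - split; apply/lltW; first by apply: llt_head; rewrite /sh glued_lt //= a0.
    exists 1; split=> [[|//] _|]; first by rewrite /sh glued_lt // /rf a0 /=; lia.
    by rewrite /sh /glued /= subnn y1 /rf; lia.
  - by rewrite -(add2n i) glued_sh; exact: hy.
by case=> // _; rewrite glued_lt.
Qed.

(** Continue [a_1 .. a_j] to the next good index [N], lowering the last letter there, or to the full
    period. What is then pending is a prefix of the reflection of [a], shorter than [j] by
    [state_drop], and the induction hypothesis applies through [Q_rf]. *)
Lemma Q_all j : j <= m -> Q j.
Proof.
elim/ltn_ind: j => j IH jm.
have [->|j0] := posnP j.
  by exists 0 => y hy; exists 0, y; split.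
have [sp|nsp] := boolP (special && (j == 1)).
  by case/andP: sp => sp /eqP ->; exact: Q_special.
have [N [jN Nm hN nog]] : exists N, [/\ j <= N, N <= m, N = m \/ gidx M a N &
    forall i, j <= i < N -> ~ gidx M a i].
  have : exists N, (j <= N) && ((N == m) || `[< gidx M a N >]) by exists m; rewrite jm eqxx.
  move=> h; case: (ex_minnP h) => N /andP[jN hN] Nmin; exists N; split=> //.
  - by apply: Nmin; rewrite jm eqxx.
  - by case/orP: hN => [/eqP|/asboolP]; [left|right].
  - move=> i /andP[ji iN] g; have := Nmin i; rewrite ji (asboolT g) orbT => /(_ isT).
    by rewrite leqNgt iN.
have N0 : 0 < N by lia.
have [x0 [G xa xla xm xs]] : exists x0, [/\ fund M N x0, (forall i, i < N.-1 -> x0 i = a i),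
    (forall i, i < N -> x0 i <= a i), N = m -> x0 = a &
    N < m -> gidx M a N /\ x0 = cw a N].
  have [e|Nm'] := eqVneq N m.
    by exists a; split=> //; rewrite e //; lia.
  have g : gidx M a N by case: hN => // e; rewrite e eqxx in Nm'.
  exists (cw a N); split=> //.
  - exact: (gidx_fund ale).
  - exact: cw_lt.
  - by move=> i iN; rewrite /cw modn_small //; lia.
  - by move=> e; rewrite e eqxx in Nm'.
have [|i [/andP[i0 iN] ij hi hl]] := @state_drop N x0 j _ Nm G xa xla nog nsp xm.
  by rewrite j0.
have m00 := irr_rf0.
have Gup l : 0 < l < N -> exists2 k, l + k < N & lt_at (sh l x0) a k.
  move=> lN; have [k hk hk2] := fund_up G lN; exists k => //.
  by apply: lt_at_ext hk2 _ _ => // t tk; rewrite xa //; lia.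
have [hb|hb] : (N = m \/ j < N) \/ (N = j /\ N < m) by lia.
  have [|K HK] := Q_rf (IH (N - i) ij _); first by lia.
  exists (m + K) => y hy; have [l [z [h1 h2 h3 h4]]] := HK y hy.
  have [|||hW hx] := @glueW N (N - i) x0 z _ h2; first by lia.
    by move=> k hk; rewrite h3 // -hi //; congr x0; lia.
    move=> k hk; have {}hk : k < i by lia.
    case: k hk => [|k] hk; last by split; [left; apply: Gup; lia|apply: hl; lia].
    split.
      case: hb => [e|jN'].
        right; exists N; split; rewrite ?subn0 ?e //; first exact: leq_subr.
        by move=> t _; rewrite xm.
      have [e|Nm'] := eqVneq N m.
        right; exists N; split; rewrite ?subn0 ?e //; first exact: leq_subr.
        by move=> t _; rewrite xm.
      have [|g e] := xs; first by lia.
      left; exists N.-1; first by lia.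
      by rewrite sh0 e; exact: cw_a g.
    exists 0 => //; split=> //; rewrite sh0; case: hb => [e|jN']; first by rewrite xm.
    by rewrite xa //; lia.
  exists (N - j + l), (glued (N - (N - i)) x0 z); split=> //; first by lia.
    move=> k kj; case: hb => [e|jN']; first by rewrite hx ?xm //; lia.
    by rewrite hx ?xa //; lia.
  rewrite -h4; have -> : j + (N - j + l) = N - (N - i) + (N - i + l) by lia.
  by rewrite glued_sh.
case: hb => e Nm'; have [g x0E] := xs Nm'; subst N.
(* Here [j] itself is a good index, and following [cw a j] would alter the prescribed [a_1 .. a_j].
   Following it by reflected copies of [cw a j] keeps it, and stays strictly below [a]. *)
have [t ht] : lex_lt (cR M j (cw a j)) a by apply: gidx_cR_lt => //; rewrite j0.
set c := cR M j (cw a j) in ht; rewrite x0E in G.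
have cagr k : k < j -> c k = a k by exact: (cw_cR_agree j0 g).
have cj : sh j c = rf M (cw a j) by exact: cR_sh G.
have cjk k : sh (j * k.+1) c = rf M (cw a j).
  by rewrite mulnS -sh_sh cj sh_rf (sh_per _ (fund_per G)).
(* Enough reflected copies for that comparison, decided at [t], to be settled before [n]. *)
pose n := j + j * t.+1.
have [|K HK] := IH (j - i) ij _; first by lia.
exists (j * t.+1 + K) => y hy; have [l [z [h1 h2 h3 h4]]] := HK y hy.
have nji : n - (j - i) = j * t.+1 + i by rewrite /n; lia.
have tn : t < n by rewrite /n; nia.
have jn : j <= n by rewrite /n leq_addr.
have rc0 : rf M (cw a j) 0 < a 0.
  have [j1|j1] := eqVneq j 1.
    have [h5 h6] := g.2 j1; rewrite /rf /cw j1 /= modn1 subn1; lia.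
  by rewrite /rf cw_lt; [exact: irr_rf0|lia].
have ca := cw_a j0 g.
have cle := fund_le G.
have [|||hW hx] := @glueW n (j - i) c z _ h2; first by lia.
- move=> k hk; rewrite h3 // nji -addnA -shE cjk [RHS]/rf -x0E hi; last by lia.
  by have := ale k; rewrite /rf; lia.
- rewrite nji => k hk; have [kj|kj] := eqVneq (k %% j) 0.
    have ek : k = j * (k %/ j) by rewrite {1}(divn_eq k j) kj addn0 mulnC.
    case: (posnP (k %/ j)) => hk0.
      rewrite hk0 muln0 in ek; subst k; split; first by left; exists t; rewrite // sh0.
      by exists 0; [lia|split=> //; rewrite sh0 cagr].
    have shk : sh k c = rf M (cw a j) by rewrite ek -(prednK hk0) cjk.
    have kj' : k + j <= n.
      have : k %/ j <= t.+1.
        by rewrite -ltnS ltn_divLR // mulSn mulnC; lia.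
      by rewrite /n {2}ek => h; rewrite addnC leq_add2l leq_mul2l h orbT.
    split; first by left; exists 0; [lia|split=> //; rewrite shk].
    exists j.-1; first by lia.
    by rewrite shk; exact: lt_at_rf.
  have [knj|knj] := leqP (k + j) n.
    have [s sj hs] := NB_up G (leq0n 1) bink1 kj.
    have [s' sj' hs'] := NB_lo G (leq0n 1) bink1 kj.
    split; [left; exists s; first by lia|exists s'; first by lia].
      by apply: lt_at_ext hs _ _ => // r rs; apply: cagr; lia.
    by apply: lt_at_ext hs' _ _ => // r rs; rewrite /rf; congr (_ - _); apply: cagr; lia.
  pose s := k - j * t.+1; have sk : k = j * t.+1 + s by rewrite /s; rewrite /n in knj; lia.
  have si : 0 < s < i.
    rewrite sk in hk; rewrite ltn_add2l in hk; rewrite hk andbT lt0n.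
    by apply: contraNneq kj => s0; rewrite sk s0 addn0 modnMr.
  have shk : sh k c = rf M (sh s (cw a j)) by rewrite sk -sh_sh cjk sh_rf.
  split.
    have [r hr hr2] := hl s si; left; exists r; first by rewrite sk /n; lia.
    rewrite shk -x0E -[X in lt_at _ X](rfK ale); apply: lt_at_rf hr2; first exact: rf_le.
    by rewrite x0E; exact: sh_le.
  have [|r hr hr2] := Gup s; first by lia.
  exists r; first by rewrite sk /n; lia.
  by rewrite shk -x0E; apply: lt_at_rf hr2 => //; rewrite x0E; exact: sh_le.
exists (j * t.+1 + l), (glued (n - (j - i)) c z); split=> //; first by lia.
  by move=> k kj; rewrite hx ?cagr //; lia.
rewrite -h4; have -> : j + (j * t.+1 + l) = n - (j - i) + (j - i + l) by rewrite nji /n; lia.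
by rewrite glued_sh.
Qed.

Lemma Q_unif : exists K, forall j, j <= m -> forall y, W M a y -> exists l z,
  [/\ l <= K, W M a z, (forall i, i < j -> z i = a i) & sh (j + l) z = y].
Proof.
have : forall n, n <= m.+1 -> exists K, forall j, j < n -> forall y, W M a y -> exists l z,
  [/\ l <= K, W M a z, (forall i, i < j -> z i = a i) & sh (j + l) z = y].
  elim=> [|n IH] nm; first by exists 0.
  have [|K HK] := IH _; first by lia.
  have [|K' HK'] := @Q_all n; first by lia.
  exists (K + K') => j; rewrite ltnS leq_eqVlt => /orP[/eqP->|jn] y hy.
    by have [l [z [h1 h2 h3 h4]]] := HK' y hy; exists l, z; split=> //; lia.
  by have [l [z [h1 h2 h3 h4]]] := HK j jn y hy; exists l, z; split=> //; lia.
by move=> /(_ m.+1 (leqnn _)).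
Qed.

(** Only the longest match of a prefix of [a] or of its reflection at the end of the word matters,
    and by reflection it may be taken to be of [a]. Matches of at most [m] letters are states
    covered by [Q_unif]. *)
Lemma specification : exists K, forall x0 y n, W M a x0 -> W M a y -> exists l x,
  [/\ l <= K, W M a x, (forall i, i < n -> x i = x0 i) & sh (n + l) x = y].
Proof.
have [K HK] := Q_unif; exists (m + K) => x0 y n.
pose E (b x : sq) i := forall k, k < n - i -> x (i + k) = b k.
have main : forall x0 y i, W M a x0 -> W M a y -> i <= n -> E a x0 i ->
    (forall i', i' < i -> ~ E a x0 i' /\ ~ E (rf M a) x0 i') ->
    exists l x, [/\ l <= m + K, W M a x, (forall i, i < n -> x i = x0 i) & sh (n + l) x = y].
  move=> {x0 y} x0 y i hx hy iN hE hres.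
  have res i' : i' < i -> (exists2 k, i' + k < n & lt_at (sh i' x0) a k) /\
      (exists2 k, i' + k < n & lt_at (rf M a) (sh i' x0) k).
    move=> ii; have [n1 n2] := hres i' ii; have [h1 h2] := hx i'; split.
      case: (cmpn (sh i' x0) a (n - i')) => [[k hk ?]|[[k _ /h1//]|//]].
      by exists k => //; lia.
    case: (cmpn (rf M a) (sh i' x0) (n - i')) => [[k hk ?]|[[k _ /h2//]|h]].
      by exists k => //; lia.
    by case: n2 => k hk; rewrite h.
  have [Jm|Jm] := leqP (n - i) m.
    have [l [z [h1 h2 h3 h4]]] := HK _ Jm y hy.
    have [|||hW hag] := @glueW n (n - i) x0 z _ h2; first by lia.
    - by move=> k hk; rewrite h3 // -hE //; congr x0; lia.
    - move=> k hk; have ki : k < i by lia.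
      by have [h5 h6] := res k ki; split=> //; left.
    exists l, (glued (n - (n - i)) x0 z); split=> //; first by lia.
    rewrite -h4; have -> : n + l = n - (n - i) + (n - i + l) by lia.
    by rewrite glued_sh.
  (* A longer match is first completed to whole periods, at the cost of at most [m] letters, and the
     last period is taken as the state. *)
  pose T := (n - i).-1 %/ m; pose n' := i + m * T.+1.
  have nn' : n <= n' <= n + m.
    have := divn_eq (n - i).-1 m; have := ltn_pmod (n - i).-1 m0.
    by rewrite /n' mulnS mulnC -/T; lia.
  pose x1 := glued i x0 a.
  have x1a k : x1 (i + k) = a k by rewrite /x1 /glued ltnNge leq_addr /= addKn.
  have x1E k : k < n -> x1 k = x0 k.
    move=> kn; rewrite /x1 /glued; case: ltnP => // ik.
    by rewrite -hE ?subnKC //; lia.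
  have [l [z [h1 h2 h3 h4]]] := HK m (leqnn m) y hy.
  have mn' : n' - m = i + m * T by rewrite /n' mulnS; lia.
  have [|||hW hag] := @glueW n' m x1 z _ h2; first by lia.
  - move=> k hk; rewrite h3 // mn' -addnA x1a.
    by rewrite -[in RHS]shE (sh_per _ (fund_per F)).
  - rewrite mn' => k hk; have [ki|ki] := ltnP k i.
      have [[s hs hs2] [s' hs' hs2']] := res k ki; split.
        left; exists s; first by lia.
        by apply: lt_at_ext hs2 _ _ => // r rs; rewrite /sh x1E //; lia.
      exists s'; first by lia.
      by apply: lt_at_ext hs2' _ _ => // r rs; rewrite /sh x1E //; lia.
    have shk : sh k x1 = sh (k - i) a.
      by rewrite -{1}(subnKC ki) /x1 glued_sh.
    split; last first.
      (* A window inside the copied periods of [a] is never a period of the reflection, so its lower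
         bound is decided within [m] letters. *)
      have [s sm hs] := irr_norf (k - i); exists s; last by rewrite shk.
      by rewrite /n' mulnS; lia.
    have [h0|h0] := eqVneq ((k - i) %% m) 0.
      right; exists (i + m * T); split; rewrite ?mn' //; try lia.
      - have -> : i + m * T - k = m * T - (k - i) by lia.
        by rewrite dvdn_subr ?dvdn_mulr // /dvdn ?h0 //; lia.
      - move=> s hs; rewrite -shE shk (sh_mod _ (fund_per F)) h0 sh0 //.
    have [s hs hs2] := fund_shlt F h0; left; exists s; last by rewrite shk.
    have := divn_eq (k - i) m; have : (k - i) %/ m < T by rewrite ltn_divLR // mulnC; lia.
    move=> h5 h6; have : (k - i) %/ m * m + m <= m * T by rewrite -mulSnr mulnC leq_mul2l h5 orbT.
    by rewrite /n' mulnS; lia.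
  exists (n' - n + l), (glued (n' - m) x1 z); split=> //; first by lia.
    by move=> k kn; rewrite hag ?x1E //; lia.
  rewrite -h4; have -> : n + (n' - n + l) = n' - m + (m + l) by rewrite /n' mulnS; lia.
  by rewrite glued_sh.
move=> hx hy.
have : exists i, `[< E a x0 i \/ E (rf M a) x0 i >] by exists n; apply/asboolP; left => k; lia.
move=> h; case: (ex_minnP h) => i /asboolP hi imin {h}.
have iN : i <= n by apply: imin; apply/asboolP; left => k; lia.
have imin' i' : i' < i -> ~ E a x0 i' /\ ~ E (rf M a) x0 i'.
  move=> ii; split=> h; have := imin i'; rewrite asboolT; try by [left|right].
    by move/(_ isT); rewrite leqNgt ii.
  by move/(_ isT); rewrite leqNgt ii.
case: hi => hi; first exact: (main x0 y i).
have xle := W_le ale hx; have yle := W_le ale hy.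
have [||l [x [h1 h2 h3 h4]]] := main _ _ i (W_rf ale hx) (W_rf ale hy) iN.
- by move=> k hk; have := ale k; rewrite /rf hi // /rf; lia.
- move=> i' ii; have [n1 n2] := imin' i' ii; split=> h.
    by apply: n2 => k hk; have := h k hk; have := xle (i' + k); rewrite /rf; lia.
  by apply: n1 => k hk; have := h k hk; have := xle (i' + k); have := ale k; rewrite /rf; lia.
exists l, (rf M x); split=> //; first exact: W_rf.
  by move=> k kn; have := xle k; rewrite /rf h3 // /rf; lia.
by rewrite sh_rf h4 rfK.
Qed.

End Specification.

(** * Counting words *)

Lemma card_rel (T T' : finType) (A : {set T}) (B : {set T'}) (R : T -> T' -> Prop) :
  (forall a, a \in A -> exists2 b, b \in B & R a b) ->
  (forall a a' b, a \in A -> a' \in A -> R a b -> R a' b -> a = a') -> #|A| <= #|B|.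
Proof.
move=> h1 h2; have [->|[a0 ha0]] := set_0Vmem A; first by rewrite cards0.
have [b0 _ _] := h1 a0 ha0.
have : forall a, exists b, a \in A -> b \in B /\ R a b.
  move=> a; have [/h1[b hb hR]|h] := boolP (a \in A); last by exists b0.
  by exists b.
move=> /choice[f hf].
have inj : {in A &, injective f}.
  move=> a a' ha ha' e; have [_ r1] := hf a ha; have [_ r2] := hf a' ha'.
  by apply: (h2 a a' (f a)) => //; rewrite e.
rewrite -(card_in_imset inj); apply: subset_leq_card; apply/fintype.subsetP => b /imsetP[a ha ->].
by have [] := hf a ha.
Qed.

Definition re (M n : nat) (w : n.-tuple 'I_M.+1) (x : sq) : Prop :=
  forall i : 'I_n, x i = val (tnth w i).

Lemma re_inj M n (w w' : n.-tuple 'I_M.+1) x x' : re w x -> re w' x' ->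
  (forall i, i < n -> x i = x' i) -> w = w'.
Proof. by move=> h h' e; apply: eq_from_tnth => i; apply: val_inj; rewrite -h -h' e. Qed.

Lemma re_ex M n x : (forall i, i < n -> x i <= M) -> exists w : n.-tuple 'I_M.+1, re w x.
Proof.
move=> h; exists [tuple inord (x i) | i < n] => i.
by rewrite tnth_mktuple /= inordK // ltnS h.
Qed.

Lemma re_agree M n (w : n.-tuple 'I_M.+1) x x' : re w x -> re w x' ->
  forall i, i < n -> x i = x' i.
Proof. by move=> h h' i hi; rewrite (h (Ordinal hi)) (h' (Ordinal hi)). Qed.

Definition cnt (M : nat) (X : set sq) (n : nat) : nat := #|Bn M X n|.

Lemma BnP M X n (w : n.-tuple 'I_M.+1) : reflect (exists2 x, X x & re w x) (w \in Bn M X n).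
Proof.
rewrite inE; apply: (iffP (asboolP _)) => [[x [h1 h2]]|[x h1 h2]]; by exists x.
Qed.

(** Common form of the counting arguments: each word must be recoverable from an index below [s] and
    two prefixes. A missing component is represented by the prefix of length 0 of [k0]. *)
Lemma cnt_gen (T : finType) (A : {set T}) (s p q M1 M2 : nat) (Y1 Y2 : set sq)
    (R : T -> nat -> sq -> sq -> Prop) :
  (forall w, w \in A -> exists i y1 y2,
     [/\ i < s, Y1 y1, Y2 y2, inOmega M1 y1 & inOmega M2 y2] /\ R w i y1 y2) ->
  (forall w w' i y1 y2 y1' y2', w \in A -> w' \in A -> R w i y1 y2 -> R w' i y1' y2' ->
     (forall j, j < p -> y1 j = y1' j) -> (forall j, j < q -> y2 j = y2' j) -> w = w') ->
  #|A| <= s * (cnt M1 Y1 p * cnt M2 Y2 q).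
Proof.
move=> h1 h2.
have -> : s * (cnt M1 Y1 p * cnt M2 Y2 q) =
    #|finset.setX [set: 'I_s]%SET (finset.setX (Bn M1 Y1 p) (Bn M2 Y2 q))| by rewrite !cardsX cardsT card_ord.
apply: (@card_rel _ _ _ _ (fun w (b : 'I_s * (p.-tuple 'I_M1.+1 * q.-tuple 'I_M2.+1)) => exists y1 y2,
  [/\ re b.2.1 y1, re b.2.2 y2 & R w b.1 y1 y2])) => [w wA|w w' [i [b1 b2]] wA wA' /=].
  have [i [y1 [y2 [[si hy1 hy2 o1 o2] hR]]]] := h1 w wA.
  have [b1 hb1] := @re_ex M1 p y1 (fun i _ => o1 i).
  have [b2 hb2] := @re_ex M2 q y2 (fun i _ => o2 i).
  exists (Ordinal si, (b1, b2)); last by exists y1, y2.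
  by rewrite !inE /=; apply/andP; split; apply/asboolP; [exists y1|exists y2].
move=> [y1 [y2 [r1 r2 hR]]] [y1' [y2' [r1' r2' hR']]].
by apply: (h2 _ _ _ _ _ _ _ wA wA' hR hR'); [exact: re_agree r1 r1'|exact: re_agree r2 r2'].
Qed.

Lemma cnt0_le M X : cnt M X 0 <= 1.
Proof. by apply: leq_trans (max_card _) _; rewrite card_tuple expn0. Qed.

Lemma cnt_gt0 M (X : set sq) n x : X x -> inOmega M x -> 0 < cnt M X n.
Proof.
move=> hx ox; have [w hw] := @re_ex M n x (fun i _ => ox i).
by apply/card_gt0P; exists w; apply/BnP; exists x.
Qed.

Lemma cnt_one (M1 M2 p q : nat) (X Y : set sq) (R : sq -> sq -> Prop) :
  (forall x, X x -> exists y, [/\ Y y, inOmega M2 y & R x y]) ->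
  (forall x x' y y', X x -> X x' -> R x y -> R x' y' -> (forall j, j < q -> y j = y' j) ->
     forall j, j < p -> x j = x' j) -> cnt M1 X p <= cnt M2 Y q.
Proof.
move=> h1 h2; have := @cnt_gen _ (Bn M1 X p) 1 q 0 M2 0 Y (fun y => y = k0)
  (fun w i y _ => exists x, [/\ X x, re w x & R x y]).
rewrite mul1n => h; apply: leq_trans (_ : cnt M2 Y q * cnt 0 (fun y => y = k0) 0 <= _).
  apply: h => [w /BnP[x hx hw]|w w' i y1 _ y1' _ _ _ [x [hx hw hR]] [x' [hx' hw' hR']] hy _].
    by have [y [hy oy hR]] := h1 x hx; exists 0, y, k0; split=> //; exists x.
  by apply: (re_inj hw hw'); exact: h2 hR hR' hy.
by rewrite -[X in _ <= X]muln1 leq_mul // cnt0_le.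
Qed.

Lemma cnt_mono M (X Y : set sq) n : (forall x, X x -> Y x) -> (forall x, X x -> inOmega M x) ->
  cnt M X n <= cnt M Y n.
Proof.
move=> XY ox; apply: (@cnt_one _ _ _ _ _ _ (fun x y => x = y)) => [x hx|x x' y y' _ _ -> -> //].
by exists x; split; [exact: XY|exact: ox|].
Qed.

Lemma cnt_submul M (X : set sq) p q : (forall x, X x -> inOmega M x) ->
  (forall x n, X x -> X (sh n x)) -> cnt M X (p + q) <= cnt M X p * cnt M X q.
Proof.
move=> ox Xs; have := @cnt_gen _ (Bn M X (p + q)) 1 p q M M X X
  (fun w i y z => exists x, [/\ re w x, y = x & z = sh p x]).
rewrite mul1n; apply=> [w /BnP[x hx hw]|w w' i y1 y2 y1' y2' _ _].
  exists 0, x, (sh p x); split; last by exists x.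
  by split=> //; [exact: Xs|exact: ox|exact/sh_le/ox].
move=> [x [hw -> ->]] [x' [hw' -> ->]] h1 h2; apply: (re_inj hw hw') => j hj.
have [/h1//|pj] := ltnP j p; have := h2 (j - p); rewrite /sh subnKC //; apply; lia.
Qed.

Lemma cnt_le_pow M (X : set sq) n : (forall x, X x -> inOmega M x) -> cnt M X n <= M.+1 ^ n.
Proof.
by move=> _; apply: leq_trans (max_card _) _; rewrite card_tuple card_ord.
Qed.

Lemma card_bigcup_le (T : finType) (n : nat) (A : nat -> {set T}) :
  #|\bigcup_(i < n) A i| <= \sum_(i < n) #|A i|.
Proof.
elim: n => [|n IH]; first by rewrite !big_ord0 cards0.
by rewrite !big_ord_recr /=; apply: leq_trans (leq_card_setU _ _) _; rewrite leq_add2r.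
Qed.

Section Transitive.
Variables (M m : nat) (a : sq) (K : nat).
Hypotheses (F : fund M m a).
Hypothesis spec : forall x0 y n, W M a x0 -> W M a y -> exists l x,
  [/\ l <= K, W M a x, (forall i, i < n -> x i = x0 i) & sh (n + l) x = y].
Let ale := fund_le F.
Let oW x : W M a x -> inOmega M x := @W_le M a x ale.

Lemma cntW_gt0 n : 0 < cnt M (W M a) n.
Proof. exact: cnt_gt0 (fund_W F) ale. Qed.

Lemma cntW_sub p q : cnt M (W M a) (p + q) <= cnt M (W M a) p * cnt M (W M a) q.
Proof. by apply: cnt_submul => // x n; exact: W_sh. Qed.

(** Specification joins two words by at most [K] letters. The constant pays for the length of the
    joint and for the surplus letters. *)
Lemma cntW_super p q : cnt M (W M a) p * cnt M (W M a) q <=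
  K.+1 * cnt M (W M a) K * cnt M (W M a) (p + q).
Proof.
have -> : cnt M (W M a) p * cnt M (W M a) q = #|finset.setX (Bn M (W M a) p) (Bn M (W M a) q)|.
  by rewrite cardsX.
apply: (@leq_trans (K.+1 * (cnt M (W M a) (p + K + q) * cnt 0 (fun y => y = k0) 0))).
  apply: (@cnt_gen _ _ _ _ _ _ _ _ _ (fun w l x _ =>
    re w.1 x /\ re w.2 (sh (p + l) x) /\ l <= K)).
    move=> [w1 w2] /finset.setXP[/BnP[x0 hx0 r1] /BnP[y hy r2]].
    have [l [x [lK hx e1 e2]]] := spec p hx0 hy.
    exists l, x, k0; split; first by split=> //; exact: oW.
    split=> /=; first by move=> i; rewrite e1.
    by rewrite e2.
  move=> [w1 w2] [w1' w2'] l x _ x' _ _ _ [/= r1 [r2 lK]] [/= r1' [r2' _]] h _.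
  congr pair; first by apply: (re_inj r1 r1') => i hi; apply: h; lia.
  by apply: (re_inj r2 r2') => i hi; apply: h; lia.
rewrite -mulnA leq_mul2l /=.
apply: leq_trans (_ : cnt M (W M a) (p + K + q) <= _).
  by rewrite -[X in _ <= X]muln1 leq_mul // cnt0_le.
by rewrite -addnA addnCA; exact: cntW_sub.
Qed.

Definition avoid (r : nat) (x : sq) : Prop :=
  W M a x /\ forall i, ~ (forall k, k < r -> x (i + k) = a k).

Lemma avoid_sh r x n : avoid r x -> avoid r (sh n x).
Proof.
move=> [h1 h2]; split; first exact: W_sh.
by move=> i h; apply: (h2 (n + i)) => k kr; rewrite -addnA -h.
Qed.

Lemma cnt_avoid_sub r p q : cnt M (avoid r) (p + q) <= cnt M (avoid r) p * cnt M (avoid r) q.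
Proof.
apply: cnt_submul => [x [/oW//]|x n]; exact: avoid_sh.
Qed.

(* One occurrence of the forbidden prefix can be inserted at any of [n] places. *)
Lemma cnt_insert r n : n * cnt M (avoid r) n <=
  K.+1 * K.+1 * (K + r) * cnt M (W M a) (n + (r + K + K)).
Proof.
have -> : n * cnt M (avoid r) n = #|finset.setX [set: 'I_n]%SET (Bn M (avoid r) n)|.
  by rewrite cardsX cardsT card_ord.
pose occ (x : sq) p := forall k, k < r -> x (p + k) = a k.
(* The place of insertion is recovered from the first occurrence [f] of the prefix in the glued
   sequence. As the original word avoids the prefix, [f] is near that place; the offset, below
   [K + r], and the two joint lengths are packed into [s]. *)
pose R (w : 'I_n * n.-tuple 'I_M.+1) (s : nat) (x : sq) (_ : sq) := exists l l' f,
  [/\ l <= K, l' <= K, s = l + K.+1 * (l' + K.+1 * (w.1 + K - f)), f <= w.1 + K &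
   [/\ occ x f, forall p, occ x p -> f <= p &
     re w.2 (fun i => if i < w.1 then x i else x (w.1 + l + r + l' + (i - w.1)))]].
apply: (@leq_trans (K.+1 * K.+1 * (K + r) *
    (cnt M (W M a) (n + (r + K + K)) * cnt 0 (fun y => y = k0) 0))); last first.
  by rewrite leq_mul2l -[X in _ <= X]muln1 [X in _ || X]leq_mul ?orbT // cnt0_le.
apply: (@cnt_gen _ _ _ _ _ _ _ _ _ R).
  move=> [i w] /finset.setXP[_ /BnP[u [hu hav] ru]].
  have [l [x1 [lK hx1 e1 e2]]] := spec i hu (fund_W F).
  have [l' [x [lK' hx e3 e4]]] := spec (i + l + r) hx1 (W_sh i hu).
  have occx : occ x (i + l).
    move=> k kr; rewrite e3; last by lia.
    by have := congr1 (fun g => g k) e2; rewrite /sh.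
  have ex : exists p, `[< occ x p >] by exists (i + l); apply/asboolP.
  case: (ex_minnP ex) => f /asboolP of_ fmin.
  have fil : f <= i + l by apply: fmin; apply/asboolP.
  have fi : i < f + r.
    rewrite ltnNge; apply/negP => h; apply: (hav f) => k kr.
    by rewrite -(of_ k kr) e3 ?e1 //; lia.
  exists (l + K.+1 * (l' + K.+1 * (i + K - f))), x, k0; split.
    split=> //; last exact: oW.
    have : i + K - f < K + r by lia.
    by move: (i + K - f) => z hz; nia.
  exists l, l', f; split=> //; first by rewrite /=; lia.
  split=> //; first by move=> p hp; apply: fmin; apply/asboolP.
  move=> j /=; case: ltnP => ji; first by rewrite e3 ?e1 -?ru //; lia.
  rewrite -shE e4 /sh -ru.
  by congr u; lia.
move=> [i w] [i' w'] s x z x' z' _ _ [l [l' [f [/= lK lK' es fi [of_ fmin ru]]]]].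
move=> [l2 [l2' [f2 [/= lK2 lK2' es2 fi2 [of2 fmin2 ru2]]]]] hx _ {z z'}.
have [e1 [e2 e3]] : l = l2 /\ l' = l2' /\ i + K - f = i' + K - f2.
  move: es; rewrite es2; move: (i + K - f) (i' + K - f2) => z z2 e {of_ fmin ru of2 fmin2 ru2 hx}.
  have h1 := congr1 (fun t => t %% K.+1) e; have h2 := congr1 (fun t => t %/ K.+1) e.
  rewrite /= ![_ + K.+1 * _]addnC ![K.+1 * _]mulnC !modnMDl !modn_small // in h1.
  rewrite /= ![_ + K.+1 * _]addnC ![K.+1 * _]mulnC !divnMDl // !(@divn_small _ K.+1) // !addn0 in h2.
  have h3 := congr1 (fun t => t %% K.+1) h2; have h4 := congr1 (fun t => t %/ K.+1) h2.
  rewrite /= !modnMDl !modn_small // in h3.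
  by rewrite /= !divnMDl // !(@divn_small _ K.+1) // !addn0 in h4.
subst l2 l2'; have hi := ltn_ord i; have hi' := ltn_ord i'.
have ff : f = f2.
  apply/eqP; rewrite eqn_leq fmin ?fmin2 // => k kr; first by rewrite -hx ?of_ //; lia.
  by rewrite hx ?of2 //; lia.
have ii : i = i' by apply: val_inj => /=; subst f2; lia.
subst i' f2; congr pair; apply: (re_inj ru ru2) => j jn.
by case: ltnP => ji; apply: hx; lia.
Qed.

End Transitive.

Lemma glued_ge n x z i : n <= i -> glued n x z i = z (i - n).
Proof. by rewrite /glued ltnNge => ->. Qed.

(** * Splitting words at the first block c^+ or its reflection *)

Section Lift.
Variables (M m : nat) (c : sq).
Hypothesis F : fund M m c.
Let m0 : 0 < m := fund_m F.
Let cle := fund_le F.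
Notation cR := (cR M m c).

Definition occ (x : sq) (p : nat) : Prop := forall k, k < m -> x (p + k) = cR k.

Let cRE i : i < m.-1 -> cR i = c i.
Proof.
move=> h; rewrite cR_lt; last by lia.
by rewrite (_ : (i == m.-1) = false) ?addn0 //; apply/eqP; lia.
Qed.

(** Below [cR], the first place where [c] is exceeded must be the last letter of a period of [c],
    and that period is then read as [c^+]. *)
Lemma exceed_occ x i t : W M cR x -> lt_at c (sh i x) t ->
  exists p, [/\ i <= p, p + m <= (i + t).+1 & occ x p].
Proof.
move=> hx; elim/ltn_ind: t i => t IH i [h1 h2].
have [hu _] := hx i.
case: (ltngtP t m.-1) => ht.
- case: (hu t); split=> [j jt|]; first by rewrite cRE ?h1 //; lia.
  by rewrite cRE.
- have cm : lt_at c (sh (i + m) x) (t - m).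
    have [|_] := @lt_at_shE m _ _ _ _ (conj h1 h2); first by move=> j jm; apply: h1; lia.
    by rewrite sh_sh (fund_per F).
  have [|p [p1 p2 p3]] := IH (t - m) _ (i + m) cm; first by lia.
  by exists p; split=> //; lia.
- subst t; exists i; split=> //; first by lia.
  move=> k km; case: (ltngtP k m.-1) => hk.
  + by rewrite cRE // h1.
  + by lia.
  + subst k; apply/eqP; rewrite eqn_leq; apply/andP; split.
      rewrite leqNgt; apply/negP => h; apply: (hu m.-1); split=> // j jm.
      by rewrite cRE ?h1.
    by rewrite cR_lt ?eqxx ?addn1 //; lia.
Qed.

Lemma below_occ x i t : W M cR x -> lt_at (sh i x) (rf M c) t ->
  exists p, [/\ i <= p, p + m <= (i + t).+1 & occ (rf M x) p].
Proof.
move=> hx h; have xle := W_le (psi_le F _ _) hx.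
apply: exceed_occ; first exact: W_rf (psi_le F _ _) hx.
by rewrite sh_rf -[X in lt_at X](rfK cle); apply: lt_at_rf h; [exact: sh_le|exact: rf_le].
Qed.

Lemma no_occ_W x : W M cR x -> (forall p, ~ occ x p /\ ~ occ (rf M x) p) -> W M c x.
Proof.
move=> hx h i; split=> t ht.
  by have [p [_ _ hp]] := exceed_occ hx ht; case: (h p).
by have [p [_ _ hp]] := below_occ hx ht; case: (h p).
Qed.

(** A violation of the bounds by the new sequence would either yield an occurrence before [p], by
    [exceed_occ] or [below_occ], or contradict the bounds on the shifts of [c] itself. *)
Lemma truncate_W x p : W M cR x -> occ x p ->
  (forall q, q < p -> ~ occ x q /\ ~ occ (rf M x) q) -> W M c (glued p x c).
Proof.
move=> hx op hq i; set x' := glued p x c.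
have [pi|ip] := leqP p i.
  have -> : sh i x' = sh (i - p) c by rewrite -{1}(subnKC pi) /x' glued_sh.
  by split; [exact: (fund_shle F)|exact: (fund_rf F)].
have shp : sh p x' = c by rewrite -[p]addn0 /x' addn0 -[X in sh X]addn0 glued_sh sh0.
split=> t ht.
- have [tp|tp] := ltnP (i + t) p.
    have : lt_at c (sh i x) t.
      by apply: lt_at_ext ht _ _ => // j jt; rewrite /sh /x' glued_lt //; lia.
    by move=> /(exceed_occ hx)[q [q1 q2 q3]]; case: (hq q) => //; lia.
  have agr j : j < m.-1 -> x' (p + j) = x (p + j).
    by move=> jm; rewrite /x' glued_ge ?leq_addr // addKn op ?cRE //; lia.
  have c1 : x' (p + m.-1) = c m.-1 by rewrite /x' glued_ge ?leq_addr // addKn.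
  have [tm|tm] := ltnP (i + t) (p + m).
    have : lt_at c (sh i x) t.
      split=> [j jt|].
        rewrite ht.1 // /sh /x'; have [?|?] := ltnP (i + j) p; first by rewrite glued_lt.
        by have := agr (i + j - p); rewrite /x' subnKC //; apply; lia.
      apply: leq_trans ht.2 _; rewrite /sh /x' glued_ge //.
      rewrite -{2}(subnKC tp) op; last by lia.
      by rewrite cR_lt ?leq_addr //; lia.
    move=> /(exceed_occ hx)[q [q1 q2 q3]].
    have qp : p <= q by rewrite leqNgt; apply/negP => h; case: (hq q h).
    have et : i + t = p + m.-1 by lia.
    (* [c] would contain a copy of itself with a larger last letter at offset [p - i] *)
    have ccE j : j < m.-1 -> c (p - i + j) = c j.
      move=> jm; rewrite ht.1 /sh; last by lia.
      rewrite (_ : i + (p - i + j) = p + j); last by lia.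
      by rewrite /x' glued_ge ?leq_addr // addKn.
    have ccL : c (p - i + m.-1) < c m.-1.
      have := ht.2; rewrite (_ : t = p - i + m.-1); last by lia.
      by rewrite /sh (_ : i + (p - i + m.-1) = p + m.-1) ?c1 //; lia.
    have [h0|h0] := eqVneq ((p - i) %% m) 0.
      have := congr1 (fun f => f m.-1) (sh_mod (p - i) (fund_per F)).
      by rewrite h0 /sh add0n => e; move: ccL; rewrite e ltnn.
    have [k km [_ hk]] := fund_shlt F h0; move: hk; rewrite /sh ccE ?ltnn //.
    by have : (p - i) %% m != 0 := h0; lia.
  have ccE j : j < m -> c (p - i + j) = c j.
    move=> jm; rewrite ht.1 /sh; last by lia.
    rewrite (_ : i + (p - i + j) = p + j); last by lia.
    by rewrite /x' glued_ge ?leq_addr // addKn.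
  have h0 : (p - i) %% m = 0.
    apply: contrapT => /eqP h0; have [k km [_]] := fund_shlt F h0.
    by rewrite /sh ccE ?ltnn //; lia.
  have [|_] := @lt_at_shE (p - i) _ _ _ _ ht; first by move=> j jp; apply: ht.1; lia.
  rewrite sh_sh subnKC; last by lia.
  rewrite shp (sh_mod (p - i) (fund_per F)) h0 sh0 => -[_]; by rewrite ltnn.
- have [tp|tp] := ltnP (i + t) p.
    have : lt_at (sh i x) (rf M c) t.
      by apply: lt_at_ext ht _ _ => // j jt; rewrite /sh /x' glued_lt //; lia.
    by move=> /(below_occ hx)[q [q1 q2 q3]]; case: (hq q) => //; lia.
  have [|_] := @lt_at_shE (p - i) _ _ _ _ ht; first by move=> j jp; apply: ht.1; lia.
  rewrite sh_sh subnKC; last by lia.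
  by rewrite shp => h; apply: (fund_rfle F (p - i) _ h).
Qed.

Variables (al : sq) (Z : set sq).
Hypotheses (alle : inOmega M al) (alR : lle al cR).
Hypothesis decode : forall x, W M al x -> occ x 0 ->
  exists d, [/\ Z d, bin d & x = psi M m c 0 d].

(** Words without [c^+] or its reflection belong to the subshift of [c]. Otherwise, [p] being the
    first occurrence, a word is given by which of the two occurs there, the part before [p], and the
    code of the blocks meeting the rest. *)
Lemma cnt_lift n : cnt M (W M al) n <= cnt M (W M c) n +
  \sum_(p < n) 2 * (cnt M (W M c) p * cnt 1 Z ((n - p) %/ m).+1).
Proof.
pose fl (b : nat) x := if b == 0 then x else rf M x.
pose first x b p := occ (fl b x) p /\ forall q, q < p -> ~ occ x q /\ ~ occ (rf M x) q.
pose A p : {set n.-tuple 'I_M.+1} := [set w in Bn M (W M al) n |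
  `[< exists x b, [/\ W M al x, re w x, b < 2 & first x b p] >]].
have cRl := psi_le F 0 k1.
have WR x : W M al x -> W M cR x by apply: W_mono.
have flW b x : W M al x -> W M al (fl b x) by rewrite /fl; case: eqP => // _; exact: W_rf.
have trunc x b p : W M al x -> first x b p -> W M c (glued p (fl b x) c).
  move=> hx [h1 h2]; apply: truncate_W => //; first exact/WR/flW.
  move=> q qp; have [] := h2 q qp; have xle := W_le alle hx.
  by rewrite /fl; case: eqP => // _; rewrite rfK.
apply: (@leq_trans #|Bn M (W M c) n :|: \bigcup_(p < n) A p|).
  apply/subset_leq_card/fintype.subsetP => w wB; rewrite finset.in_setU.
  have /BnP[x hx rw] := wB.
  have [[p hp]|h] := pselect (exists p, occ x p \/ occ (rf M x) p); last first.
    apply/orP; left; apply/BnP; exists x => //; apply: no_occ_W => [|p]; first exact: WR.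
    by split=> hp; apply: h; exists p; [left|right].
  have : exists p, `[< occ x p \/ occ (rf M x) p >] by exists p; apply/asboolP.
  move=> ex; case: (ex_minnP ex) => {hp ex}p /asboolP hp pmin.
  have hq q : q < p -> ~ occ x q /\ ~ occ (rf M x) q.
    move=> qp; split=> h; have := pmin q; rewrite asboolT; try by [left|right].
      by move/(_ isT); rewrite leqNgt qp.
    by move/(_ isT); rewrite leqNgt qp.
  have [b b2 hb] : exists2 b, b < 2 & first x b p by case: hp => hp; [exists 0|exists 1].
  have [pn|np] := ltnP p n; last first.
    apply/orP; left; apply/BnP; have xle := W_le alle hx.
    exists (fl b (glued p (fl b x) c)).
      by have := trunc _ _ _ hx hb; rewrite /fl; case: eqP => // _; exact: W_rf.
    move=> i; have ip : i < p by apply: leq_trans np.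
    rewrite -rw /fl; case: eqP => _; rewrite ?/rf glued_lt //.
    by have := xle i; rewrite /rf; lia.
  apply/orP; right; apply/finset.bigcupP; exists (Ordinal pn) => //=.
  by rewrite inE wB; apply/asboolP; exists x, b.
apply: leq_trans (leq_card_setU _ _) _; rewrite leq_add2l.
apply: leq_trans (card_bigcup_le _ _) _; apply: leq_sum => p _.
pose R (w : n.-tuple 'I_M.+1) b y d := exists x, [/\ re w x, inOmega M x,
  (forall i, i < p -> y i = fl b x i) & sh p (fl b x) = psi M m c 0 d].
apply: (@cnt_gen _ _ _ _ _ _ _ _ _ R).
  move=> w; rewrite inE => /andP[_ /asboolP[x [b [hx rw b2 hb]]]].
  have [d [Zd bd ed]] : exists d, [/\ Z d, bin d & sh p (fl b x) = psi M m c 0 d].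
    by apply: decode; [exact/W_sh/flW|move=> k km; case: hb => h _; rewrite /sh add0n h].
  exists b, (glued p (fl b x) c), d; split; first split=> //.
  - exact: trunc.
  - exact: W_le cle (trunc _ _ _ hx hb).
  by exists x; split=> //; [exact: W_le hx|move=> i ip; rewrite glued_lt].
move=> w w' b y d y' d' _ _ [x [rw xle h1 h2]] [x' [rw' xle' h1' h2']] hy hd.
apply: (re_inj rw rw') => i hi.
have : fl b x i = fl b x' i.
  have [ip|pi] := ltnP i p; first by rewrite -h1 // hy // h1'.
  have e1 := congr1 (fun f => f (i - p)) h2; have e2 := congr1 (fun f => f (i - p)) h2'.
  rewrite /sh subnKC // in e1; rewrite /sh subnKC // in e2; rewrite e1 e2.
  apply: (psi_agree F 0 hd); rewrite mulnC.
  by have := divn_eq (n - p) m; have := ltn_pmod (n - p) m0; rewrite mulSn; lia.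
rewrite /fl; case: eqP => // _; rewrite /rf; have := xle i; have := xle' i; lia.
Qed.

End Lift.

(** * The lexicographic condition on unique expansions *)

Definition univ_cond (M : nat) (al x : sq) : Prop := inOmega M x /\
  forall i, (x i < M -> lex_lt (sh i.+1 x) al) /\ (0 < x i -> lex_lt (rf M al) (sh i.+1 x)).

Section Univoque.
Variables (M : nat) (al : sq).
Hypotheses (M0 : 0 < M) (alle : inOmega M al) (almax : forall l, lle (sh l al) al).

Lemma univ_rf x : univ_cond M al x -> univ_cond M al (rf M x).
Proof.
move=> [xle h]; split=> [|i]; first exact: rf_le.
have [h1 h2] := h i; rewrite sh_rf; split.
  rewrite /rf => hi; rewrite -(rfK alle); apply: llt_rf; [exact: rf_le|exact: sh_le|].
  by apply: h2; lia.
rewrite /rf => hi; apply: llt_rf; [exact: sh_le|exact: alle|].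
by apply: h1; have := xle i; lia.
Qed.

(** After a digit [M] the condition gives no upper bound. There the bound is inherited from the
    previous place: [al] must start with [M] too, and cancelling this letter leaves a shift of
    [al]. *)
Lemma univ_up x j l : univ_cond M al x -> x j < M -> j <= l -> lle (sh l.+1 x) al.
Proof.
move=> [xle h] hj; elim: l => [|l IH].
  by rewrite leqn0 => /eqP e; subst j; apply/lltW; have [+ _] := h 0; apply.
rewrite leq_eqVlt => /orP[/eqP e|jl]; first by subst j; apply/lltW; have [+ _] := h l.+1; apply.
have [hl|hl] := ltnP (x l.+1) M; first by apply/lltW; have [+ _] := h l.+1; apply.
have e : x l.+1 = M by have := xle l.+1; lia.
have h1 := IH jl; have a0 : al 0 = M.
  by have := lle_head h1; rewrite /sh addn0 e; have := alle 0; lia.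
apply: (@lle_trans _ (sh 1 al)); last exact: almax.
have -> : sh l.+2 x = sh 1 (sh l.+1 x) by rewrite sh_sh addn1.
by apply: lle_sh1 => //; rewrite /sh addn0 e a0.
Qed.

Lemma univ_tail x i : univ_cond M al x -> (exists2 j, j <= i & x j < M) ->
  (exists2 j, j <= i & 0 < x j) -> W M al (sh i.+1 x).
Proof.
move=> hx [j ji hj] [j' ji' hj'] l; rewrite sh_sh addSn; split.
  by apply: (univ_up (j := j)) => //; lia.
have := @univ_up (rf M x) j' (i + l) (univ_rf hx); rewrite {1}/rf => h.
rewrite -[X in lle _ X](rfK (sh_le _ hx.1)); apply: lle_rf; [exact: rf_le|exact: alle|].
by rewrite -sh_rf; apply: h; lia.
Qed.

(** [i] is the first place by which both a digit below [M] and a positive digit have occurred.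
    Before it the word is constant 0 or [M], after it [univ_tail] applies; the term 2 counts the
    words that are constant throughout. *)
Lemma cnt_univ (X : set sq) n : (forall x, X x -> univ_cond M al x) ->
  cnt M X n <= 2 + \sum_(i < n) (2 * M.+1) * cnt M (W M al) (n - i.+1).
Proof.
move=> hX; have oX x : X x -> inOmega M x by case/hX.
pose mix (x : sq) i := (exists2 j, j <= i & x j < M) /\ (exists2 j, j <= i & 0 < x j).
pose cst b := (if b == 0 then 0 else M) : nat.
pose A i : {set n.-tuple 'I_M.+1} := [set w in Bn M X n |
  `[< exists x b, [/\ X x, re w x, b < 2, mix x i & forall j, j < i -> x j = cst b] >]].
pose B : {set n.-tuple 'I_M.+1} := [set w in Bn M X n |
  `[< exists x b, [/\ re w x, b < 2 & forall j, j < n -> x j = cst b] >]].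
have nmix x i : X x -> ~ mix x i -> exists2 b, b < 2 & forall j, j <= i -> x j = cst b.
  move=> hx; have xle := oX x hx; have [[j ji hj]|h] := pselect (exists2 j, j <= i & x j < M).
    move=> hm; exists 0 => // k ki; apply/eqP; rewrite /cst /= -leqn0 leqNgt; apply/negP => hk.
    by apply: hm; split; [exists j|exists k].
  move=> _; exists 1 => // k ki; have := xle k; rewrite leq_eqVlt => /orP[/eqP//|hk].
  by case: h; exists k.
apply: (@leq_trans #|B :|: \bigcup_(i < n) A i|).
  apply/subset_leq_card/fintype.subsetP => w wB; rewrite finset.in_setU.
  have /BnP[x hx rw] := wB.
  have [[i hi]|h] := pselect (exists i, i < n /\ mix x i); last first.
    apply/orP; left; rewrite inE wB; apply/asboolP.
    case: (posnP n) => [n0|n0]; first by exists x, 0; split=> // j; rewrite n0.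
    have [|b b2 hb] := nmix x n.-1 hx; first by move=> hm; apply: h; exists n.-1; split=> //; lia.
    by exists x, b; split=> // j jn; apply: hb; lia.
  have : exists i, `[< i < n /\ mix x i >] by exists i; apply/asboolP.
  move=> ex; case: (ex_minnP ex) => {hi ex}i /asboolP[ni hi] imin.
  apply/orP; right; apply/finset.bigcupP; exists (Ordinal ni) => //=.
  rewrite inE wB; apply/asboolP; exists x.
  case: i ni hi imin => [|i] ni hi imin; first by exists 0.
  have [|b b2 hb] := nmix x i hx.
    move=> hm; have := imin i; rewrite asboolT; last by split=> //; lia.
    by move/(_ isT); rewrite ltnn.
  by exists b.
apply: leq_trans (leq_card_setU _ _) _; apply: leq_add.
  have := @cnt_gen _ B 2 0 0 0 0 (fun y => y = k0) (fun y => y = k0) (fun w b _ _ =>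
    exists x, re w x /\ forall j, j < n -> x j = cst b).
  move=> h; apply: leq_trans (h _ _) _.
  - move=> w; rewrite inE => /andP[_ /asboolP[x [b [rw b2 hb]]]].
    by exists b, k0, k0; split=> //; exists x.
  - move=> w w' b _ _ _ _ _ _ [x [rw hb]] [x' [rw' hb']] _ _.
    by apply: (re_inj rw rw') => i hi; rewrite hb ?hb'.
  - by rewrite -[X in _ <= X]muln1 leq_mul2l /= -[X in _ <= X]muln1 leq_mul // cnt0_le.
apply: leq_trans (card_bigcup_le _ _) _; apply: leq_sum => i _.
pose R (w : n.-tuple 'I_M.+1) s y (_ : sq) := exists x b, [/\ re w x, b < 2, x i <= M,
  s = x i + M.+1 * b & (forall j, j < i -> x j = cst b) /\ sh i.+1 x = y].
have := @cnt_gen _ (A i) (2 * M.+1) (n - i.+1) 0 M 0 (W M al) (fun y => y = k0) R.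
move=> h; apply: leq_trans (h _ _) _; last by rewrite leq_mul2l -[X in _ <= X]muln1 leq_mul ?orbT // cnt0_le.
  move=> w; rewrite inE => /andP[_ /asboolP[x [b [hx rw b2 [hm1 hm2] hb]]]].
  have xle := oX x hx; exists (x i + M.+1 * b), (sh i.+1 x), k0; split; last by exists x, b.
  split=> //; [|exact: univ_tail (hX x hx) hm1 hm2|exact: sh_le].
  by have := xle i; nia.
move=> w w' s y z y' z' _ _ [x [b [rw b2 xM es [hb ey]]]] [x' [b' [rw' b2' xM' es' [hb' ey']]]] hy _.
have [e1 e2] : x i = x' i /\ b = b'.
  move: es; rewrite es' ![_ + M.+1 * _]addnC ![M.+1 * _]mulnC => e.
  have e1 := congr1 (fun t => t %% M.+1) e; have e2 := congr1 (fun t => t %/ M.+1) e.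
  rewrite /= !modnMDl !modn_small // in e1.
  by rewrite /= !divnMDl // !divn_small // !addn0 in e2.
subst b'; apply: (re_inj rw rw') => j jn.
case: (ltngtP j i) => ji; [by rewrite hb // hb'| |by rewrite ji].
have := hy (j - i.+1); rewrite -ey -ey' /sh subnKC //; apply; lia.
Qed.

End Univoque.

(** * The tower of Thue-Morse words *)

Lemma t10E : t10 = us 1.
Proof. by apply: funext => i; rewrite /t10 /us /=; case: odd. Qed.

Lemma fund_t10 : fund 1 2 t10.
Proof. by rewrite t10E; exact: fund_u. Qed.

Lemma uR1 : cR 1 2 t10 = uR 1.
Proof. by rewrite t10E. Qed.

(* [anx n], of length [anl n], is the periodic extension of [u o (10)^n]; [Lb n] and [Ub n]
   are the expansions of the end points of [(q'_{n+1}, q'_n]]. *)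
Fixpoint anl (M n : nat) : nat := if n is n'.+1 then anl M n' * 2 else um M.
Fixpoint anx (M n : nat) : sq := if n is n'.+1 then psi M (anl M n') (anx M n') 0 t10 else us M.
Definition Lb (M n : nat) : sq := cR M (anl M n) (anx M n).
Definition Ub (M n : nat) : sq := if n is n'.+1 then Lb M n' else fun _ => M.

Section Tower.
Variable M : nat.
Hypothesis M0 : 0 < M.

Lemma fund_an n : fund M (anl M n) (anx M n).
Proof.
elim: n => [|n IH]; first exact: fund_u.
exact: fund_comp IH fund_t10.
Qed.

Lemma Lb_le n : inOmega M (Lb M n).
Proof. exact: (cR_le (fund_an n)). Qed.

Lemma Lb_S n : Lb M n.+1 = psi M (anl M n) (anx M n) 0 (uR 1).
Proof. by rewrite /Lb /= (cR_comp (fund_an n) fund_t10) uR1. Qed.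

Lemma uP_an n : lle (uP M) (anx M n.+1).
Proof.
elim: n => [|n IH]; last first.
  by apply: lle_trans IH _; apply/lltW; exact: (comp_lt (fund_an n.+1) fund_t10).
move=> t [_]; rewrite /uP; case: ifP => // tu.
rewrite /= psi_lt // /us /um; move: tu; rewrite /um.
by case: (odd M) => /=; case: t => [|[|t]] //= _; rewrite ?addn0 ?addn1 ltnn.
Qed.

Lemma uP_Lb n : lle (uP M) (Lb M n).
Proof.
case: n => [|n]; first exact: uP_uR.
apply: lle_trans (@uP_an n) _; apply/lltW; exact: (c_cR (fund_an n.+1)).
Qed.

(** All letters are at least [M - a 0], which settles even [M]. For M = 2k+1, a first letter too
    small would be a k after a k, and this lies below the reflection, which starts with k, k+1. *)
Lemma us_min m a : fund M m a -> lle (us M) a.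
Proof.
move=> F; have U0 := fund_u M0; have e := odd_double_half M; have ale := fund_le F.
have lo i : M - a 0 <= a i.
  by have /lle_head := fund_rf F i; rewrite /sh addn0.
have a0 := lo 0; move=> t [h1 h2].
have [oM|oM] := boolP (odd M); last first.
  have hl := lo t; case: t h1 h2 hl => [|t] h1 h2 hl; move: h2; rewrite /us (negbTE oM) /=.
    by move: e; rewrite (negbTE oM); lia.
  have := h1 0 isT; rewrite /us (negbTE oM) /=; move: e; rewrite (negbTE oM); lia.
rewrite oM /= in e; have us0 : us M 0 = M./2.+1 by rewrite /us oM.
have t0 : 0 < t by case: t h1 h2 => // _; rewrite us0; lia.
have a0' : a 0 = M./2.+1 by rewrite h1.
case: t t0 h1 h2 => // t _ h1 h2.
have [ot|ot] := boolP (odd t.+1).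
  by move: h2; rewrite /us ot andbF; have := lo t.+1; lia.
move: h2; rewrite /us ot oM /= => h2; have at1 : a t.+1 = M./2 by have := lo t.+1; lia.
have at0 : a t = M./2 by rewrite h1 // /us; rewrite /= in ot; rewrite (negbNE ot) andbF.
have t0 : 0 < t by case: t ot {h1 h2 at1 at0}.
have a1 : a 1 = M./2 by rewrite h1 ?ltnS // /us andbF.
have := fund_rf F t => /(_ 1); apply; split; first by case=> // _; rewrite /sh addn0 /rf at0 a0'; lia.
by rewrite /sh addn1 at1 /rf a1; lia.
Qed.

(** Nothing is below the unit lift, and any other word in its interval is a composition. *)
Lemma irr_us m a : irr M m a -> lex_lt (uR M) a \/ a = us M.
Proof.
move=> I; case: (llt_trich a (us M)) => [h|[->|h]]; last 1 first.
- have [h1|h1] := lle_total a (uR M); last by left.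
  by case: (irr_disjoint I (fund_u M0) h h1).
- by have /lle_nlt := us_min I.1; case.
- by right.
Qed.

End Tower.

(* The irreducible (for [j = 0]) and [j]-irreducible words, without those of the tower. *)
Definition Ecl (M j m : nat) (e : sq) : Prop :=
  if j is j'.+1 then exists k b, [/\ irr 1 k b, lex_lt (uR 1) b, m = anl M j' * k &
    e = psi M (anl M j') (anx M j') 0 b]
  else irr M m e /\ lex_lt (uR M) e.

(** * The dichotomy for irreducible and n-irreducible words *)

Section Classes.
Variables (M : nat) (M0 : 0 < M).

Lemma cover_us m a : fund M m a -> lex_lt (uR M) (cR M m a) ->
  exists m' e, [/\ irr M m' e, lex_lt (uR M) e, lle e a & lle (cR M m a) (cR M m' e)].
Proof.
move=> F h; have [m' [e [I h1 h2]]] := irr_cover F; exists m', e; split=> //.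
have [//|eu] := irr_us M0 I; subst e.
have em : m' = um M by exact: fund_eq_len I.1 (fund_u M0).
by subst m'; case: (llt_irr (llt_le_trans h h2)).
Qed.

Lemma Ecl_fund j m e : Ecl M j m e -> fund M m e.
Proof.
case: j => [[[]]//|j [k [b [[G _] _ -> ->]]]].
exact: fund_comp (fund_an M0 j) G.
Qed.

Lemma Ecl_range j m e : Ecl M j m e -> lex_lt (Lb M j) e /\ lle (cR M m e) (Ub M j).
Proof.
case: j => [|j] /=.
  move=> [I h]; split=> //; have := cR_le I.1; move=> hl t [_]; have := hl t; lia.
move=> [k [b [I h -> ->]]]; have F := fund_an M0 j; split; last exact: (cR_comp_le F I.1).
rewrite -/(anl M j.+1) Lb_S //; apply/(psi_llt F) => //; first exact: (cR_le (fund_u (isT : 0 < 1))).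
exact: fund_le I.1.
Qed.

Lemma Ecl_disj j m e m' e' : Ecl M j m e -> Ecl M j m' e' -> lex_lt e' e ->
  lle e (cR M m' e') -> False.
Proof.
case: j => [|j] /=; first by move=> [I _] [I' _]; exact: irr_disjoint I I'.1.
move=> [k [b [I h em ee]]] [k' [b' [I' h' em' ee']]]; have F := fund_an M0 j; subst.
have ble := fund_le I.1; have ble' := fund_le I'.1.
move=> /(psi_llt F (leq0n 1) ble' ble) h1; rewrite (cR_comp F I'.1).
by move=> /(psi_lle F (leq0n 1) ble (cR_le I'.1)); exact: irr_disjoint I I'.1 h1.
Qed.

Lemma Ecl_lift j m a : fund M m a -> lex_lt (anx M j) a -> lle a (Lb M j) ->
  lex_lt (Lb M j.+1) (cR M m a) ->
  exists m' e, [/\ Ecl M j.+1 m' e, lle e a & lle (cR M m a) (cR M m' e)].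
Proof.
move=> G h1 h2 h3; have F := fund_an M0 j.
have [k [d [em D ea]]] := fund_factor F G h1 h2; subst m a.
have dle := fund_le D.
rewrite (cR_comp F D) Lb_S // in h3.
have h4 : lex_lt (uR 1) (cR 1 k d).
  exact: (psi_llt F (leq0n 1) (cR_le (fund_u (isT : 0 < 1))) (cR_le D)).1 h3.
have [k' [b [I h5 h6 h7]]] : exists m' e, [/\ irr 1 m' e, lex_lt (uR 1) e, lle e d & lle (cR 1 k d) (cR 1 m' e)].
  have [m' [e [I h5 h6]]] := irr_cover D; exists m', e; split=> //.
  have [//|eu] := irr_us (isT : 0 < 1) I; subst e.
  have em : m' = um 1 by exact: fund_eq_len I.1 (fund_u (isT : 0 < 1)).
  by subst m'; case: (llt_irr (llt_le_trans h4 h6)).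
exists (anl M j * k'), (psi M (anl M j) (anx M j) 0 b); split.
- by exists k', b.
- by apply/(psi_lle F) => //; exact: fund_le I.1.
- rewrite (cR_comp F D) (cR_comp F I.1); apply/(psi_lle F) => //; first exact: (cR_le D).
  exact: (cR_le I.1).
Qed.

Lemma Ecl_dichotomy j a1 a2 : inOmega M a2 -> (forall l, lle (sh l a2) a2) ->
  lle (Lb M j) a1 -> lex_lt a1 a2 -> lle a2 (Ub M j) ->
  (exists m e, [/\ Ecl M j m e, lex_lt a1 e & lle e a2]) \/
  (exists m e, [/\ Ecl M j m e, lle e a1 & lle a2 (cR M m e)]).
Proof.
move=> ale amax h1 h2 h3.
apply: (@dichotomy M (Ecl M j) (Lb M j) (Ub M j)) => //.
- by move=> m e; exact: Ecl_fund.
- move=> {a1 a2 ale amax h1 h2 h3} m a F La aU; have aR := llt_trans La (c_cR F).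
  case: j La aU aR => [|j] La aU aR.
    by have [m' [e [I h1 h2 h3]]] := cover_us F aR; exists m', e; split.
  apply: Ecl_lift => //; apply: llt_trans La.
  exact: llt_trans (comp_lt (fund_an M0 j) fund_t10) (c_cR (fund_an M0 j.+1)).
- move=> {a1 a2 ale amax h1 h2 h3} m c a1 a2 F La1 a12 a2U ca1 a2t.
  have a2R : lle a2 (cR M m c).
    apply: lle_trans a2t _; apply/(psi_lle F) => //; first exact: bin_t10.
    by move=> t [_]; have := bin_t10 t; rewrite /k1; lia.
  have LR : lex_lt (Lb M j) (cR M m c) by apply: llt_le_trans a2R; apply: lle_lt_trans a12.
  case: j La1 a2U LR => [|j] La1 a2U LR.
    have [m' [e [I h1 h2 h3]]] := cover_us F LR; exists m', e; split=> //.
      exact: lle_trans h2 ca1.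
    exact: lle_trans a2R h3.
  have Fj := fund_an M0 j.
  have jL : lex_lt (anx M j.+1) a1 by apply: llt_le_trans La1; exact: c_cR (fund_an M0 j.+1).
  (* If [c] were the tower word itself, [a2] would not reach the range. If it were smaller, the
     tower word would be [c o d], hence at least [c o 10], against [a2] being at most that. *)
  have jc : lex_lt (anx M j) c.
    case: (llt_trich (anx M j) c) => [//|[ec|cj]].
      have em := fund_eq_len Fj (eq_ind_r (fund M m) F ec); subst c m.
      have := llt_le_trans (llt_trans jL a12) a2t; by move/llt_irr.
    have h4 : lex_lt (anx M j) a2.
      by apply: llt_trans a12; apply: llt_trans jL; exact: comp_lt fund_t10.
    have [k [d [_ D ed]]] := fund_factor F Fj cj (lle_trans (lltW h4) a2R).
    have : lex_lt (psi M m c 0 d) (psi M m c 0 t10) by rewrite -ed; exact: llt_le_trans h4 a2t.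
    move/(psi_llt F (p := 0) isT (fund_le D) bin_t10).
    by have := us_min (isT : 0 < 1) D; rewrite -t10E => /lle_nlt.
  have [|m' [e [Ee h5 h6]]] := Ecl_lift F jc _ LR.
    by apply: lle_trans ca1 _; apply: lle_trans a2U; exact: lltW.
  by exists m', e; split=> //; [exact: lle_trans h5 ca1|exact: lle_trans a2R h6].
- by move=> m e m' e'; exact: Ecl_disj.
- exact: uP_Lb.
Qed.

End Classes.

(** * Words and periodic sequences *)

Lemma word_leE c d : word_le c d <-> lle (pad c) (pad d).
Proof. by rewrite lleP. Qed.

Lemma periodic_lt a i : i < size a -> periodic a i = nth 0 a i.
Proof. by move=> h; rewrite /periodic modn_small. Qed.

Lemma mkseq_periodic a : mkseq (periodic a) (size a) = a.
Proof.
apply: (@eq_from_nth _ 0) => [|i]; rewrite size_mkseq // => h.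
by rewrite nth_mkseq // periodic_lt.
Qed.

Lemma periodic_mkseq m x : 0 < m -> sh m x = x -> periodic (mkseq x m) = x.
Proof.
move=> m0 hp; apply: funext => i; rewrite /periodic size_mkseq nth_mkseq ?ltn_pmod //.
by rewrite [RHS](per_mod i hp).
Qed.

Lemma pad_drop a l k : pad (drop l a) k = nth 0 a (l + k).
Proof. by rewrite /pad nth_drop. Qed.

Lemma pad_take a n k : n <= size a -> pad (take n a) k = if k < n then nth 0 a k else 0.
Proof.
move=> h; rewrite /pad; case: ltnP => kn; first by rewrite nth_take.
by rewrite nth_default // size_takel.
Qed.

Lemma pad_wrefl_take M a n k : n <= size a ->
  pad (wrefl M (take n a)) k = if k < n then M - nth 0 a k else 0.
Proof.
move=> h; rewrite /pad /wrefl; case: ltnP => kn.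
  by rewrite (nth_map 0) ?size_takel // nth_take.
by rewrite nth_default // size_map size_takel.
Qed.

Lemma fundamental_fund M a : fundamental M a -> fund M (size a) (periodic a).
Proof.
move=> [ale h]; have s0 : 0 < size a by case: h => [[]|[_ [a1 [-> _]]]] //; lia.
have per : sh (size a) (periodic a) = periodic a.
  by apply: funext => i; rewrite /sh /periodic modnDl.
have le : inOmega M (periodic a).
  by move=> i; rewrite /periodic; apply: (all_nthP 0 ale); rewrite ltn_pmod.
have shP l k : l + k < size a -> sh l (periodic a) k = pad (drop l a) k.
  by move=> lk; rewrite pad_drop /sh periodic_lt.
case: h => [[s2 h]|[M2 [a1 [ea ha]]]]; last first.
  have e i : periodic a i = a1 by rewrite ea /periodic /= modn1.
  subst a; split=> //.
  - by move=> l /=; lia.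
  - by move=> l k /=; lia.
  - by rewrite e; lia.
  - by rewrite e; lia.
have up l : 0 < l < size a -> exists2 k, l + k < size a & lt_at (sh l (periodic a)) (periodic a) k.
  move=> lm; have [_ [k [h1 h2]]] := h l lm.
  have hk : l + k < size a.
    rewrite ltnNge; apply/negP => hk; move: h2.
    by rewrite pad_take ?leq_subr // ifF //; apply/negbTE; rewrite -leqNgt; lia.
  exists k => //; split=> [i ik|].
    rewrite shP; last by lia.
    rewrite h1 // pad_take ?leq_subr // ifT; last by lia.
    by rewrite periodic_lt //; lia.
  rewrite shP //; apply: leq_trans h2 _; rewrite pad_take ?leq_subr // ifT; last by lia.
  by rewrite periodic_lt //; lia.
split=> //.
- move=> l k lm lk [h1 h2]; have [/word_leE hle _] := h l lm; apply: (hle k).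
  have e i : i <= k -> pad (wrefl M (take (size a - l) a)) i = rf M (periodic a) i.
    move=> ik; rewrite pad_wrefl_take ?leq_subr // ifT; last by lia.
    by rewrite /rf periodic_lt //; lia.
  split=> [i ik|]; first by rewrite -shP ?h1 ?e //; lia.
  by rewrite -shP // e.
- have [|k hk [_ h2]] := up (size a).-1; first by lia.
  have k0 : k = 0 by lia.
  by subst k; move: h2; rewrite /sh addn0 => h2; apply: leq_trans h2 (le 0).
- by move=> e; move: s2; rewrite e.
Qed.

Lemma fund_fundamental M m x : fund M m x -> fundamental M (mkseq x m).
Proof.
move=> F; have m0 := fund_m F; have xle := fund_le F; split.
  by apply/(all_nthP 0) => i; rewrite size_mkseq => im; rewrite nth_mkseq.
have [m1|m1] := eqVneq m 1; last first.
  left; rewrite size_mkseq; split; first by lia.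
  move=> l lm; split.
    apply/word_leE => k [h1 h2]; have lk : l + k < m.
      rewrite ltnNge; apply/negP => hk; move: h2.
      by rewrite pad_wrefl_take ?size_mkseq ?leq_subr // ifF //; apply/negbTE; rewrite -leqNgt; lia.
    apply: (fund_lo F lm lk).
    have e i : i <= k -> pad (wrefl M (take (m - l) (mkseq x m))) i = rf M x i.
      move=> ik; rewrite pad_wrefl_take ?size_mkseq ?leq_subr // ifT; last by lia.
      by rewrite nth_mkseq //; lia.
    have e' i : i <= k -> pad (drop l (mkseq x m)) i = sh l x i.
      by move=> ik; rewrite pad_drop nth_mkseq //; lia.
    split=> [i ik|]; first by rewrite -e' -?e ?h1 //; lia.
    by rewrite -e' // -e.
  have [k lk [h1 h2]] := fund_up F lm; exists k.
  have e i : i <= k -> pad (take (m - l) (mkseq x m)) i = x i.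
    move=> ik; rewrite pad_take ?size_mkseq ?leq_subr // ifT; last by lia.
    by rewrite nth_mkseq //; lia.
  have e' i : i <= k -> pad (drop l (mkseq x m)) i = sh l x i.
    by move=> ik; rewrite pad_drop nth_mkseq //; lia.
  split=> [i ik|]; first by rewrite e' ?e ?h1 //; lia.
  by rewrite e' // e.
right; have h1 := fund_1 F m1; have h2 := fund_last F; rewrite m1 /= in h2.
by split; [lia|exists (x 0); rewrite m1; split=> //; rewrite h1].
Qed.

Lemma size_wplus a : 0 < size a -> size (wplus a) = size a.
Proof. by move=> h; rewrite /wplus size_rcons size_takel ?prednK // leq_pred. Qed.

Lemma nth_wplus a i : i < size a -> nth 0 (wplus a) i = nth 0 a i + (i == (size a).-1).
Proof.
move=> h; rewrite /wplus nth_rcons size_takel ?leq_pred //.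
case: (ltngtP i (size a).-1) => hi; [by rewrite nth_take ?addn0|by lia|].
by rewrite hi addn1 nth_last.
Qed.

Lemma pre_periodic_cR M a : 0 < size a ->
  pre_periodic (wplus a) (wrefl M a) = cR M (size a) (periodic a).
Proof.
move=> s0; apply: funext => i; rewrite /pre_periodic size_wplus // /cR.
case: ltnP => hi; first by rewrite psi_lt // nth_wplus // periodic_lt.
have -> : psi M (size a) (periodic a) 0 k1 i = M - periodic a (i %% size a).
  have i1 : 0 < i %/ size a by rewrite divn_gt0.
  by rewrite /psi; case: (i %/ size a) i1 => //= j _; rewrite addn0.
rewrite /wrefl (nth_map 0); last by rewrite size_map ltn_pmod.
rewrite size_map periodic_lt ?ltn_pmod //.
by rewrite -[in RHS](subnK hi) modnDr.
Qed.

Lemma mkseq_add T (f : nat -> T) m n : mkseq f (m + n) = mkseq f m ++ mkseq (fun i => f (m + i)) n.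
Proof.
rewrite /mkseq iotaD map_cat add0n; congr (_ ++ _).
by rewrite -[in LHS](addn0 m) iotaDl -map_comp.
Qed.

Lemma block_words M a p d : 0 < size a -> p <= 1 -> d 0 <= 1 ->
  mkseq (psi M (size a) (periodic a) p d) (size a) =
  La M a (if p == 0 then (if d 0 == 0 then e2 else e3) else (if d 0 == 0 then e1 else e4)).
Proof.
move=> s0 hp hd; apply: (@eq_from_nth _ 0) => [|i].
  rewrite size_mkseq; case: ifP => _; case: ifP => _ //=; rewrite ?size_map ?size_wplus //.
rewrite size_mkseq => hi; rewrite nth_mkseq // psi_lt // periodic_lt //.
case: p hp => [|[|]] // _; case: (d 0) hd => [|[|]] //= _.
- by rewrite addn0.
- by rewrite nth_wplus.
- by rewrite (nth_map 0) ?size_wplus // nth_wplus.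
- by rewrite (nth_map 0) // addn0.
Qed.

Lemma flatten_path M a b v : fund M (size a) (periodic a) -> all (fun x => x <= 1) b ->
  v <> VStart -> flatten (map (La M a) (path_from v b)) =
  mkseq (psi M (size a) (periodic a) (if v is VA then 1 else 0) (nth 0 b)) (size a * size b).
Proof.
move=> F; have s0 := fund_m F; elim: b v => [|x b IH] v /=; first by rewrite muln0.
move=> /andP[x1 ball] hv; rewrite mulnS mkseq_add block_words //; last by case: v hv.
have e p : (fun i => psi M (size a) (periodic a) p (nth 0 (x :: b)) (size a + i)) =
    psi M (size a) (periodic a) x (nth 0 b).
  by have := psi_sh F p (nth 0 (x :: b)) 1; rewrite muln1.
rewrite e; case: x x1 {e} => [|[|]] // _; case: v hv => // _ /=; rewrite IH //.
Qed.

Lemma composeE M c d : fundamental M c -> fundamental 1 d ->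
  compose M c d = mkseq (psi M (size c) (periodic c) 0 (periodic d)) (size c * size d).
Proof.
move=> hc hd; have F := fundamental_fund hc; have G := fundamental_fund hd.
have [dle _] := hd; have d0 := fund1_head G; have s0 := fund_m G.
rewrite /compose.
(* [e0] and [e3] have the same labels and the same target, so the path may as well start at B, as it
   does in [psi]. *)
have -> : path_from VStart d = (if path_from VB d is _ :: p then e0 :: p else [::]).
  by move: d0; rewrite periodic_lt //; case: (d) s0 => // x d' _ /= ->.
have -> : flatten (map (La M c) (if path_from VB d is _ :: p then e0 :: p else [::])) =
    flatten (map (La M c) (path_from VB d)).
  by move: d0; rewrite periodic_lt //; case: (d) s0 => // x d' _ /= ->.
rewrite flatten_path //; apply: (@eq_from_nth _ 0) => [|i]; rewrite !size_mkseq // => hi.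
rewrite !nth_mkseq //; apply: (psi_agree F 0 (n := size d)) => // j jd.
by rewrite periodic_lt.
Qed.

Lemma compose_size M c d : fundamental M c -> fundamental 1 d ->
  size (compose M c d) = size c * size d.
Proof. by move=> hc hd; rewrite composeE // size_mkseq. Qed.

Lemma compose_periodic M c d : fundamental M c -> fundamental 1 d ->
  periodic (compose M c d) = psi M (size c) (periodic c) 0 (periodic d).
Proof.
move=> hc hd; have FG := fund_comp (fundamental_fund hc) (fundamental_fund hd).
by rewrite composeE // periodic_mkseq //; [exact: fund_m FG|exact: fund_per FG].
Qed.

Lemma word_eq a b : size a = size b -> periodic a = periodic b -> a = b.
Proof. by move=> es ep; rewrite -(mkseq_periodic a) es ep mkseq_periodic. Qed.

Lemma fund_word M m x : fund M m x -> exists a, [/\ fundamental M a, size a = m & periodic a = x].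
Proof.
move=> F; exists (mkseq x m); split; [exact: fund_fundamental|exact: size_mkseq|].
by apply: periodic_mkseq; [exact: fund_m F|exact: fund_per F].
Qed.

Lemma irreducible_irr M a : irreducible M a <-> fundamental M a /\ irr M (size a) (periodic a).
Proof.
split=> [[h n]|[h [_ n]]]; split=> //.
- split; first exact: fundamental_fund.
  move=> [m' [c' [k [d' [Fc Fd es ep]]]]]; apply: n.
  have [c [hc sc pc]] := fund_word Fc; have [d [hd sd pd]] := fund_word Fd.
  exists c, d; split=> //; split=> //; apply: word_eq.
    by rewrite compose_size // sc sd.
  by rewrite compose_periodic // sc pc pd.
- move=> [c [d [hc [hd ea]]]]; apply: n.
  exists (size c), (periodic c), (size d), (periodic d); split.
  + exact: fundamental_fund.
  + exact: fundamental_fund.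
  + by rewrite ea compose_size.
  + by rewrite ea compose_periodic.
Qed.

Lemma irr_word M m x : irr M m x -> exists a, [/\ irreducible M a, size a = m & periodic a = x].
Proof.
move=> I; have [a [ha sa pa]] := fund_word I.1.
by exists a; split=> //; apply/irreducible_irr; rewrite sa pa.
Qed.

Definition w10 : word := [:: 1; 0].

Lemma w10_word : [/\ fundamental 1 w10, size w10 = 2 & periodic w10 = t10].
Proof.
have [a [ha sa pa]] := fund_word fund_t10.
suff <- : a = w10 by [].
apply: (@eq_from_nth _ 0) => [|i]; rewrite sa // => i2.
by rewrite -periodic_lt ?sa // pa /t10; case: i i2 => [|[|]].
Qed.

Definition tower (M n : nat) : word := iter n (fun w => compose M w w10) (unit_lift M).

Lemma tower_word M n : 0 < M ->
  [/\ fundamental M (tower M n), size (tower M n) = anl M n & periodic (tower M n) = anx M n].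
Proof.
move=> M0; elim: n => [|n [IH1 IH2 IH3]].
  have [a [ha sa pa]] := fund_word (fund_u M0).
  suff e : a = unit_lift M by rewrite /tower /= -e.
  have su : size (unit_lift M) = um M by rewrite /unit_lift /um; case: odd.
  apply: (@eq_from_nth _ 0) => [|i]; rewrite sa // => i2.
  rewrite -periodic_lt ?sa // pa /us /unit_lift; move: i2; rewrite /um.
  by case: (odd M); case: i => [|[|]].
have [h1 h2 h3] := w10_word; have F := fund_an M0 n.
rewrite /tower iterS -/(tower M n); split.
- have [a [ha sa pa]] := fund_word (fund_an M0 n.+1).
  suff e : a = compose M (tower M n) w10 by rewrite -e.
  apply: word_eq; first by rewrite compose_size // sa IH2 h2.
  by rewrite compose_periodic // pa IH2 IH3 h3.
- by rewrite compose_size // IH2 h2.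
- by rewrite compose_periodic // IH2 IH3 h3.
Qed.

Lemma compose_fundamental M c d : fundamental M c -> fundamental 1 d -> fundamental M (compose M c d).
Proof.
move=> hc hd; rewrite composeE //; apply: fund_fundamental.
by apply: fund_comp; exact: fundamental_fund.
Qed.

(** * The Thue-Morse sequence *)

Lemma tm_aux_fuel f i : i <= f -> tm_aux f i = tau i.
Proof.
rewrite /tau; elim/ltn_ind: i f => i IH f fi.
case: i IH fi => [|i] IH fi; first by case: f fi.
case: f fi => // f fi /=; have h : uphalf i < i.+1 by rewrite uphalf_half; have := odd_double_half i; lia.
by rewrite !(IH (uphalf i)) //; lia.
Qed.

Lemma tauE i : tau i = (odd i + tau i./2) %% 2.
Proof.
case: i => // i; rewrite {1}/tau /= tm_aux_fuel // uphalf_half; have := odd_double_half i; lia.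
Qed.

Lemma tau_le1 i : tau i <= 1.
Proof. by rewrite tauE -ltnS ltn_mod. Qed.

Lemma tau_pow n i : i < 2 ^ n -> tau (2 ^ n + i) = 1 - tau i.
Proof.
elim: n i => [|n IH] i hi; first by have -> : i = 0 by move: hi; rewrite expn0; lia.
have h2 : i./2 < 2 ^ n by rewrite expnS in hi; have := odd_double_half i; lia.
rewrite tauE [in RHS]tauE expnS mul2n halfD odd_double /= doubleK add0n oddD odd_double /=.
rewrite IH //; have := tau_le1 i./2; case: (tau i./2) => [|[|]] //; case: odd => //.
Qed.

Lemma tau_pow2 n : tau (2 ^ n) = 1.
Proof. by rewrite -[2 ^ n]addn0 tau_pow ?expn_gt0. Qed.

Lemma anlE M n : anl M n = um M * 2 ^ n.
Proof. by elim: n => [|n IH] /=; rewrite ?muln1 // IH expnSr mulnA. Qed.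

Section Lambda.
Variable M : nat.
Hypothesis M0 : 0 < M.

(** Block doubling. With first half [c^+], the second half is the reflection of [c], exactly as in
    [c o 10] with its last letter raised; this identifies [lambda] with the tower. *)
Lemma lambda_step n r : r < anl M n ->
  lambda M (anl M n + r) = M - lambda M r + (r == (anl M n).-1).
Proof.
rewrite anlE /um /lambda; have e := odd_double_half M.
case: (boolP (odd M)) e => oM e /=.
  rewrite -expnS; set N := 2 ^ n.+1 => rN; have N0 : 0 < N by rewrite expn_gt0.
  have := tau_le1 r.+1; case: (ltngtP r N.-1) => hr.
  - by rewrite -addnS tau_pow; rewrite -/N; lia.
  - by lia.
  - have -> : (N + r).+1 = 2 ^ n.+2 by rewrite expnS -/N; lia.
    have -> : r.+1 = 2 ^ n.+1 by rewrite -/N; lia.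
    by rewrite !tau_pow2; lia.
rewrite mul1n; set N := 2 ^ n => rN; have N0 : 0 < N by rewrite expn_gt0.
have t1 := tau_le1 r.+1; have t2 := tau_le1 r.
have h1 : tau (N + r) = 1 - tau r by rewrite tau_pow.
rewrite h1; case: (ltngtP r N.-1) => hr.
- by rewrite -addnS tau_pow -/N; move: e; rewrite /=; lia.
- by lia.
- have -> : (N + r).+1 = 2 ^ n.+1 by rewrite expnS -/N; lia.
  have er : r.+1 = 2 ^ n by rewrite -/N; lia.
  by rewrite er !tau_pow2; move: e; rewrite /=; lia.
Qed.

Lemma lambda_Lb n i : i < anl M n -> lambda M i = Lb M n i.
Proof.
elim: n i => [|n IH] i hi.
  rewrite /Lb cR_lt //= /us /um /lambda; move: hi; rewrite /= /um.
  by case: (odd M) => /=; case: i => [|[|i]] //= _; rewrite ?addn1 ?addn0.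
have F := fund_an M0 n; have N0 := fund_m F.
rewrite /Lb cR_lt //=; have [h|h] := ltnP i (anl M n).
  rewrite psi_lt //= IH // /Lb cR_lt //.
  by rewrite [i == (_ * _).-1](_ : _ = false) ?addn0 //; apply/eqP; lia.
have ri : i - anl M n < anl M n by rewrite /= in hi; lia.
rewrite -{1}(subnKC h) lambda_step // IH // /Lb cR_lt //.
have -> : psi M (anl M n) (anx M n) 0 t10 i =
    M - (anx M n (i - anl M n) + (i - anl M n == (anl M n).-1)).
  have := congr1 (fun f => f (i - anl M n)) (psi_sh F 0 t10 1).
  by rewrite /sh muln1 subnKC // => ->; rewrite psi_lt.
by congr (_ + _); congr nat_of_bool; apply/eqP/eqP; lia.
Qed.

Lemma lt_anl i n : i <= n -> i < anl M n.
Proof. by move=> h; rewrite anlE /um; have := ltn_expl n (isT : 1 < 2); case: odd; lia. Qed.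

Lemma lambda_prefix i : exists2 n, i < anl M n & forall j, j <= i -> lambda M j = Lb M n j.
Proof.
have h := lt_anl (leqnn i).
by exists i => // j ji; apply: lambda_Lb; lia.
Qed.

Lemma lambda_le : inOmega M (lambda M).
Proof. by move=> i; have [n _ h] := lambda_prefix i; rewrite h //; exact: Lb_le. Qed.

Lemma cR_max m x l : fund M m x -> lle (sh l (cR M m x)) (cR M m x).
Proof.
move=> F; have hW : W 1 k1 k1 by move=> i; split=> t [_]; rewrite /rf /sh /k1.
by have [] := psi_W F bink1 erefl bink1 (leq0n 1) hW l.
Qed.

Lemma lambda_max l : lle (sh l (lambda M)) (lambda M).
Proof.
move=> t ht; have [n _ h] := lambda_prefix (l + t).
apply: (@cR_max _ _ l (fund_an M0 n) t).
by apply: lt_at_ext ht _ _ => j jt; rewrite /sh h //; lia.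
Qed.

Lemma lambda_end0 : not_end0 (lambda M).
Proof.
move=> n; exists (2 ^ n).-1; split; first by have := ltn_expl n (isT : 1 < 2); lia.
rewrite /lambda prednK ?expn_gt0 // tau_pow2; have := tau_le1 (2 ^ n).-1.
by have := odd_double_half M; case: (odd M) => /=; lia.
Qed.

Lemma an_lambda n : lex_lt (anx M n) (lambda M).
Proof.
have F := fund_an M0 n; have N0 := fund_m F; exists (anl M n).-1.
split=> [i hi|]; rewrite (@lambda_Lb n) /Lb ?cR_lt //; try lia.
Qed.

Lemma Lb_decr n : lex_lt (Lb M n.+1) (Lb M n).
Proof.
rewrite Lb_S //; apply/(psi_llt (fund_an M0 n)) => //.
  exact: (cR_le (fund_u (isT : 0 < 1))).
have U := fund_u (isT : 0 < 1).
exists 2; split=> [i i2|]; first by rewrite /uR cR_lt //; case: i i2 => [|[|]].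
have := congr1 (fun f => f 0) (cR_sh U); rewrite /sh addn0 => h.
by rewrite /uR (_ : um 1 = 2) // in h *; rewrite h.
Qed.

Lemma Lb_mono n n' : n <= n' -> lle (Lb M n') (Lb M n).
Proof.
elim: n' => [|n' IH]; first by rewrite leqn0 => /eqP ->; exact: lle_refl.
rewrite leq_eqVlt => /orP[/eqP ->|h]; first exact: lle_refl.
by apply: lle_trans (IH h); exact/lltW/Lb_decr.
Qed.

Lemma lambda_Lb_lt n : lex_lt (lambda M) (Lb M n).
Proof.
apply: lle_lt_trans (Lb_decr n) => t ht.
apply: (@Lb_mono n.+1 (maxn n.+1 t) (leq_maxl _ _) t).
apply: lt_at_ext ht _ _ => // j jt; rewrite (@lambda_Lb (maxn n.+1 t)) //.
by apply: lt_anl; apply: leq_trans jt (leq_maxr _ _).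
Qed.

End Lambda.

Local Open Scope classical_set_scope.
Local Open Scope ring_scope.

(** * Expansions in real bases *)

Definition qval (R : realType) (q : R) (x : sq) : R := limn (psum R q x).

Section Value.
Variables (R : realType) (M : nat) (q : R).
Hypothesis q1 : 1 < q.
Let q0 : 0 < q. Proof. by apply: lt_trans q1. Qed.
Let qn n : 0 < q ^+ n. Proof. exact: exprn_gt0. Qed.
Let qne : q != 0. Proof. by rewrite gt_eqF. Qed.
Notation psum := (psum R q).
Notation qval := (qval q).
(** The value of the constant sequence [M]. *)
Definition vmax : R := M%:R / (q - 1).

Lemma vmax_ge0 : 0 <= vmax.
Proof. by rewrite divr_ge0 // subr_ge0 ltW. Qed.

Lemma vmaxE : (M%:R + vmax) / q = vmax.
Proof.
have h : q - 1 != 0 by rewrite gt_eqF // subr_gt0.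
by rewrite /vmax; field; rewrite h qne.
Qed.

Lemma psumS x n : psum x n.+1 = ((x 0%N)%:R + psum (sh 1 x) n) / q.
Proof.
rewrite /Defs.psum big_nat_recl // expr1 mulrDl; congr (_ + _).
rewrite mulr_suml; apply: eq_bigr => i _; rewrite /sh add1n exprS invfM mulrCA mulrA.
by rewrite -mulrA [q^-1 * _]mulrC.
Qed.

Lemma psum_le x n : inOmega M x -> psum x n <= vmax.
Proof.
elim: n x => [|n IH] x hx; first by rewrite /Defs.psum big_nil vmax_ge0.
rewrite psumS -vmaxE ler_pM2r ?invr_gt0 //; apply: lerD; first by rewrite ler_nat.
exact/IH/sh_le.
Qed.

Lemma psum_nd x : nondecreasing_seq (psum x).
Proof.
apply/nondecreasing_seqP => n; rewrite /Defs.psum big_nat_recr //= lerDl.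
by rewrite divr_ge0 // ltW.
Qed.

Lemma psum_cvg x : inOmega M x -> psum x @ \oo --> qval x.
Proof.
move=> hx; apply: nondecreasing_is_cvgn; first exact: psum_nd.
by exists vmax => _ [n _ <-]; exact: psum_le.
Qed.

Lemma expansionE x s : inOmega M x -> expansion R q x s <-> s = qval x.
Proof.
move=> hx; split=> [h|->]; last exact: psum_cvg.
by symmetry; apply: cvg_lim.
Qed.

Lemma psum_val x n : inOmega M x -> psum x n <= qval x.
Proof.
move=> hx; apply: nondecreasing_cvgn_le; first exact: psum_nd.
by apply/cvg_ex; exists (qval x); exact: psum_cvg.
Qed.

Lemma val_le x : inOmega M x -> qval x <= vmax.
Proof.
move=> hx; apply: limr_le; first by apply/cvg_ex; exists (qval x); exact: psum_cvg.
by near=> n; exact: psum_le.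
Unshelve. all: by end_near. Qed.

Lemma val_ge0 x : inOmega M x -> 0 <= qval x.
Proof. by move=> /(psum_val 0); rewrite {1}/Defs.psum big_nil. Qed.

Lemma valS x : inOmega M x -> qval x = ((x 0%N)%:R + qval (sh 1 x)) / q.
Proof.
move=> hx; apply: cvg_lim => //; rewrite -(cvg_shiftS (psum x)).
rewrite [X in X @ _](_ : _ = fun n => ((x 0%N)%:R + psum (sh 1 x) n) / q).
  by apply: cvgMl; apply: cvgD; [exact: cvg_cst|apply/psum_cvg/sh_le].
by apply: funext => n; exact: psumS.
Qed.

Lemma psum_recr x n : psum x n.+1 = psum x n + (x n)%:R / q ^+ n.+1.
Proof. by rewrite /Defs.psum big_nat_recr. Qed.

Lemma val_cat x n : inOmega M x -> qval x = psum x n + qval (sh n x) / q ^+ n.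
Proof.
move=> hx; elim: n => [|n IH]; first by rewrite /Defs.psum big_nil add0r expr0 divr1 sh0.
rewrite psum_recr IH valS; last exact: sh_le.
rewrite sh_sh addn1 -addrA; congr (_ + _).
by rewrite /sh addn0 exprS; field; rewrite qne gt_eqF.
Qed.

Lemma eq_psum x y n : (forall i, (i < n)%N -> x i = y i) -> psum x n = psum y n.
Proof.
move=> h; rewrite /Defs.psum !big_mkord; apply: eq_bigr => i _.
by rewrite h.
Qed.

Lemma val_gt0 x i : inOmega M x -> x i <> 0%N -> 0 < qval x.
Proof.
move=> hx xi; rewrite (val_cat i.+1 hx) psum_recr.
have h0 : 0 <= psum x i.
  by have := psum_nd x (leq0n i); rewrite {1}/Defs.psum big_nil.
have h1 : 0 < (x i)%:R / q ^+ i.+1 by rewrite divr_gt0 // ltr0n lt0n; exact/eqP.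
have h2 : 0 <= qval (sh i.+1 x) / q ^+ i.+1.
  by rewrite divr_ge0 ?(ltW (qn _)) //; exact/val_ge0/sh_le.
lra.
Qed.

Lemma val_lt_at x y t : inOmega M x -> inOmega M y -> lt_at x y t ->
  (1 + qval (sh t.+1 y) - qval (sh t.+1 x)) / q ^+ t.+1 <= qval y - qval x.
Proof.
move=> hx hy [h1 h2]; rewrite (val_cat t.+1 hx) (val_cat t.+1 hy) !psum_recr.
rewrite (eq_psum h1).
have h3 : ((x t)%:R + 1) / q ^+ t.+1 <= (y t)%:R / q ^+ t.+1.
  by rewrite ler_pM2r ?invr_gt0 // natr1 ler_nat.
move: h3; rewrite !mulrDl mul1r mulNr; lra.
Qed.

Lemma pow_unbounded (e b : R) : 0 < e -> exists n, b < q ^+ n * e.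
Proof.
move=> e0; have d0 : 0 < (q - 1) * e by rewrite mulr_gt0 // subr_gt0.
have [n hn] : exists n : nat, b / ((q - 1) * e) < n%:R.
  exists (Num.Def.truncn (`|b / ((q - 1) * e)|)).+1.
  by apply: le_lt_trans (ler_norm _) _; exact: truncnS_gt.
exists n; rewrite ltr_pdivrMr // in hn; apply: lt_le_trans hn _.
have bern : n%:R * (q - 1) <= q ^+ n.
  elim: n => [|n IH]; first by rewrite mul0r expr0.
  rewrite -natr1 mulrDl mul1r exprS.
  have h1 : 1 <= q ^+ n by apply: exprn_ege1; exact: ltW.
  have h2 : (q - 1) * 1 <= (q - 1) * q ^+ n by rewrite ler_pM2l // subr_gt0.
  lra.
by rewrite mulrA ler_pM2r.
Qed.

Section Key.
Variable a : sq.
Hypotheses (ale : inOmega M a) (aval : qval a = 1) (an0 : not_end0 a).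

Lemma key_step x t : inOmega M x -> lt_at x a t ->
  q ^+ t.+1 * (qval x - 1) < qval (sh t.+1 x) - 1.
Proof.
move=> hx h; have h1 := val_lt_at hx ale h; rewrite aval in h1.
rewrite ler_pdivrMr // in h1.
have [i [ti hi]] := an0 t.+1.
have : 0 < qval (sh t.+1 a).
  by apply: (@val_gt0 _ (i - t.+1)); [exact: sh_le|rewrite /sh subnKC].
lra.
Qed.

(** Cutting [x] after its first difference with [a] multiplies an excess of the value over 1 by at
    least [q]. Iterating contradicts the bound [vmax]. *)
Lemma key_le x : inOmega M x -> (forall i, lle (sh i x) a) -> qval x <= 1.
Proof.
move=> hx hle; rewrite leNgt; apply/negP => v1.
have H n : exists i, q ^+ n * (qval x - 1) <= qval (sh i x) - 1.
  elim: n => [|n [i IH]]; first by exists 0%N; rewrite sh0 expr0 mul1r.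
  have vi : 0 < qval (sh i x) - 1.
    by apply: lt_le_trans IH; rewrite mulr_gt0 // subr_gt0.
  have /lleP[[t ht]|e] := hle i; last by move: vi; rewrite e aval subrr ltxx.
  exists (i + t.+1)%N; have := key_step (sh_le i hx) ht; rewrite sh_sh => h.
  apply: le_trans (ltW h); rewrite exprS -mulrA; apply: ler_pM => //.
  - exact: ltW.
  - by apply: mulr_ge0; [exact: ltW|rewrite subr_ge0 ltW].
  - by rewrite exprS ler_peMr ?(ltW q0) //; apply: exprn_ege1; exact: ltW.
have d0 : 0 < qval x - 1 by rewrite subr_gt0.
have [n hn] := pow_unbounded vmax d0.
have [i hi] := H n; have := val_le (sh_le i hx); lra.
Qed.

Lemma key_lt x : inOmega M x -> (forall i, lle (sh i x) a) -> lex_lt x a -> qval x < 1.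
Proof.
move=> hx hle [t ht]; have h := key_step hx ht.
have h2 : qval (sh t.+1 x) <= 1.
  by apply: key_le => [|i]; [exact: sh_le|rewrite sh_sh].
have : q ^+ t.+1 * (qval x - 1) < 0 by lra.
by rewrite pmulr_rlt0 // subr_lt0.
Qed.

Lemma is_alpha_of : q <= M.+1%:R -> (forall i, lle (sh i a) a) -> is_alpha R M q a.
Proof.
move=> qM amax; split=> //; first by rewrite q1.
  by apply/expansionE.
move=> b hb bn0 /(expansionE _ hb) bval; apply/lex_leE; apply/lle_nlt => -[t ht].
have h := val_lt_at ale hb ht; rewrite aval -bval subrr in h.
have h1 : qval (sh t.+1 a) <= 1 by apply: key_le => [|i]; [exact: sh_le|rewrite sh_sh].
have [i [ti hi]] := bn0 t.+1.
have h2 : 0 < qval (sh t.+1 b).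
  by apply: (@val_gt0 _ (i - t.+1)); [exact: sh_le|rewrite /sh subnKC].
move: h; rewrite pmulr_lle0 ?invr_gt0 //; lra.
Qed.

End Key.

(** Remainders and values obey the same recursion, so their difference is multiplied by [q] at each
    step; both are bounded, hence it vanishes. *)
Lemma expansion_rem (r : nat -> R) (a : sq) (b : R) :
  (forall n, r n.+1 = q * r n - (a n)%:R) -> (forall n, 0 <= r n <= b) ->
  inOmega M a -> forall n, qval (sh n a) = r n.
Proof.
move=> hr hb ha n.
have H k x : inOmega M x -> forall s : nat -> R, (forall n, s n.+1 = q * s n - (x n)%:R) ->
   psum x k = s 0%N - s k / q ^+ k.
  move=> hx s hs; elim: k => [|k IH]; first by rewrite /Defs.psum big_nil expr0 divr1 subrr.
  by rewrite psum_recr IH hs exprS; field; rewrite qne gt_eqF.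
have h1 := val_cat _ (sh_le n ha).
apply/eqP/negPn/negP => ne; have dn : 0 < `|qval (sh n a) - r n| by rewrite normr_gt0 subr_eq0.
have [k hk] := pow_unbounded (vmax + b) dn.
have h2 := H k (sh n a) (sh_le n ha) (fun i => r (n + i)%N) (fun i => etrans (congr1 r (addnS n i)) (hr _)).
move: (h1 k); rewrite h2 // addn0 => e.
have e2 : q ^+ k * (qval (sh n a) - r n) = qval (sh k (sh n a)) - r (n + k)%N.
  by rewrite e; field; rewrite gt_eqF.
have v0 := val_ge0 (sh_le k (sh_le n ha)); have v1 := val_le (sh_le k (sh_le n ha)).
have /andP[r0 r1] := hb (n + k)%N; have /andP[r2 r3] := hb n.
have : q ^+ k * `|qval (sh n a) - r n| <= vmax + b.
  rewrite -[q ^+ k]ger0_norm ?(ltW (qn _)) // -normrM e2 ler_norml.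
  by apply/andP; split; lra.
lra.
Qed.

End Value.

Section Digits.
Variable R : realType.

Lemma digit_pos (M : nat) (y : R) : 0 < y <= M.+1%:R ->
  exists2 d : nat, (d <= M)%N & 0 < y - d%:R <= 1.
Proof.
elim: M y => [|M IH] y /andP[y0 y1]; first by exists 0%N => //; rewrite subr0 y0.
have [h|h] := lerP y 1; first by exists 0%N => //; rewrite subr0 y0.
have [|d dM hd] := IH (y - 1).
  by rewrite subr_gt0 h lerBlDr natr1.
by exists d.+1 => //; rewrite -natr1 [d%:R + 1]addrC opprD addrA.
Qed.

Lemma digit_ge0 (M : nat) (b y : R) : 1 <= b -> 0 <= y <= M%:R + b ->
  exists2 d : nat, (d <= M)%N & 0 <= y - d%:R <= b.
Proof.
move=> b1; elim: M y => [|M IH] y /andP[y0 y1].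
  by exists 0%N => //; rewrite subr0 y0; rewrite add0r in y1.
have [h|h] := lerP y b; first by exists 0%N => //; rewrite subr0 y0.
have [|d dM hd] := IH (y - 1).
  rewrite subr_ge0 (le_trans b1 (ltW h)) lerBlDr.
  by rewrite -natr1 in y1; apply/(le_trans y1); lra.
by exists d.+1 => //; rewrite -natr1 [d%:R + 1]addrC opprD addrA.
Qed.

Variables (M : nat) (q : R).
Hypotheses (q1 : 1 < q) (qM : q <= M.+1%:R).
Let q0 : 0 < q. Proof. exact: lt_trans q1. Qed.

Lemma vmax_ge1 : 1 <= vmax M q.
Proof. by rewrite /vmax ler_pdivlMr ?subr_gt0 // mul1r lerBlDr natr1. Qed.

Lemma expansion_exists (v : R) : 0 <= v <= vmax M q ->
  exists2 a, inOmega M a & qval q a = v.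
Proof.
move=> hv; have B1 := vmax_ge1.
have : forall y : R, exists d : nat, 0 <= y <= M%:R + vmax M q ->
    (d <= M)%N /\ 0 <= y - d%:R <= vmax M q.
  move=> y; have [h|h] := boolP (0 <= y <= M%:R + vmax M q); last by exists 0%N.
  by have [d h1 h2] := digit_ge0 B1 h; exists d.
move=> /choice[f hf].
pose r n := iter n (fun s => q * s - (f (q * s))%:R) v; pose a n := f (q * r n).
have qv : q * vmax M q = M%:R + vmax M q.
  by rewrite -{1}(vmaxE M q1) mulrCA divff ?mulr1 // gt_eqF.
have H n : 0 <= q * r n <= M%:R + vmax M q /\ 0 <= r n <= vmax M q.
  have W s : 0 <= s <= vmax M q -> 0 <= q * s <= M%:R + vmax M q.
    by move=> /andP[s0 s1]; rewrite mulr_ge0 ?(ltW q0) //= -qv ler_pM2l.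
  elim: n => [|n [IH1 IH2]]; first by split => //; exact: W.
  have [_ h] := hf _ IH1; split => //; exact: W.
have aM : inOmega M a by move=> n; have [h _] := H n; have [] := hf _ h.
exists a => //; have := @expansion_rem R M q q1 r a (vmax M q) _ _ aM 0%N.
by rewrite sh0; apply=> // n; have [] := H n.
Qed.

(** The digits keep the remainder in (0, 1]. It is never 0, so the expansion does not end in zeros;
    a shift exceeding [a] would have a remainder above 1. *)
Lemma quasi_greedy : exists a, [/\ inOmega M a, not_end0 a, qval q a = 1 & forall i, lle (sh i a) a].
Proof.
have : forall y : R, exists d : nat, 0 < y <= M.+1%:R -> (d <= M)%N /\ 0 < y - d%:R <= 1.
  move=> y; have [h|h] := boolP (0 < y <= M.+1%:R); last by exists 0%N.
  by have [d h1 h2] := digit_pos h; exists d.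
move=> /choice[f hf].
pose r n := iter n (fun s => q * s - (f (q * s))%:R) 1; pose a n := f (q * r n).
have H n : 0 < q * r n <= M.+1%:R /\ 0 < r n <= 1.
  have W s : 0 < s <= 1 -> 0 < q * s <= M.+1%:R.
    move=> /andP[s0 s1]; rewrite mulr_gt0 //=; apply: le_trans qM.
    by rewrite ler_piMr // ltW.
  elim: n => [|n [IH1 IH2]]; first by split; [apply: W|]; rewrite ltr01 /=.
  have [_ h] := hf _ IH1; split => //; exact: W.
have aM : inOmega M a by move=> n; have [h _] := H n; have [] := hf _ h.
have va n : qval q (sh n a) = r n.
  apply: (@expansion_rem R M q q1 r a 1 _ _ aM) => // k.
  by have [_ /andP[/ltW-> ->]] := H k.
have a0 : qval q a = 1 by rewrite -[a]sh0 va.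
exists a; split=> //.
- move=> n; apply: contrapT => hn.
  have z i : sh n a i = 0%N.
    apply: contrapT => h; apply: hn; exists (n + i)%N; split => //; exact: leq_addr.
  have : qval q (sh n a) = 0.
    apply: cvg_lim => //; rewrite (_ : psum R q (sh n a) = fun=> 0); first exact: cvg_cst.
    apply: funext => k; rewrite /psum big1_seq // => i _; by rewrite z mul0r.
  by rewrite va => e; have [_] := H n; rewrite e ltxx.
- move=> i; apply/lle_nlt => -[t ht].
  have h := val_lt_at q1 aM (sh_le i aM) ht; rewrite sh_sh !va a0 in h.
  have [_ /andP[r1 r2]] := H i; have [_ /andP[r3 r4]] := H (i + t.+1)%N.
  have [_ /andP[r5 r6]] := H t.+1.
  have : 0 < (1 + r (i + t.+1)%N - r t.+1) / q ^+ t.+1.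
    by apply: divr_gt0; [lra|exact: exprn_gt0].
  lra.
Qed.

End Digits.

(** * Quasi-greedy expansions and their bases *)

Section Alpha.
Variables (R : realType) (M : nat).

Lemma is_alpha_uniq (q : R) a b : is_alpha R M q a -> is_alpha R M q b -> a = b.
Proof.
move=> [_ a1 a2 a3 a4] [_ b1 b2 b3 b4].
by apply: lle_anti; apply/lex_leE; [exact: b4|exact: a4].
Qed.

Lemma alpha_exists (q : R) : 1 < q -> q <= M.+1%:R -> exists a, is_alpha R M q a.
Proof.
move=> q1 qM; have [a [h1 h2 h3 h4]] := quasi_greedy q1 qM.
by exists a; apply: is_alpha_of.
Qed.

Lemma alpha_props (q : R) a : is_alpha R M q a ->
  [/\ 1 < q, q <= M.+1%:R, inOmega M a, not_end0 a & qval q a = 1] /\ forall i, lle (sh i a) a.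
Proof.
move=> h; have [/andP[q1 qM] h1 h2 h3 h4] := h.
have [b [b1 b2 b3 b4]] := quasi_greedy q1 qM.
have e : a = b by apply: is_alpha_uniq h _; apply: is_alpha_of.
by subst b.
Qed.

Lemma val_decr (q1 q2 : R) x : 1 < q1 -> q1 <= q2 -> inOmega M x ->
  q2 / q1 * qval q2 x <= qval q1 x.
Proof.
move=> h1 h2 hx; have h3 : 1 < q2 by exact: lt_le_trans h2.
have h10 : 0 < q1 by exact: lt_trans h1. have h20 : 0 < q2 by exact: lt_trans h3.
have c1 := psum_cvg h3 hx.
have c2 : (fun n => q2 / q1 * psum R q2 x n) @ \oo --> q2 / q1 * qval q2 x.
  by apply: cvgM => //; exact: cvg_cst.
apply: (ler_cvg_to c2 (psum_cvg h1 hx)); near=> n.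
rewrite /psum mulr_sumr; apply: ler_sum => i _.
rewrite mulrCA; apply: ler_wpM2l => //.
rewrite !exprS !invfM mulrA -[q2 / q1 * _]mulrAC divff ?gt_eqF // mul1r.
rewrite ler_pM2l ?invr_gt0 // lef_pV2 ?posrE ?exprn_gt0 //.
by apply: lerXn2r => //; rewrite nnegrE ltW.
Unshelve. all: by end_near. Qed.

(** If [a2] were at most [a1], its value in base [q1] would be at most 1 by [key_le]; but it is at
    least [q2 / q1]. *)
Lemma alpha_incr (q1 q2 : R) a1 a2 : is_alpha R M q1 a1 -> is_alpha R M q2 a2 ->
  q1 < q2 -> lex_lt a1 a2.
Proof.
move=> A1 A2 q12.
have [[h1 h2 h3 h4 h5] h6] := alpha_props A1; have [[k1 k2 k3 k4 k5] k6] := alpha_props A2.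
apply/llt_nle => h.
have v1 : qval q1 a2 <= 1.
  by apply: (key_le h1 h3 h5 h4 k3) => i; apply: lle_trans h.
have := val_decr h1 (ltW q12) k3; rewrite k5 mulr1 => v2.
have : 1 < q2 / q1 by rewrite ltr_pdivlMr ?mul1r //; exact: lt_trans h1.
lra.
Qed.

Lemma alpha_incrE (q1 q2 : R) a1 a2 : is_alpha R M q1 a1 -> is_alpha R M q2 a2 ->
  (q1 < q2) <-> lex_lt a1 a2.
Proof.
move=> A1 A2; split; first exact: alpha_incr.
have [//|h|e] := ltgtP q1 q2.
  by move=> /lltW/lle_nlt; case; exact: alpha_incr h.
by subst q2; rewrite (is_alpha_uniq A1 A2) => /llt_irr.
Qed.

End Alpha.

Section Base.
Variables (R : realType) (M : nat).

Lemma vmax_anti (p q : R) : 1 < p -> p <= q -> vmax M q <= vmax M p.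
Proof.
move=> p1 pq; rewrite /vmax ler_wpM2l // lef_pV2 ?posrE ?subr_gt0 //; first by rewrite lerD2r.
exact: lt_le_trans pq.
Qed.

Let lip_arith (d A B A' B' E V q1 q2 : R) : q1 * A = d + A' -> q2 * B = d + B' ->
  (q2 - q1) * B <= (q2 - q1) * V -> (q2 - q1) * V <= (q1 - 1) * E ->
  q1 * (A - B - E) <= A' - B' - E.
Proof. by move=> f1 f2 v3 EV; nra. Qed.

(** Amplification again: an excess over the bound is multiplied by at least [q1] at each shift,
    while the differences of values stay bounded. *)
Lemma val_lip (p q1 q2 : R) x : 1 < p -> p <= q1 -> q1 <= q2 -> inOmega M x ->
  qval q1 x - qval q2 x <= (q2 - q1) * (vmax M p / (p - 1)).
Proof.
move=> p1 pq1 q12 hx.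
have h1 : 1 < q1 by exact: lt_le_trans pq1.
have h2 : 1 < q2 by exact: lt_le_trans q12.
set V := vmax M p; set E := (q2 - q1) * (V / (p - 1)).
have V0 : 0 <= V by exact: vmax_ge0.
have pp : 0 < p - 1 by rewrite subr_gt0.
have E0 : 0 <= E by rewrite mulr_ge0 ?subr_ge0 // divr_ge0 // ltW.
have EV : (q1 - 1) * E >= (q2 - q1) * V.
  have -> : (q2 - q1) * V = (p - 1) * E by rewrite /E; field; rewrite gt_eqF.
  by rewrite ler_wpM2r // lerD2r.
rewrite leNgt; apply/negP => hD.
pose D n := qval q1 (sh n x) - qval q2 (sh n x).
have step n : q1 * (D n - E) <= D n.+1 - E.
  have hs := sh_le n hx; have hs1 := sh_le 1 hs.
  have e1 := valS h1 hs; have e2 := valS h2 hs.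
  have f1 : q1 * qval q1 (sh n x) = (sh n x 0%N)%:R + qval q1 (sh 1 (sh n x)).
    by rewrite e1 mulrCA divff ?mulr1 // gt_eqF // (lt_trans _ h1).
  have f2 : q2 * qval q2 (sh n x) = (sh n x 0%N)%:R + qval q2 (sh 1 (sh n x)).
    by rewrite e2 mulrCA divff ?mulr1 // gt_eqF // (lt_trans _ h2).
  rewrite /D -addn1 -sh_sh.
  have v2 : qval q2 (sh n x) <= V.
    by apply: le_trans (val_le h2 hs) _; apply: vmax_anti => //; exact: le_trans q12.
  have v3 : (q2 - q1) * qval q2 (sh n x) <= (q2 - q1) * V by rewrite ler_wpM2l // subr_ge0.
  exact: lip_arith f1 f2 v3 EV.
have H n : q1 ^+ n * (D 0%N - E) <= D n - E.
  elim: n => [|n IH]; first by rewrite expr0 mul1r.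
  apply: le_trans (step n); rewrite exprS -mulrA ler_pM2l //.
  exact: lt_trans h1.
have d0 : 0 < D 0%N - E by rewrite /D sh0 subr_gt0.
have [n hn] := pow_unbounded h1 (vmax M q1) d0.
have h3 : D n - E <= vmax M q1.
  by rewrite /D; have := val_le h1 (sh_le n hx); have := val_ge0 h2 (sh_le n hx); lra.
by have := lt_le_trans hn (le_trans (H n) h3); rewrite ltxx.
Qed.

Lemma base_near1 a : inOmega M a -> not_end0 a -> exists p : R,
  [/\ 1 < p, p <= M.+1%:R & 1 <= qval p a].
Proof.
move=> ale an0; have [i [_ hi]] := an0 0%N; have [j [ij hj]] := an0 i.+1.
have M0 : (0 < M)%N by have := ale i; rewrite lt0n; case: (M) => //; case: (a i) hi.
(* The choice [p ^+ n = 2] makes each of the nonzero digits at [i] and [j] contribute at least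
   1/2. *)
pose n := j.+1; pose p : R := expR (ln 2 / n%:R).
have pn : p ^+ n = 2.
  by rewrite -expRM_natl mulrC -mulrA mulVf ?mulr1 ?lnK ?posrE // pnatr_eq0.
have p1 : 1 < p by rewrite -expR0 ltr_expR divr_gt0 ?ln_gt0 // ltr1n.
have p0 : 0 < p by exact: lt_trans p1.
exists p; split=> //.
  apply: le_trans (_ : 2 <= _); last by rewrite ler_nat.
  by rewrite -pn -[X in X <= _]expr1 ler_eXn2l.
have dig k : (k < n)%N -> a k <> 0%N -> 2^-1 <= (a k)%:R / p ^+ k.+1.
  move=> kn hk; apply: le_trans (_ : (p ^+ k.+1)^-1 <= _).
    by rewrite -pn lef_pV2 ?posrE ?exprn_gt0 // ler_eXn2l.
  rewrite ler_peMl ?invr_ge0 ?exprn_ge0 ?(ltW p0) // ler1n lt0n; exact/eqP.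
have h1 := psum_val p1 n ale; rewrite psum_recr in h1.
have h2 := psum_nd p1 a ij; rewrite psum_recr in h2.
have h3 := psum_nd p1 a (leq0n i); rewrite {1}/psum big_nil in h3.
have h4 := dig i (leq_trans ij (leqnSn j)) hi; have h5 := dig j (leqnn _) hj.
have : (2^-1 : R) + 2^-1 = 1 by field.
lra.
Qed.

(** An intermediate value argument: the supremum of the bases where [a] has value at least 1 gives
    the value 1, by the continuity in [val_lip] and since in base M+1 no value exceeds 1. *)
Lemma alpha_base a : inOmega M a -> not_end0 a -> (forall i, lle (sh i a) a) ->
  exists q : R, is_alpha R M q a.
Proof.
move=> ale an0 amax; have [p [p1 pM pv]] := base_near1 ale an0.
pose S := [set q : R | p <= q <= M.+1%:R /\ 1 <= qval q a].
have Sp : S p by split=> //; rewrite lexx.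
have hS : has_sup S by split; [exists p|exists M.+1%:R => q [/andP[]]].
pose s := sup S.
have ps : p <= s by apply: sup_upper_bound.
have sM : s <= M.+1%:R by apply: ge_sup; [exists p|move=> q [/andP[]]].
have s1 : 1 < s by exact: lt_le_trans ps.
pose Lc := vmax M p / (p - 1).
have L0 : 0 <= Lc by rewrite divr_ge0 ?vmax_ge0 // subr_ge0 ltW.
have L1 : 0 < Lc + 1 by lra.
have vge : 1 <= qval s a.
  rewrite leNgt; apply/negP => vs.
  have d0 : 0 < (1 - qval s a) / (Lc + 1) by rewrite divr_gt0 // subr_gt0.
  have [q [/andP[pq qM] vq] hq] := sup_adherent d0 hS.
  have qs : q <= s by apply: sup_upper_bound => //; split => //; rewrite pq.
  have := val_lip p1 pq qs ale; rewrite -/Lc => h.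
  have : (s - q) * Lc <= (1 - qval s a) / (Lc + 1) * Lc.
    by rewrite ler_wpM2r //; rewrite -/s in hq; lra.
  have e : (1 - qval s a) / (Lc + 1) * Lc + (1 - qval s a) / (Lc + 1) = 1 - qval s a.
    by field; rewrite gt_eqF.
  lra.
have vle : qval s a <= 1.
  rewrite leNgt; apply/negP => vs.
  have sM' : s < M.+1%:R.
    rewrite lt_neqAle sM andbT; apply/eqP => e; move: vs; rewrite e ltNge.
    have M1 : (1 : R) < M.+1%:R by exact: lt_le_trans pM.
    rewrite (le_trans (val_le M1 ale)) // /vmax -natr1 addrK.
    have [->|M0] := posnP M; first by rewrite mul0r.
    by rewrite divff // pnatr_eq0 -lt0n.
  pose d := Num.min (M.+1%:R - s) ((qval s a - 1) / (Lc + 1)).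
  have d0 : 0 < d by rewrite lt_min subr_gt0 sM' divr_gt0 // subr_gt0.
  have sd : s <= s + d by rewrite lerDl ltW.
  have dM : d <= M.+1%:R - s by rewrite ge_min lexx.
  have dv : d <= (qval s a - 1) / (Lc + 1) by rewrite ge_min lexx orbT.
  have := val_lip p1 ps sd ale; rewrite -/Lc addrAC subrr add0r => h.
  have h2 : d * Lc <= (qval s a - 1) / (Lc + 1) * Lc by rewrite ler_wpM2r.
  have e : (qval s a - 1) / (Lc + 1) * Lc + (qval s a - 1) / (Lc + 1) = qval s a - 1.
    by field; rewrite gt_eqF.
  have Ssd : S (s + d).
    by split; [apply/andP; split; lra|lra].
  have := sup_upper_bound hS Ssd; rewrite -/s; lra.
exists s; apply: is_alpha_of => //; apply/eqP; rewrite eq_le vle; exact: vge.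
Qed.

End Base.

(** * Unique expansions and the subshift *)

Section Univ.
Variables (R : realType) (M : nat) (q : R) (al : sq).
Hypothesis A : is_alpha R M q al.
Let P := alpha_props A.
Let q1 : 1 < q. Proof. by have [[]] := P. Qed.
Let qM : q <= M.+1%:R. Proof. by have [[]] := P. Qed.
Let ale : inOmega M al. Proof. by have [[]] := P. Qed.
Let an0 : not_end0 al. Proof. by have [[]] := P. Qed.
Let aval : qval q al = 1. Proof. by have [[]] := P. Qed.
Let amax i : lle (sh i al) al. Proof. by have [_ h] := P; exact: h. Qed.
Let qn n : 0 < q ^+ n. Proof. by apply: exprn_gt0; exact: lt_trans q1. Qed.

Lemma UcalE x : Ucal R M q x <-> inOmega M x /\ forall y, inOmega M y -> qval q y = qval q x -> y = x.
Proof.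
split=> -[hx h]; split=> // y.
- move=> hy e; apply: funext; apply: (h y (qval q x)) => //.
    exact/(expansionE q1 _ hx).
  exact/(expansionE q1 _ hy).
- move=> s hy /(expansionE q1 _ hx) e1 /(expansionE q1 _ hy) e2 i.
  by rewrite (h y) // -e2.
Qed.

Lemma val_rf x : inOmega M x -> qval q (rf M x) = vmax M q - qval q x.
Proof.
move=> hx; have hm : inOmega M (fun=> M) by [].
have e : psum R q (rf M x) = fun n => psum R q (fun=> M) n - psum R q x n.
  apply: funext => n; rewrite /psum -sumrB; apply: eq_bigr => i _.
  by rewrite /rf natrB // mulrBl.
have c1 := psum_cvg q1 hm; have c2 := psum_cvg q1 hx.
have -> : vmax M q = qval q (fun=> M).
  have := valS q1 hm; have -> : sh 1 (fun=> M) = (fun=> M) by [].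
  move=> h; have q0 : q - 1 != 0 by rewrite gt_eqF // subr_gt0.
  have qq : q != 0 by rewrite gt_eqF // (lt_trans _ q1).
  have {}h : q * qval q (fun=> M) = M%:R + qval q (fun=> M) by rewrite {1}h mulrCA divff ?mulr1.
  by apply: (mulIf q0); rewrite /vmax divfK //; lra.
by apply: cvg_lim => //; rewrite e; exact: cvgB.
Qed.

Lemma Ucal_rf x : Ucal R M q x -> Ucal R M q (rf M x).
Proof.
move=> /UcalE[hx h]; apply/UcalE; split=> [|y hy]; first exact: rf_le.
rewrite val_rf // => e; have : rf M y = x.
  by apply: h; [exact: rf_le|rewrite val_rf // e; lra].
by move=> <-; rewrite rfK.
Qed.

(** Otherwise the tail has value at least 1, and raising the digit at [i] and expanding the tail
    value minus 1 gives a second expansion. *)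
Lemma Ucal_up x i : Ucal R M q x -> (x i < M)%N -> lex_lt (sh i.+1 x) al.
Proof.
move=> /UcalE[hx h] xi; apply/llt_nle => hl.
have v1 : 1 <= qval q (sh i.+1 x).
  have /lleP[[t ht]|<-] := hl; last by rewrite aval.
  have h1 := val_lt_at q1 ale (sh_le i.+1 hx) ht; rewrite aval in h1.
  have h2 : qval q (sh t.+1 al) <= 1.
    by apply: (key_le q1 ale aval an0 (sh_le t.+1 ale)) => j; rewrite sh_sh.
  have h3 := val_ge0 q1 (sh_le t.+1 (sh_le i.+1 hx)).
  have : 0 <= (1 + qval q (sh t.+1 (sh i.+1 x)) - qval q (sh t.+1 al)) / q ^+ t.+1.
    by apply: divr_ge0; [lra|exact: ltW].
  lra.
have v2 := val_le q1 (sh_le i.+1 hx).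
have [|y yle yv] := @expansion_exists R M q q1 qM (qval q (sh i.+1 x) - 1).
  by apply/andP; split; lra.
pose z := glued i.+1 (fun j => if j == i then (x i).+1 else x j) y.
have zle : inOmega M z.
  move=> j; rewrite /z /glued; case: ifP => _; last exact: yle.
  by case: eqP => // ->.
have zsh : sh i.+1 z = y by rewrite -[i.+1]addn0 /z addn0 -[X in sh X]addn0 glued_sh sh0.
have zpre : psum R q z i = psum R q x i.
  apply: eq_psum => j ji; rewrite /z glued_lt; last by lia.
  by rewrite (_ : j == i = false) //; apply/eqP; lia.
have zi : z i = (x i).+1 by rewrite /z glued_lt // eqxx.
have : z = x.
  apply: h => //; rewrite (val_cat q1 i.+1 zle) (val_cat q1 i.+1 hx) !psum_recr zsh yv zpre zi.
  by rewrite -natr1; field; rewrite gt_eqF.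
by move=> e; move: zi; rewrite e; lia.
Qed.

Lemma Ucal_cond x : Ucal R M q x -> univ_cond M al x.
Proof.
move=> hx; have /UcalE[xle _] := hx; split=> // i; split; first exact: Ucal_up.
move=> xi; have h := @Ucal_up _ i (Ucal_rf hx).
rewrite -[X in lex_lt _ X](rfK (sh_le _ xle)); apply: llt_rf; [exact: rf_le|exact: ale|].
by apply: h; rewrite /rf; have := xle i; lia.
Qed.

(** A larger sequence of the same value would force a tail of [x] to have value at least 1, against
    [key_lt]; a smaller one is excluded by reflection. *)
Lemma Ws_Ucal x : Ws M al x -> Ucal R M q x.
Proof.
move=> hW; have xle := W_le ale (WsW hW); apply/UcalE; split=> // y yle.
have main z w : inOmega M z -> Ws M al w -> inOmega M w -> qval q z = qval q w -> ~ lex_lt w z.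
  move=> zle hw wle e [t ht]; have h := val_lt_at q1 wle zle ht; rewrite e subrr in h.
  have h1 : qval q (sh t.+1 w) < 1.
    apply: (key_lt q1 ale aval an0 (sh_le _ wle)).
      by move=> j; rewrite sh_sh; have [/lltW] := hw (t.+1 + j)%N.
    by have [] := hw t.+1.
  have h2 := val_ge0 q1 (sh_le t.+1 zle).
  have : 0 < (1 + qval q (sh t.+1 z) - qval q (sh t.+1 w)) / q ^+ t.+1.
    by apply: divr_gt0 => //; lra.
  lra.
move=> e; apply: lle_anti; first by apply/lle_nlt; exact: main e.
have hW' : Ws M al (rf M x).
  move=> j; have [h1 h2] := hW j; rewrite sh_rf; split.
    by rewrite -[X in lex_lt _ X](rfK ale); apply: llt_rf h2; [exact: rf_le|exact: sh_le].
  by apply: llt_rf h1 => //; exact: sh_le.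
apply/lle_nlt => h; apply: (main (rf M y) (rf M x)) => //; try exact: rf_le.
  by rewrite !val_rf // e.
exact: llt_rf.
Qed.

Lemma Ucal_le x : Ucal R M q x -> inOmega M x.
Proof. by case/UcalE. Qed.

Lemma Ucal_sh x n : Ucal R M q x -> Ucal R M q (sh n x).
Proof.
move=> /UcalE[hx h]; apply/UcalE; split=> [|y yle e]; first exact: sh_le.
have zle : inOmega M (glued n x y) by move=> j; rewrite /glued; case: ifP.
have zsh : sh n (glued n x y) = y by rewrite -[X in sh X]addn0 glued_sh sh0.
have e2 : glued n x y = x.
  apply: h => //; rewrite (val_cat q1 n zle) (val_cat q1 n hx) zsh e; congr (_ + _).
  by apply: eq_psum => j jn; rewrite glued_lt.
by rewrite -{1}zsh e2.
Qed.

Lemma Ucal0 : Ucal R M q k0.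
Proof.
apply/UcalE; split=> // y yle e; apply: funext => i; apply: contrapT => hi.
have := val_gt0 q1 yle hi; rewrite e.
have -> : qval q k0 = 0; last by rewrite ltxx.
apply: cvg_lim => //; rewrite (_ : psum R q k0 = fun=> 0); first exact: cvg_cst.
by apply: funext => k; rewrite /psum big1_seq // => j _; rewrite mul0r.
Qed.

End Univ.

(** * Growth rates and entropy *)

Section Growth.
Variable R : realType.
Implicit Types (f g : nat -> nat) (l r : R).

(* [f n] grows at most like [l ^+ n], up to subexponential factors. *)
Definition GB f l : Prop := forall r, l < r -> exists C : R, forall n, (f n)%:R <= C * r ^+ n.

Lemma GB_le f g l l' : (forall n, (f n <= g n)%N) -> l <= l' -> GB g l -> GB f l'.
Proof.
move=> fg ll h r lr; have [|C hC] := h r; first exact: le_lt_trans lr.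
by exists C => n; apply: le_trans (hC n); rewrite ler_nat.
Qed.

Lemma bernoulli (r : R) n : 1 <= r -> n%:R * (r - 1) <= r ^+ n.
Proof.
move=> r1; elim: n => [|n IH]; first by rewrite mul0r expr0.
rewrite -natr1 mulrDl mul1r exprS.
have h1 : 1 <= r ^+ n by apply: exprn_ege1.
have h2 : (r - 1) * 1 <= (r - 1) * r ^+ n by rewrite ler_wpM2l // subr_ge0.
lra.
Qed.

Lemma GB_conv f0 (T : nat -> nat -> nat) (F : nat -> nat) l : 1 <= l -> GB f0 l ->
  (forall r, l < r -> exists C : R, forall n i, (i < n)%N -> (T n i)%:R <= C * r ^+ n) ->
  (forall n, (F n <= f0 n + \sum_(i < n) T n i)%N) -> GB F l.
Proof.
(* The sum has [n] terms; by Bernoulli's inequality the passage from [r'] to [r] absorbs this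
   factor. *)
move=> l1 h0 hT hF r lr; pose r' := (l + r) / 2.
have lr' : l < r' by rewrite /r'; lra.
have r'r : r' < r by rewrite /r'; lra.
have r'0 : 0 < r' by lra.
have [C0 hC0] := h0 r lr; have [C hC] := hT r' lr'.
pose s := r / r'; have s1 : 0 < s - 1 by rewrite subr_gt0 /s ltr_pdivlMr // mul1r.
exists (C0 + `|C| / (s - 1)) => n.
have hn : n%:R <= s ^+ n / (s - 1).
  by rewrite ler_pdivlMr //; apply: bernoulli; lra.
have -> : (C0 + `|C| / (s - 1)) * r ^+ n = C0 * r ^+ n + (s ^+ n / (s - 1)) * (`|C| * r' ^+ n).
  rewrite mulrDl; congr (_ + _); rewrite {2}/s expr_div_n; field.
  by rewrite expf_neq0 ?gt_eqF.
apply: le_trans (_ : ((f0 n)%:R + \sum_(i < n) (T n i)%:R <= _)).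
  by rewrite -natr_sum -natrD ler_nat.
apply: lerD => //; apply: le_trans (_ : \sum_(i < n) `|C| * r' ^+ n <= _).
  apply: ler_sum => i _; apply: le_trans (hC n i (ltn_ord i)) _.
  by apply: ler_wpM2r; [apply: exprn_ge0; exact: ltW|exact: ler_norm].
rewrite sumr_const card_ord -[X in X <= _]mulr_natl; apply: ler_wpM2r => //.
by rewrite mulr_ge0 // exprn_ge0 // ltW.
Qed.

Lemma subGB f n0 (mu : R) : (0 < n0)%N -> (forall p q, (f (p + q) <= f p * f q)%N) ->
  1 <= mu -> (f n0)%:R <= mu ^+ n0 -> exists C : R, 0 < C /\ forall n, (f n)%:R <= C * mu ^+ n.
Proof.
move=> n00 fs mu1 h; exists (((f 0%N).+1 * (f 1%N).+1 ^ n0)%:R); split.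
  by rewrite ltr0n muln_gt0 expn_gt0.
move=> n; rewrite {1}(divn_eq n n0).
have fr s : (s <= n0)%N -> (f s <= (f 0%N).+1 * (f 1%N).+1 ^ n0)%N.
  move=> sn; apply: (@leq_trans ((f 0%N).+1 * (f 1%N).+1 ^ s)); last first.
    by rewrite leq_mul2l leq_pexp2l.
  elim: s {sn} => [|s IH]; first by rewrite expn0 muln1.
  rewrite -addn1; apply: leq_trans (fs _ _) _; rewrite addn1 expnSr mulnA.
  by apply: leq_mul.
have fk k : (f (k * n0 + n %% n0)%N)%:R <= (mu ^+ n0) ^+ k * (f (n %% n0)%N)%:R.
  elim: k => [|k IH]; first by rewrite mul0n add0n expr0 mul1r.
  rewrite mulSn -addnA; apply: le_trans (_ : (f n0 * f (k * n0 + n %% n0))%N%:R <= _).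
    by rewrite ler_nat.
  by rewrite natrM exprS -mulrA; apply: ler_pM.
apply: le_trans (fk _) _; rewrite mulrC; apply: ler_pM => //.
- by apply: exprn_ge0; apply: exprn_ge0; lra.
- by rewrite ler_nat fr // ltnW // ltn_pmod.
- by rewrite -exprM mulnC; apply: ler_weXn2l => //; exact: leq_trunc_div.
Qed.

Lemma expR_nat (b : R) n : expR (b * n%:R) = expR b ^+ n.
Proof. by rewrite expRM_natr. Qed.

Section Fekete.
Variable f : nat -> nat.
Hypotheses (f0 : forall n, (0 < f n)%N) (fs : forall p q, (f (p + q) <= f p * f q)%N).
Let u : nat -> R := fun n => ln (f n)%:R / n%:R.

Let u_ge0 n : 0 <= u n.
Proof. by rewrite divr_ge0 // ln_ge0 // ler1n. Qed.

(** Fekete's lemma. The first two clauses say in exponential form that the limit is the infimum of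
    [u] over the positive indices. *)
Lemma fekete : [/\ forall n, expR (limn u * n%:R) <= (f n)%:R,
  forall b, (forall n, (0 < n)%N -> expR (b * n%:R) <= (f n)%:R) -> b <= limn u &
  forall r, expR (limn u) < r -> exists C : R, 0 < C /\ forall n, (f n)%:R <= C * r ^+ n].
Proof.
pose S := [set x : R | exists2 n, (0 < n)%N & x = u n].
have S0 : S !=set0 by exists (u 1%N); exists 1%N.
have Slb : has_lbound S by exists 0 => _ [n _ ->].
have hS : has_inf S by split.
pose l := inf S.
have lu n : (0 < n)%N -> l <= u n by move=> n0; apply: ge_inf => //; exists n.
have fe n : (0 < n)%N -> (f n)%:R = expR (u n) ^+ n.
  move=> n0; rewrite -expR_nat /u divfK ?lnK // ?posrE ?ltr0n //.
  by rewrite pnatr_eq0 -lt0n.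
have GBl r : expR l < r -> exists C : R, 0 < C /\ forall n, (f n)%:R <= C * r ^+ n.
  move=> lr; have r0 : 0 < r by apply: lt_trans lr; exact: expR_gt0.
  have d0 : 0 < ln r - l by rewrite subr_gt0 -ltr_expR lnK.
  have [_ [n n0 ->] hn] := inf_adherent d0 hS.
  apply: (@subGB f n) => //.
    apply: le_trans (ltW lr); rewrite -expR0 ler_expR.
    by apply: lb_le_inf => // _ [k _ ->].
  rewrite fe // lerXn2r ?nnegrE ?expR_ge0 ?(ltW r0) //.
  by rewrite -[r]lnK ?posrE // ler_expR ltW //; rewrite -/l in hn; lra.
have cv : u @ \oo --> l.
  apply/cvgrPdist_lt => e e0.
  have lr : expR l < expR (l + e / 2) by rewrite ltr_expR; lra.
  have [C [C0 hC]] := GBl _ lr.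
  near=> n; have n0 : (0 < n)%N by near: n; exists 1%N.
  have n0R : (0 : R) < n%:R by rewrite ltr0n.
  have h1 := lu n n0.
  have h2 : u n <= ln C / n%:R + (l + e / 2).
    rewrite /u ler_pdivrMr // mulrDl divfK ?gt_eqF //.
    rewrite -ler_expR lnK ?posrE ?ltr0n // expRD lnK ?posrE // expR_nat.
    exact: hC.
  have h3 : ln C / n%:R < e / 2.
    rewrite ltr_pdivrMr // mulrC -ltr_pdivrMr ?divr_gt0 //.
    near: n; exists (Num.Def.truncn `|ln C / (e / 2)|).+1 => // n /=.
    rewrite -(ler_nat R) => hn; apply: lt_le_trans hn.
    by apply: le_lt_trans (ler_norm _) _; exact: truncnS_gt.
  by rewrite distrC ger0_norm ?subr_ge0 //; lra.
have le : limn u = l by apply: cvg_lim.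
rewrite le; split=> // [[|n]|b hb].
- by rewrite mulr0 expR0 ler1n.
- by rewrite (fe n.+1) // expR_nat lerXn2r ?nnegrE ?expR_ge0 // ler_expR lu.
- apply: lb_le_inf => // _ [n n0 ->].
  have n0R : (0 : R) < n%:R by rewrite ltr0n.
  by rewrite /u ler_pdivlMr // -ler_expR lnK ?posrE ?ltr0n // hb.
Unshelve. all: by end_near. Qed.

End Fekete.

Section Entropy.
Variables (M : nat) (X : set sq) (x0 : sq).
Hypotheses (Xx : X x0) (Xle : forall x, X x -> inOmega M x) (Xsh : forall x n, X x -> X (sh n x)).
Notation ent := (entropy R M X).

Let fek := @fekete (cnt M X) (fun n => cnt_gt0 n Xx (Xle Xx))
  (fun p q => cnt_submul p q Xle Xsh).

Lemma ent_le n : expR (ent * n%:R) <= (cnt M X n)%:R.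
Proof. by have [h _ _] := fek; exact: h. Qed.

Lemma ent_ge b : (forall n, (0 < n)%N -> expR (b * n%:R) <= (cnt M X n)%:R) -> b <= ent.
Proof. by have [_ h _] := fek; exact: h. Qed.

Lemma ent_GB : GB (cnt M X) (expR ent).
Proof. by have [_ _ h] := fek => r hr; have [C [_ hC]] := h r hr; exists C. Qed.

Lemma GB_ent b : GB (cnt M X) (expR b) -> ent <= b.
Proof.
move=> h; rewrite leNgt; apply/negP => bl.
pose t := (b + ent) / 2; have [|C hC] := h (expR t); first by rewrite ltr_expR /t; lra.
have d0 : 0 < ent - t by rewrite /t; lra.
have e1 : 1 < expR (ent - t) by rewrite -expR0 ltr_expR.
have [n hn] := pow_unbounded e1 C ltr01.
have := le_trans (ent_le n) (hC n).
have -> : expR (ent * n%:R) = expR (ent - t) ^+ n * expR t ^+ n.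
  by rewrite -!expR_nat -expRD; congr expR; lra.
rewrite ler_pM2r ?exprn_gt0 ?expR_gt0 //; rewrite mulr1 in hn; lra.
Qed.

(** Lengths divisible by [N] suffice, because a bound on words of length [N * n] passes to its
    [N]-th root at length [n] by submultiplicativity. *)
Lemma ent_ge_mul N b : (0 < N)%N -> (forall k, expR (b * k%:R) <= (cnt M X (N * k))%:R) ->
  b / N%:R <= ent.
Proof.
move=> N0 h; apply: ent_ge => n n0.
have hp k : (cnt M X (k * n) <= cnt M X n ^ k)%N.
  elim: k => [|k IH]; first by rewrite mul0n expn0 cnt0_le.
  rewrite mulSn expnS; apply: leq_trans (cnt_submul _ _ Xle Xsh) _.
  by rewrite leq_mul2l IH orbT.
have N0R : (0 : R) < N%:R by rewrite ltr0n.
rewrite -(@ler_pXn2r _ N) ?nnegrE ?expR_ge0 //.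
rewrite -expR_nat -natrX.
have -> : b / N%:R * n%:R * N%:R = b * n%:R by field; rewrite gt_eqF.
by apply: le_trans (h n) _; rewrite ler_nat.
Qed.

End Entropy.
End Growth.

Lemma cnt_bin n : cnt 1 [set d | bin d] n = (2 ^ n)%N.
Proof.
apply/eqP; rewrite eqn_leq cnt_le_pow //=.
rewrite -[X in (X ^ _)%N](card_ord 2) -card_tuple /cnt -cardsT.
apply/subset_leq_card/fintype.subsetP => w _; apply/BnP.
pose x i := if insub i is Some j then nat_of_ord (tnth w j) else 0%N.
exists x => [i|i]; last by rewrite /x valK.
by rewrite /x; case: insub => // j; rewrite -ltnS.
Qed.

Lemma cnt_psi M m c (X Y : set sq) k : fund M m c -> (forall d, X d -> bin d) ->
  (forall d, X d -> Y (psi M m c 0 d)) -> (cnt 1 X k <= cnt M Y (m * k))%N.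
Proof.
move=> F Xb XY; have m0 := fund_m F.
apply: (@cnt_one _ _ _ _ _ _ (fun d x => x = psi M m c 0 d)) => [d Xd|d d' x x' Xd Xd' -> -> h].
  by exists (psi M m c 0 d); split=> //; [exact: XY|exact: psi_le].
have W e e' j : bin e -> bin e' -> (j < k)%N -> lt_at e e' j ->
    (forall i, (i < m * k)%N -> psi M m c 0 e i = psi M m c 0 e' i) -> False.
  move=> be be' jk he heq; have [_] := psi_mono F (leq0n 1) be be' he.
  rewrite heq ?ltnn //; apply: leq_trans (_ : m * j.+1 <= _)%N; last by rewrite leq_mul2l jk orbT.
  by rewrite mulnS; lia.
have bd := Xb d Xd; have bd' := Xb d' Xd'.
case: (cmpn d d' k) => [[j jk hj]|[[j jk hj]|//]].
- by case: (W _ _ _ bd bd' jk hj).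
- by case: (W _ _ _ bd' bd jk hj) => i hi; rewrite h.
Qed.

(** The letters are all k for M = 2k. For M = 2k+1 they are k and k+1, and neither can be repeated.
    So the first letter determines the sequence. *)
Lemma cnt_us M n : (0 < M)%N -> (cnt M (W M (us M)) n <= M.+1)%N.
Proof.
move=> M0; have F := fund_u M0.
have hx x : W M (us M) x -> forall i, x i.+1 = if odd M then (M - x i)%N else x i.
  move=> hW i; have ule := fund_le F; have xle := W_le ule hW; have e := odd_double_half M.
  have dig j : (M - us M 0 <= x j <= us M 0)%N.
    have [/lle_head h1 /lle_head h2] := hW j; rewrite /sh addn0 in h1 h2.
    by rewrite h1 andbT; move: h2; rewrite /rf.
  have di := dig i; have di1 := dig i.+1.
  have [oM|oM] := boolP (odd M); last first.
    by move: di di1; rewrite /us (negbTE oM) /=; move: e; rewrite (negbTE oM); lia.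
  rewrite /us oM /= in di di1; rewrite oM /= in e.
  have [h1 h2] := hW i.
  have u0 : us M 0 = M./2.+1 by rewrite /us oM.
  have u1 : us M 1 = M./2 by rewrite /us oM.
  have n1 : ~ (x i = M./2.+1 /\ x i.+1 = M./2.+1).
    move=> [x0 x1]; apply: (h1 1%N); split; first by case=> // _; rewrite /sh addn0 x0 u0.
    by rewrite /sh addn1 x1 u1.
  have n2 : ~ (x i = M./2 /\ x i.+1 = M./2).
    move=> [x0 x1]; apply: (h2 1%N); split; first by case=> // _; rewrite /sh addn0 /rf x0 u0; lia.
    by rewrite /sh addn1 x1 /rf u1; lia.
  by lia.
have := @cnt_gen _ (Bn M (W M (us M)) n) M.+1 0 0 0 0 (fun y => y = k0) (fun y => y = k0)
  (fun w s _ _ => exists x, [/\ W M (us M) x, re w x & s = x 0%N]).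
move=> h; apply: leq_trans (h _ _) _.
- move=> w /BnP[x hW rw]; exists (x 0%N), k0, k0; split; last by exists x.
  by split=> //; rewrite ltnS; exact: (W_le (fund_le F) hW).
- move=> w w' s _ _ _ _ _ _ [x [hW rw ->]] [x' [hW' rw' e]] _ _.
  apply: (re_inj rw rw') => i _; elim: i => // i IH.
  by rewrite (hx x hW) (hx x' hW') IH.
- by rewrite -[X in (_ <= X)%N]muln1 leq_mul2l /= -[X in (_ <= X)%N]muln1 leq_mul // cnt0_le.
Qed.

Section Lifting.
Variable R : realType.

(** [cnt_lift] in terms of growth rates: a code letter stands for [m] letters, so the codes may grow
    like [l ^+ m]. *)
Lemma GB_lift M m c al (Z : set sq) (l : R) : fund M m c -> inOmega M al -> lle al (cR M m c) ->
  (forall x, W M al x -> occ M m c x 0 -> exists d, [/\ Z d, bin d & x = psi M m c 0 d]) ->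
  1 <= l -> GB (cnt M (W M c)) l -> GB (cnt 1 Z) (l ^+ m) -> GB (cnt M (W M al)) l.
Proof.
move=> F ale aR dec l1 g1 g2; have m0 := fund_m F.
have hc := @cnt_lift _ _ _ F _ _ ale aR dec.
apply: (GB_conv (T := fun n p => (2 * (cnt M (W M c) p * cnt 1 Z ((n - p) %/ m).+1))%N) l1 g1 _ hc) => r lr.
have r1 : 1 < r by exact: le_lt_trans lr.
have r0 : 0 < r by exact: lt_trans r1.
have [C1 hC1] := g1 r lr.
have [|C2 hC2] := g2 (r ^+ m); first by rewrite ltrXn2r ?gtn_eqF //; lra.
exists (2 * (`|C1| * `|C2| * r ^+ m)) => n i iN.
rewrite natrM -[X in _ <= X]mulrA ler_wpM2l // natrM.
have h1 : (cnt M (W M c) i)%:R <= `|C1| * r ^+ i.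
  by apply: le_trans (hC1 i) _; rewrite ler_wpM2r ?ler_norm // exprn_ge0 // ltW.
set k := ((n - i) %/ m).+1.
have h2 : (cnt 1 Z k)%:R <= `|C2| * r ^+ (n - i + m).
  apply: le_trans (hC2 k) _; apply: le_trans (_ : `|C2| * (r ^+ m) ^+ k <= _).
    by rewrite ler_wpM2r ?ler_norm // exprn_ge0 // exprn_ge0 // ltW.
  rewrite ler_wpM2l // -exprM ler_eXn2l // /k mulnS addnC leq_add2r mulnC.
  exact: leq_trunc_div.
apply: le_trans (ler_pM (ler0n _ _) (ler0n _ _) h1 h2) _.
have -> : `|C1| * `|C2| * r ^+ m * r ^+ n = `|C1| * `|C2| * (r ^+ n * r ^+ m) by rewrite -!mulrA; congr (_ * (_ * _)); rewrite mulrC.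
rewrite -exprD mulrACA -exprD (_ : (i + (n - i + m) = n + m)%N) //; lia.
Qed.

Lemma decode_fund M m c al : fund M m c -> inOmega M al -> lle al (cR M m c) ->
  forall x, W M al x -> occ M m c x 0 -> exists d, [/\ bin d, d 0%N = 1%N & x = psi M m c 0 d].
Proof.
move=> F ale aR x hx o; have m0 := fund_m F.
have hR : W M (cR M m c) x by apply: W_mono hx => //; exact: cR_le.
have xo i : (i < m)%N -> x i = (c i + (i == m.-1))%N.
  by move=> im; have := o i im; rewrite add0n cR_lt.
have cx : lex_lt c x.
  exists m.-1; split=> [i im|]; last by rewrite xo ?eqxx; lia.
  rewrite xo; last by lia.
  by rewrite (_ : i == m.-1 = false) ?addn0 //; apply/eqP; lia.
have [d bd xd] := psi_dec F hR (lltW cx).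
exists d; split=> //; have [d0|//] := bin01 0 bd.
have := xo m.-1; rewrite xd psi_lt ?d0 ?eqxx /=; lia.
Qed.

Lemma Hent_le M (q h : R) al : (0 < M)%N -> is_alpha R M q al -> 0 <= h ->
  GB (cnt M (W M al)) (expR h) -> Hent R M q <= h.
Proof.
move=> M0 A h0 g; have [[q1 qM ale an0 av] amax] := alpha_props A.
apply: (GB_ent (x0 := k0)).
- exact: (Ucal0 A).
- move=> x; exact: (Ucal_le A).
- by move=> x n; exact: (Ucal_sh A).
have e1 : 1 <= expR h by rewrite -expR0 ler_expR.
have hc n := @cnt_univ M al M0 ale amax (Ucal R M q) n (@Ucal_cond _ _ _ _ A).
apply: (GB_conv (T := fun n i => (2 * M.+1 * cnt M (W M al) (n - i.+1))%N) e1 (f0 := fun=> 2%N) _ _ hc).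
  move=> r hr; exists 2 => n; rewrite ler_peMr // exprn_ege1 //; lra.
move=> r hr; have [C hC] := g r hr; exists ((2 * M.+1)%:R * `|C|) => n i iN.
have r1 : 1 < r by lra.
rewrite natrM -[X in _ <= X]mulrA ler_wpM2l //; apply: le_trans (hC _) _.
apply: ler_pM => //.
- by have := hC 0%N; rewrite expr0 mulr1; exact: le_trans.
- by apply: exprn_ge0; lra.
- exact: ler_norm.
- by apply: ler_weXn2l; [exact: ltW|exact: leq_subr].
Qed.

Lemma Hent_ge M (q b : R) al N : is_alpha R M q al -> (0 < N)%N ->
  (forall k, expR (b * k%:R) <= (cnt M (Ws M al) (N * k))%:R) -> b / N%:R <= Hent R M q.
Proof.
move=> A N0 h; have [[q1 qM ale an0 av] amax] := alpha_props A.
apply: (ent_ge_mul (x0 := k0)) => //.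
- exact: (Ucal0 A).
- move=> x; exact: (Ucal_le A).
- by move=> x n; exact: (Ucal_sh A).
move=> k; apply: le_trans (h k) _; rewrite ler_nat; apply: cnt_mono.
  by move=> x; exact: (Ws_Ucal A).
by move=> x /WsW; exact: W_le.
Qed.

End Lifting.

(** * Entropy of the subshift of an irreducible word *)

Section Irreducible.
Variables (R : realType) (M m : nat) (a : sq).
Hypotheses (M0 : (0 < M)%N) (I : irr M m a) (hu : lex_lt (uR M) a).
Let F : fund M m a := I.1.
Let ale : inOmega M a := fund_le F.
Let Wa : set sq := W M a.
Let Waa : Wa a := fund_W F.
Let Wle x : Wa x -> inOmega M x := @W_le M a x ale.
Let Wsh x n : Wa x -> Wa (sh n x) := @W_sh M a x n.
Definition hW : R := entropy R M (W M a).
Let m0 : (0 < m)%N := fund_m F.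

Lemma hW_le n : expR (hW * n%:R) <= (cnt M Wa n)%:R.
Proof. exact: (@ent_le R M Wa a Waa Wle Wsh n). Qed.

Lemma hW_mul N b : (0 < N)%N -> (forall k, expR (b * k%:R) <= (cnt M Wa (N * k))%:R) ->
  b / N%:R <= hW.
Proof. exact: (ent_ge_mul Waa Wle Wsh). Qed.

(** As [a] exceeds [uR M], its subshift contains every binary sequence coded through the unit lift,
    which gives log 2 divided by the length of the latter. *)
Lemma hW_ln2 : ln 2 / m%:R <= hW.
Proof.
have pow k : expR (ln 2 * k%:R) = (2 ^ k)%:R :> R by rewrite expR_nat lnK ?posrE // natrX.
have u0 := fund_u M0.
have Wu d : bin d -> Wa (psi M (um M) (us M) 0 d).
  move=> bd; apply: (@W_mono _ (uR M)) => //; first exact: cR_le.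
    exact: lltW.
  apply: psi_W => //; move=> i; split; last by move=> k [_]; rewrite /rf /k1 /sh subnn ltn0.
  by move=> k [_]; have := bd (i + k)%N; rewrite /k1 /sh; lia.
have [um_m|um_m] := leqP (um M) m.
  have h : ln 2 / (um M)%:R <= hW.
    apply: hW_mul => [|k]; first by rewrite /um; case: odd.
    by rewrite pow ler_nat -cnt_bin; apply: (cnt_psi k u0).
  apply: le_trans h; rewrite ler_wpM2l ?ln_ge0 ?ler1n // lef_pV2 ?posrE ?ltr0n ?ler_nat //.
  by rewrite /um; case: odd.
(* The unit lift is longer than [a] only for odd [M] and a one-letter word; then the two middle
   digits can be chosen freely. *)
have [oM m1] : odd M /\ m = 1%N by move: um_m m0; rewrite /um; case: (odd M) => /=; lia.
have [a0 _] := irr_head M0 hu; have e := odd_double_half M; rewrite oM /= in e.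
have ac i : a i = a 0%N by rewrite (per_mod i (fund_per F)) m1 modn1.
apply: hW_mul => // k; rewrite m1 mul1n pow ler_nat -cnt_bin.
apply: (@cnt_one _ _ _ _ _ _ (fun d x => x = fun i => (M./2 + d i)%N)) => [d bd|d d' x x' _ _ -> -> h j jk].
  have hd i : (M - a 0%N <= M./2 + d i <= a 0%N)%N by have := bd i; lia.
  exists (fun i => (M./2 + d i)%N); split=> // [i|i]; last by have := hd i; have := ale 0%N; lia.
  split=> t [_]; rewrite /rf /sh ac; have := hd (i + t)%N; lia.
by have := h j jk; lia.
Qed.

Lemma hW_gt0 : 0 < hW.
Proof. by apply: lt_le_trans hW_ln2; rewrite divr_gt0 ?ln_gt0 ?ltr1n ?ltr0n. Qed.

Lemma GB_W : GB (cnt M Wa) (expR hW).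
Proof. exact: (@ent_GB R M Wa a Waa Wle Wsh). Qed.

(** Even if all binary codes occurred, the coded parts would grow only like the power 1/m of 2,
    which [hW_ln2] dominates. *)
Lemma GB_WcR : GB (cnt M (W M (cR M m a))) (expR hW).
Proof.
apply: (GB_lift (Z := [set d | bin d]) F (cR_le F) (@lle_refl _)) => //.
- move=> x hx o; have [d [bd _ ->]] := decode_fund F (cR_le F) (@lle_refl _) hx o.
  by exists d.
- by rewrite -expR0 ler_expR ltW // hW_gt0.
- exact: GB_W.
apply: (@GB_le _ _ (fun n => 2 ^ n)%N 2) => [n||r hr]; first by rewrite cnt_bin.
  rewrite -expR_nat -[X in X <= _](@lnK R) ?posrE // ler_expR.
  by have := hW_ln2; rewrite ler_pdivrMr ?ltr0n.
exists 1 => n; rewrite mul1r natrX; apply: lerXn2r; rewrite ?nnegrE //; lra.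
Qed.

Lemma avoid_ent r : exists h', [/\ 0 <= h', h' < hW & GB (cnt M (avoid M a r)) (expR h')].
Proof.
have [K spec] := specification M0 I hu.
have [[x0 hx0]|hno] := pselect (exists x, avoid M a r x); last first.
  exists 0; split=> //; first exact: hW_gt0.
  move=> s hs; exists 0 => n; rewrite mul0r.
  have -> // : cnt M (avoid M a r) n = 0%N.
  apply/eqP; rewrite cards_eq0; apply/eqP/finset.setP => w; rewrite [RHS]inE.
  by apply/BnP => -[x hx]; case: hno; exists x.
have gt0 n : (0 < cnt M Wa n)%N by exact: cntW_gt0 F _.
pose f := cnt M Wa; pose E := cnt M (avoid M a r).
pose c := (r + K + K)%N; pose C1 := (K.+1 * K.+1 * (K + r) * f c)%N.
(* At this length [cnt_insert] makes the avoiding words fewer by the factor [2 * D].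
   Supermultiplicativity consumes [D], and the remaining 2 lowers the growth rate by log 2 over
   [n0]. *)
pose D := (K.+1 * f K)%N; pose n0 := (2 * D * C1).+1.
have hsup p q : (f p * f q <= D * f (p + q))%N by exact: cntW_super F spec p q.
have hins : (n0 * E n0 <= C1 * f n0)%N.
  apply: leq_trans (cnt_insert F spec r n0) _; rewrite /C1 -[X in (_ <= X)%N]mulnA leq_mul2l.
  by rewrite [(f c * f n0)%N]mulnC (cntW_sub F) orbT.
have E0 n : (0 < E n)%N by apply: (cnt_gt0 n hx0); case: hx0 => /Wle.
have D0 : (0 < D)%N by rewrite muln_gt0 /= /f gt0.
have C10 : (0 < C1)%N.
  rewrite lt0n; apply/eqP => C1z; move: hins; rewrite C1z mul0n leqn0 muln_eq0 /=.
  by rewrite eqn0Ngt E0.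
have hE : (2 * D * E n0 <= f n0)%N.
  rewrite -(leq_pmul2l C10); apply: leq_trans hins; rewrite mulnA leq_mul2r; apply/orP; right.
  by rewrite mulnC; exact: leqnSn.
have hpow k : ((2 * E n0) ^ k <= f (n0 * k))%N.
  have h1 : ((f n0) ^ k <= D ^ k * f (n0 * k))%N.
    elim: k => [|k IH]; first by rewrite !expn0 mul1n /f gt0.
    rewrite !expnS mulnS; apply: leq_trans (leq_mul (leqnn _) IH) _.
    by rewrite mulnCA [(D * _)%N]mulnC -mulnA leq_mul2l hsup orbT.
  have h2 : ((2 * D * E n0) ^ k <= (f n0) ^ k)%N by case: (k) => // k'; rewrite leq_exp2r.
  have := leq_trans h2 h1.
  rewrite [(2 * D)%N]mulnC -mulnA expnMn leq_pmul2l ?expn_gt0 ?D0 //.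
have EE : (0 : R) < (2 * E n0)%N%:R by rewrite ltr0n muln_gt0 E0.
have n0R : (0 : R) < n0%:R by rewrite ltr0n.
have hb : ln (2 * E n0)%N%:R / n0%:R <= hW.
  by apply: hW_mul => // k; rewrite expR_nat lnK ?posrE // -natrX ler_nat.
have l2 : 0 < ln 2 / n0%:R :> R by rewrite divr_gt0 // ln_gt0 // ltr1n.
exists (hW - ln 2 / n0%:R).
have h0 : 0 <= hW - ln 2 / n0%:R.
  rewrite subr_ge0; apply: le_trans hb; rewrite ler_wpM2r ?invr_ge0 ?ler0n //.
  by rewrite ler_ln ?posrE // -[X in X%:R <= _]muln1 ler_nat leq_mul2l /= E0.
split=> //; first by lra.
have mu1 : 1 <= expR (hW - ln 2 / n0%:R) by rewrite -[X in X <= _]expR0 ler_expR.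
have hmu : (E n0)%:R <= expR (hW - ln 2 / n0%:R) ^+ n0.
  rewrite -expR_nat; have -> : (hW - ln 2 / n0%:R) * n0%:R = hW * n0%:R - ln 2.
    by field; rewrite gt_eqF.
  rewrite ler_pdivrMr // in hb.
  have e : (E n0)%:R = expR (ln (2 * E n0)%N%:R - ln 2) :> R.
    by rewrite expRB !lnK ?posrE // natrM mulrAC divff ?mul1r // pnatr_eq0.
  by rewrite e ler_expR; lra.
move=> s hs; have [C [C0 hC]] := subGB (ltn0Sn _) (cnt_avoid_sub F r) mu1 hmu.
exists C => n; apply: le_trans (hC n) _; rewrite ler_wpM2l ?(ltW C0) //.
by apply: lerXn2r; rewrite ?nnegrE ?expR_ge0 // ltW // (le_lt_trans (expR_ge0 _) hs).
Qed.

End Irreducible.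

(* [H] is constant on the interval of [e], and smaller at all bases to its left. *)
Definition height (R : realType) (M m : nat) (e : sq) : Prop := exists h : R, 0 < h /\
  forall q al, is_alpha R M q al ->
    (lle e al -> lle al (cR M m e) -> Hent R M q = h) /\ (lex_lt al e -> Hent R M q < h).

(** By specification every word continues to a sequence ending in [us M]. A shift equal to [a] or to
    its reflection would, moved by a multiple of the period, make a shift of [us M] equal to it, but
    these satisfy strict bounds. *)
Lemma cnt_Ws M m a n : (0 < M)%N -> irr M m a -> lex_lt (uR M) a ->
  (cnt M (W M a) n <= cnt M (Ws M a) n)%N.
Proof.
move=> M0 I hu; have F : fund M m a := I.1; have ale := fund_le F; have m0 := fund_m F.
have U0 := fund_u M0.
have uRle : inOmega M (uR M) by exact: (cR_le U0).
have usW : Ws M a (us M).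
  apply: (W_Ws uRle ale hu); apply: W_mono (fund_W U0) => //; first exact: fund_le U0.
  exact/lltW/(c_cR U0).
have [K spec] := specification M0 I hu.
apply: (@cnt_one _ _ _ _ _ _ (fun x y => forall i, (i < n)%N -> y i = x i)) => [x0 hx0|x x' y y' _ _ h1 h2 h3 j jk]; last first.
  by rewrite -h1 // -h2 // h3.
have [l [x [_ hx e1 e2]]] := spec _ _ n hx0 (WsW usW).
suff xs : Ws M a x by exists x; split=> //; exact: W_le hx.
move=> i; have [h1 h2] := hx i; set s := (i + m * (n + l) - (n + l))%N.
have es : sh s (us M) = sh (m * (n + l)) (sh i x).
  rewrite -e2 !sh_sh; congr (sh _ x).
  have : (n + l <= m * (n + l))%N by rewrite leq_pmull.
  by rewrite /s; move: (m * _)%N => z hz; lia.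
have [l1 l2] := usW s.
split; [case/lleP: h1 => // e|case/lleP: h2 => // e].
  by move: l1; rewrite es e (sh_per _ (fund_per F)) => /llt_irr.
by move: l2; rewrite es -e sh_rf (sh_per _ (fund_per F)) => /llt_irr.
Qed.

Lemma height_irr R M m a : (0 < M)%N -> irr M m a -> lex_lt (uR M) a -> height R M m a.
Proof.
move=> M0 I hu; have F : fund M m a := I.1; have ale := fund_le F; have m0 := fund_m F.
have h0 := hW_gt0 R M0 I hu; exists (hW R M a); split=> // q al A.
have [[q1 qM alle an0 av] amax] := alpha_props A.
split.
- move=> aal alR; apply/eqP; rewrite eq_le; apply/andP; split.
    apply: (Hent_le M0 A (ltW h0)); apply: (GB_le _ (lexx _) (@GB_WcR R _ _ _ M0 I hu)) => n.
    apply: cnt_mono => x; first by apply: W_mono => //; exact: (cR_le F).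
    exact: W_le.
  rewrite -[X in X <= _]divr1; apply: (Hent_ge A (N := 1)) => // k; rewrite mul1n.
  apply: le_trans (hW_le R I k) _; rewrite ler_nat.
  apply: leq_trans (cnt_Ws k M0 I hu) _; apply: cnt_mono => x hx; first exact: Ws_mono aal hx.
  exact: W_le ale (WsW hx).
(* A sequence bounded by [al] cannot contain the first [t.+1] letters of [a]. *)
- move=> [t ht]; have [h' [h'0 h'h g]] := avoid_ent R M0 I hu t.+1.
  apply: le_lt_trans h'h; apply: (Hent_le M0 A h'0); apply: (GB_le _ (lexx _) g) => n.
  apply: cnt_mono => x hx; last exact: W_le hx.
  split; first by apply: W_mono hx => //; apply/lltW; exists t.
  move=> i h; have [h1 _] := hx i; apply: (h1 t).
  by apply: lt_at_ext ht _ _ => // j jt; rewrite /sh h.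
Qed.

Lemma height_comp (R : realType) M m c k b : (0 < M)%N -> fund M m c -> GB (cnt M (W M c)) (1 : R) ->
  irr 1 k b -> lex_lt (uR 1) b -> height R M (m * k) (psi M m c 0 b).
Proof.
move=> M0 F gc I hu; have m0 := fund_m F; have G : fund 1 k b := I.1.
have m0R : (0 : R) < m%:R by rewrite ltr0n.
have ble := fund_le G; have b0 := fund1_head G.
have cle := fund_le F.
have h0 := hW_gt0 R (isT : (0 < 1)%N) I hu; set hb := hW R 1 b in h0.
have hp : 0 < hb / m%:R by rewrite divr_gt0.
have fE := fund_comp F G; have ele := fund_le fE.
have expm (h : R) : expR h = expR (h / m%:R) ^+ m.
  by rewrite -expR_nat divfK // gt_eqF.
have eU : lle (psi M m c 0 b) (cR M m c) by apply/(psi_lle F) => //; exact: bin_k1.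
exists (hb / m%:R); split=> // q al A.
have [[q1 qM alle an0 av] amax] := alpha_props A.
split.
- move=> eal alR; apply/eqP; rewrite eq_le; apply/andP; split.
    apply: (Hent_le M0 A (ltW hp)).
    have bR : bin (cR 1 k b) by exact: (cR_le G).
    have bR0 : cR 1 k b 0%N = 1%N.
      by have := lle_head (lltW (c_cR G)); have := bR 0%N; rewrite b0; lia.
    have alc : lle al (cR M m c).
      apply: (lle_trans alR); rewrite (cR_comp F G); apply/(psi_lle F) => //; exact: bin_k1.
    apply: (GB_lift (Z := W 1 (cR 1 k b)) F alle alc) => //.
    + move=> x hx o; have [d [bd d0 xd]] := decode_fund F alle alc hx o.
      exists d; split=> //; apply: (psi_W_inv F) => //.
      rewrite -xd; apply: W_mono hx => //; first exact: (psi_le F).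
      by rewrite -(cR_comp F G).
    + by rewrite -[X in X <= _]expR0 ler_expR ltW.
    + by apply: (GB_le _ _ gc) => //; rewrite -[X in X <= _]expR0 ler_expR ltW.
    + by rewrite -expm; exact: GB_WcR.
  apply: (Hent_ge A) => // j; apply: le_trans (hW_le R I j) _; rewrite ler_nat.
  apply: leq_trans (cnt_Ws j (isT : (0 < 1)%N) I hu) _.
  have bW d : Ws 1 b d -> bin d by move=> /WsW; exact: W_le.
  apply: (cnt_psi j F bW) => d hd; apply: (Ws_mono ele alle eal).
  by apply: (psi_Ws F) => //; exact: bW.
- move=> [t ht].
  (* The first [t.+1] blocks already cover the letters that separate [al] from the bound; the
     further [k] code letters serve for occurrences starting at the vertex A. *)
  pose r := (t.+1 + k)%N.
  have [h' [h'0 h'h g]] := avoid_ent R (isT : (0 < 1)%N) I hu r.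
  have h'm : h' / m%:R < hb / m%:R by rewrite ltr_pM2r ?invr_gt0.
  have h'p : 0 <= h' / m%:R by rewrite divr_ge0.
  have ale : lle al (psi M m c 0 b) by apply/lltW; exists t.
  have alc : lle al (cR M m c) by exact: lle_trans eU.
  apply: le_lt_trans h'm; apply: (Hent_le M0 A h'p).
  apply: (GB_lift (Z := avoid 1 b r) F alle alc) => //.
  + move=> x hx o; have [d [bd d0 xd]] := decode_fund F alle alc hx o.
    exists d; split=> //.
    have dW : W 1 b d by apply: (psi_W_inv F) => //; rewrite -xd; exact: W_mono hx.
    split=> // i hi; have [p0|p1] : prevd 0 d i = 0%N \/ prevd 0 d i = 1%N by have := bin_prevd i (leq0n 1) bd; lia.
      have [h1 _] := hx (m * i)%N; rewrite xd (psi_sh F) p0 in h1.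
      apply: (h1 t); apply: lt_at_ext ht _ _ => // s st.
      apply: (psi_agree F 0 (n := r)) => [z zr|]; first by rewrite /sh hi.
      have : (r <= m * r)%N by rewrite leq_pmull.
      by rewrite {1}/r; move: (m * r)%N => z; lia.
    (* At A the preceding code letter is 1, so the code contains 1 followed by a prefix of [b]. This
       exceeds [b], since [sh 1 b] is smaller than [b] within [k] letters. *)
    case: i p1 hi => // i /= p1 hi.
    have [|s sk [hs1 hs2]] := @fund_up _ _ _ G 1; first by rewrite (fund1_size G).
    have [h1 _] := dW i; apply: (h1 s.+1); split=> [[|z] zs|].
    + by rewrite /sh addn0 p1 b0.
    + rewrite /sh addnS -addSn hi; last by rewrite /r; lia.
      by have := hs1 z zs; rewrite /sh add1n.
    + rewrite /sh addnS -addSn hi; last by rewrite /r; lia.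
      by move: hs2; rewrite /sh add1n.
  + by rewrite -[X in X <= _]expR0 ler_expR.
  + by apply: (GB_le _ _ gc) => //; rewrite -[X in X <= _]expR0 ler_expR.
  + by rewrite -expm.
Qed.

(** * Plateaus *)

Definition admissible (M : nat) (a : sq) : Prop :=
  [/\ inOmega M a, not_end0 a & forall i, lle (sh i a) a].

Lemma fund_head_gt0 M m e : fund M m e -> (0 < e 0)%N.
Proof.
move=> F; have /lle_head := fund_rf F m.-1; rewrite /sh addn0 /rf.
by have := fund_last F; lia.
Qed.

Lemma admissible_fund M m e : fund M m e -> admissible M e.
Proof.
move=> F; split; [exact: fund_le F| |exact: (fund_shle F)].
move=> n; exists (m * n)%N; have m0 := fund_m F; split; first by rewrite leq_pmull.
have := congr1 (fun f => f 0%N) (sh_per n (fund_per F)); rewrite /sh addn0 => ->.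
by have := fund_head_gt0 F; lia.
Qed.

Lemma admissible_cR M m e : fund M m e -> admissible M (cR M m e).
Proof.
move=> F; split; [exact: cR_le F| |by move=> l; apply: cR_max F].
move=> n; exists (m + (m * n + m.-1))%N; have m0 := fund_m F.
split; first by have : (n <= m * n)%N by [rewrite leq_pmull]; lia.
have := congr1 (fun f => f (m * n + m.-1)%N) (cR_sh F); rewrite /sh => ->.
have := congr1 (fun f => f m.-1) (sh_per n (fund_per F)); rewrite /rf /sh => ->.
by have := fund_last F; lia.
Qed.

(** Entropy zero along the tower, by induction through [GB_lift]: the codes lie in the subshift of
    [t10], which has at most two words of each length. *)
Lemma GB_an (R : realType) M n : (0 < M)%N -> GB (cnt M (W M (anx M n))) (1 : R).
Proof.
have bounded (f : nat -> nat) N : (forall n, (f n <= N)%N) -> GB f (1 : R).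
  move=> h r r1; exists N%:R => k; apply: le_trans (_ : N%:R <= _); first by rewrite ler_nat.
  by rewrite ler_peMr // exprn_ege1 // ltW.
move=> M0; elim: n => [|n IH]; first by apply: (bounded _ M.+1) => n; exact: cnt_us.
have F := fund_an M0 n; have bt := bin_t10.
have ale : inOmega M (psi M (anl M n) (anx M n) 0 t10) by exact: (psi_le F).
have aR : lle (psi M (anl M n) (anx M n) 0 t10) (cR M (anl M n) (anx M n)).
  by apply/(psi_lle F) => //; exact: bin_k1.
apply: (GB_lift (Z := W 1 t10) F ale aR) => //; last first.
  by rewrite expr1n; apply: (bounded _ 2) => k; rewrite t10E; exact: cnt_us.
move=> x hx o; have [d [bd d0 xd]] := decode_fund F ale aR hx o.
by exists d; split=> //; apply: (psi_W_inv F) => //; rewrite -xd.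
Qed.

Lemma height_Ecl (R : realType) M j m e : (0 < M)%N -> Ecl M j m e -> height R M m e.
Proof.
move=> M0; case: j => [[I hu]|j [k [b [I hu -> ->]]]]; first exact: height_irr.
by apply: height_comp => //; [exact: fund_an|exact: GB_an].
Qed.

(** Leaves room inside the range to the right of the interval, as maximality requires. *)
Lemma Ecl_Ub M j m e : (0 < M)%N -> Ecl M j.+1 m e -> lex_lt (cR M m e) (Ub M j.+1).
Proof.
move=> M0 [k [b [I hu -> ->]]]; have F := fund_an M0 j; have G := I.1.
rewrite (cR_comp F G) /=; apply/(psi_llt F) => //; first exact: (cR_le G).
have /lleP[//|h] := bin_k1 (cR_le G); have := congr1 (fun f => f 0%N) (cR_sh G).
by rewrite h /sh /rf (fund1_head G).
Qed.

Section Bases.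
Variables (R : realType) (M : nat).
Hypothesis M0 : (0 < M)%N.

Lemma alpha_invP a : admissible M a -> is_alpha R M (alpha_inv R M a) a.
Proof. by move=> [h1 h2 h3]; exact: (xgetPex 0 (alpha_base R h1 h2 h3)). Qed.

Lemma alpha_leE (q1 q2 : R) a1 a2 : is_alpha R M q1 a1 -> is_alpha R M q2 a2 ->
  (q1 <= q2) <-> lle a1 a2.
Proof.
move=> A1 A2; rewrite leNgt; split=> [/negP h|h].
  by apply/lle_nlt => h'; apply: h; apply/(alpha_incrE A2 A1).
by apply/negP => /(alpha_incrE A2 A1) h'; move/lle_nlt: h; apply.
Qed.

Definition alpha_between (e f : sq) : set R :=
  [set q | exists al, [/\ is_alpha R M q al, lle e al & lle al f]].

Lemma is_alpha_KL : is_alpha R M (qKL R M) (lambda M).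
Proof.
by apply: alpha_invP; split; [exact: lambda_le|exact: lambda_end0|move=> i; apply: lambda_max].
Qed.

Lemma Jint_between a : fundamental M a ->
  Jint R M a = alpha_between (periodic a) (cR M (size a) (periodic a)).
Proof.
move=> ha; have F := fundamental_fund ha.
have A1 := alpha_invP (admissible_fund F); have A2 := alpha_invP (admissible_cR F).
rewrite /Jint /qL /qR pre_periodic_cR ?(fund_m F) //.
apply/seteqP; split=> q /= => [/andP[h1 h2]|[al [A h1 h2]]]; last first.
  by apply/andP; split; [apply/(alpha_leE A1 A)|apply/(alpha_leE A A2)].
have [[/andP[q1 _]] _ _ _ _ [/andP[_ qM]] _ _ _ _] := (A1, A2).
have [al A] := alpha_exists (lt_le_trans q1 h1) (le_trans h2 qM).
by exists al; split=> //; [apply/(alpha_leE A1 A)|apply/(alpha_leE A A2)].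
Qed.

Definition range (j : nat) : set R :=
  [set q | exists al, [/\ is_alpha R M q al, lex_lt (Lb M j) al & lle al (Ub M j)]].

Lemma lambda_wplus n : mkseq (lambda M) (anl M n) = wplus (tower M n).
Proof.
have [h1 h2 h3] := tower_word n M0; have m0 := fund_m (fund_an M0 n).
apply: (@eq_from_nth _ 0%N) => [|i]; rewrite size_mkseq; first by rewrite size_wplus h2.
move=> hi; rewrite nth_mkseq // (lambda_Lb M0 hi) /Lb cR_lt // nth_wplus ?h2 //.
by rewrite -h3 periodic_lt // h2.
Qed.

Lemma wplus_wrefl_wplus a : (0 < size a)%N -> all (fun c => c <= M)%N a -> (last 0%N a < M)%N ->
  wplus (wrefl M (wplus a)) = wrefl M a.
Proof.
move=> s0 /(all_nthP 0%N) ale al.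
have sw : size (wrefl M (wplus a)) = size a by rewrite size_map size_wplus.
apply: (@eq_from_nth _ 0%N) => [|i]; rewrite size_wplus sw //; first by rewrite size_map.
move=> hi; rewrite nth_wplus sw // /wrefl !(nth_map 0%N) ?size_wplus // nth_wplus //.
have [->|h] := eqVneq; last by lia.
by rewrite nth_last; lia.
Qed.

Lemma qprime_Lb n : qprime R M n.+1 = alpha_inv R M (Lb M n).
Proof.
have [h1 h2 h3] := tower_word n M0; have F := fund_an M0 n; have m0 := fund_m F.
rewrite /qprime /=.
have -> : (if odd M then (2 ^ n.+1)%N else (2 ^ n)%N) = anl M n.
  by rewrite anlE /um; case: odd; rewrite ?mul1n // expnS.
rewrite lambda_wplus wplus_wrefl_wplus ?h2 //; last first.
- by rewrite -nth_last h2 -periodic_lt ?h2 ?h3; [exact: fund_last F|lia].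
- by case: h1.
by rewrite pre_periodic_cR ?h2 // h3.
Qed.

Lemma rangeE n : [set q : R | qprime R M n.+1 < q <= qprime R M n] = range n.
Proof.
have A0 := alpha_invP (admissible_cR (fund_an M0 n)); have [/andP[q1 _] _ _ _ _] := A0.
apply/seteqP; split=> q /=; rewrite qprime_Lb; [move=> /andP[h1 h2]|move=> [al [A h1 h2]]].
  have qM : q <= M.+1%:R.
    apply: le_trans h2 _; case: n {A0 q1 h1} => [|n]; first by rewrite /qprime.
    have [/andP[_ h] _ _ _ _] := alpha_invP (admissible_cR (fund_an M0 n)).
    by rewrite qprime_Lb.
  have [al A] := alpha_exists (lt_trans q1 h1) qM.
  exists al; split=> //; first exact/(alpha_incrE A0 A).
  case: n {A0 q1 h1} h2 => [|n] h2; last first.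
    by apply/(alpha_leE A (alpha_invP (admissible_cR (fund_an M0 n)))); rewrite -qprime_Lb.
  by have [_ ale _ _ _] := A => t [_]; have := ale t; rewrite /=; lia.
apply/andP; split; first exact/(alpha_incrE A0 A).
case: n {A0 q1 h1} h2 => [|n] h2; first by have [/andP[_]] := A.
by rewrite qprime_Lb; apply/(alpha_leE A (alpha_invP (admissible_cR (fund_an M0 n)))).
Qed.

Lemma pos_const_union (I J : set R) x : pos_const_interval R M I -> pos_const_interval R M J ->
  I x -> J x -> pos_const_interval R M (I `|` J).
Proof.
move=> [iI sI [u [v [Iu [Iv uv]]]] pI cI] [iJ sJ _ pJ cJ] Ix Jx; split.
- move=> a y b ha hb /andP[ay yb]; have [xy|yx] := lerP x y.
    by case: hb => hb; [left; apply: iI Ix hb _|right; apply: iJ Jx hb _]; rewrite xy.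
  by case: ha => ha; [left; apply: iI ha Ix _|right; apply: iJ ha Jx _]; rewrite ay ltW.
- by move=> y [/sI|/sJ].
- by exists u, v; split; [left|split=> //; left].
- by move=> y [/pI|/pJ].
- have c y : (I `|` J) y -> Hent R M y = Hent R M x by case=> h; [exact: cI|exact: cJ].
  by move=> y z hy hz; rewrite !c.
Qed.

Section Class.
Variables (j m : nat) (e : sq).
Hypothesis E : Ecl M j m e.
Let F : fund M m e := Ecl_fund M0 E.
Let J := alpha_between e (cR M m e).
Let Ae : is_alpha R M (alpha_inv R M e) e := alpha_invP (admissible_fund F).
Let Af : is_alpha R M (alpha_inv R M (cR M m e)) (cR M m e) := alpha_invP (admissible_cR F).

Lemma Ecl_left : J (alpha_inv R M e).
Proof. by exists e; split=> //; [exact: lle_refl|exact/lltW/(c_cR F)]. Qed.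

Lemma Ecl_pos_const : pos_const_interval R M J.
Proof.
have [h [h0 hh]] := height_Ecl R M0 E.
have H q : J q -> Hent R M q = h by move=> [al [A h1 h2]]; have [] := hh _ _ A; auto.
split.
- move=> x y z [a [A a1 a2]] [c [C c1 c2]] /andP[xy yz].
  have [/andP[x1 _] _ _ _ _] := A; have [/andP[_ zM] _ _ _ _] := C.
  have [b B] := alpha_exists (lt_le_trans x1 xy) (le_trans yz zM); exists b; split=> //.
    by apply: lle_trans a1 _; apply/(alpha_leE A B).
  by apply: lle_trans _ c2; apply/(alpha_leE B C).
- by move=> q [a [[]]].
- exists (alpha_inv R M e), (alpha_inv R M (cR M m e)); split; first exact: Ecl_left.
  split; last exact/(alpha_incrE Ae Af)/(c_cR F).
  by exists (cR M m e); split=> //; [exact/lltW/(c_cR F)|exact: lle_refl].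
- by move=> q /H ->.
- by move=> x y /H -> /H ->.
Qed.

Lemma Ecl_unique m' e' al : Ecl M j m' e' -> lle e' (cR M m e) -> lex_lt (cR M m e) al ->
  lle al (cR M m' e') -> False.
Proof.
move=> E' h1 h2 h3; case: (llt_trich e' e) => [h|[h|h]].
- by apply: (Ecl_disj M0 E E' h); apply/lltW/(llt_trans (c_cR F))/(llt_le_trans h2).
- by subst e'; have em := fund_eq_len (Ecl_fund M0 E') F; subst m'; move/lle_nlt: h3.
- exact: (Ecl_disj M0 E' E h).
Qed.

(** To the left [H] drops by [height_Ecl]. If [K] reached beyond the right end, the dichotomy would
    give a left end of another interval of the class inside [K], where [H] is strictly larger than
    at [e]. *)
Lemma Ecl_maximal K : pos_const_interval R M K -> J `<=` K -> K = J.
Proof.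
move=> [iK sK _ pK cK] JK; apply/seteqP; split=> // z Kz.
have Ke := JK _ Ecl_left.
have /andP[z1 zM] := sK _ Kz; have [az Az] := alpha_exists z1 zM.
have [h [h0 hh]] := height_Ecl R M0 E.
have [He _] := hh _ _ Ae.
have Hz : Hent R M z = h by rewrite (cK _ _ Kz Ke) He //; [exact: lle_refl|exact/lltW/(c_cR F)].
exists az; split=> //.
  by apply/lle_nlt => ha; have [_ /(_ ha)] := hh _ _ Az; rewrite Hz ltxx.
apply/lle_nlt => ha.
have [eL eU] := Ecl_range M0 E.
(* The dichotomy only works inside the range, so a point beyond its upper end is replaced by that
   end. *)
have [z' [a' [Kz' A' h1 h2]]] : exists z' a', [/\ K z', is_alpha R M z' a',
    lex_lt (cR M m e) a' & lle a' (Ub M j)].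
  have [h1|h1] := lle_total az (Ub M j); first by exists z, az.
  case: j E h1 => [_ [t [_]]|j' E' h1].
    by have [_ ale _ _ _] := Az; have := ale t; rewrite /=; lia.
  have AU := alpha_invP (admissible_cR (fund_an M0 j')).
  exists (alpha_inv R M (Ub M j'.+1)), (Ub M j'.+1).
  have h2 := Ecl_Ub M0 E'; split=> //; last exact: lle_refl.
  apply: (iK _ _ _ Ke Kz); apply/andP; split.
    by apply/(alpha_leE Ae AU)/lltW/(llt_trans (c_cR F)).
  by apply/(alpha_leE AU Az)/lltW.
have [_ ale' _ _ _] := A'; have [_ amax'] := alpha_props A'.
have Lf : lle (Lb M j) (cR M m e) by apply/lltW/(llt_trans eL)/(c_cR F).
have [[m' [e' [E' h3 h4]]]|[m' [e' [E' h3 h4]]]] :=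
  Ecl_dichotomy M0 ale' amax' Lf h1 h2; last first.
  exact: (Ecl_unique E' h3 h1 h4).
have [h' [h'0 hh']] := height_Ecl R M0 E'.
have Ae' := alpha_invP (admissible_fund (Ecl_fund M0 E')).
have ee' : lex_lt e e' by exact: llt_trans (c_cR F) h3.
have Ke' : K (alpha_inv R M e').
  apply: (iK _ _ _ Ke Kz'); apply/andP; split.
    exact/(alpha_leE Ae Ae')/lltW.
  exact/(alpha_leE Ae' A').
have [_ /(_ ee')] := hh' _ _ Ae; have [H' _] := hh' _ _ Ae'.
rewrite (cK _ _ Ke Ke') H' ?ltxx //; first exact: lle_refl.
exact/lltW/(c_cR (Ecl_fund M0 E')).
Qed.

Lemma Ecl_in_range : J `<=` range j.
Proof.
have [eL eU] := Ecl_range M0 E; move=> q [al [A h1 h2]]; exists al; split=> //.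
  exact: llt_le_trans eL h1.
exact: lle_trans h2 eU.
Qed.

Lemma Ecl_above_KL : J `<=` [set q | qKL R M < q <= M.+1%:R].
Proof.
have [eL _] := Ecl_range M0 E; move=> q [al [A h1 h2]].
have [/andP[_ qM] _ _ _ _] := A; apply/andP; split=> //.
apply/(alpha_incrE is_alpha_KL A); apply: llt_le_trans h1.
exact: llt_trans (lambda_Lb_lt M0 j) eL.
Qed.

End Class.

(** No left end of the class can separate two points of a plateau, as [H] is strictly smaller before
    it. So both points lie in one interval of the class; its union with the plateau is again an
    interval of constancy, and both are maximal. *)
Lemma plateau_range j P : (plateau R M P /\ P `<=` range j) <->
  exists m e, Ecl M j m e /\ P = alpha_between e (cR M m e).
Proof.
split=> [[[cP mP] sP]|[m [e [E ->]]]]; last first.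
  split; last exact: Ecl_in_range E.
  by split=> [|K]; [exact: Ecl_pos_const E|move=> hK JK; apply: (Ecl_maximal E)].
have [iP _ [x [y [Px [Py xy]]]] _ constP] := cP.
have [ax [Ax x1 _]] := sP _ Px; have [ay [Ay _ y2]] := sP _ Py.
have axy : lex_lt ax ay by exact/(alpha_incrE Ax Ay).
have [_ ale _ _ _] := Ay; have [_ amax] := alpha_props Ay.
have [[m [e [E h1 h2]]]|[m [e [E h1 h2]]]] := Ecl_dichotomy M0 ale amax (lltW x1) axy y2.
  have [h [h0 hh]] := height_Ecl R M0 E; have F := Ecl_fund M0 E.
  have Ae := alpha_invP (admissible_fund F).
  have Pe : P (alpha_inv R M e).
    apply: (iP _ _ _ Px Py); apply/andP; split; last exact/(alpha_leE Ae Ay).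
    exact/(alpha_leE Ax Ae)/lltW.
  have [_ /(_ h1)] := hh _ _ Ax; have [He _] := hh _ _ Ae.
  rewrite (constP _ _ Px Pe) He ?ltxx //; first exact: lle_refl.
  exact/lltW/(c_cR F).
exists m, e; split=> //; set J := alpha_between _ _.
have cJ : pos_const_interval R M J by exact: Ecl_pos_const E.
have Jx : J x by exists ax; split=> //; exact/lltW/(llt_le_trans axy).
have cU := pos_const_union cP cJ Px Jx.
have eP : P `|` J = P by apply: mP => //; exact: subsetUl.
by rewrite -eP; apply: (Ecl_maximal E) => //; exact: subsetUr.
Qed.

Lemma not_an_above_KL a n : fundamental M a -> periodic a = anx M n ->
  ~ Jint R M a `<=` [set q | qKL R M < q <= M.+1%:R].
Proof.
move=> ha ea sub; have F := fund_an M0 n.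
have A := alpha_invP (admissible_fund F).
have /sub/andP[+ _] : Jint R M a (alpha_inv R M (anx M n)).
  rewrite Jint_between // ea; exists (anx M n); split=> //; first exact: lle_refl.
  by rewrite -ea; exact/lltW/(c_cR (fundamental_fund ha)).
by move/(alpha_incrE is_alpha_KL A)/(llt_trans (an_lambda M0 n))/llt_irr.
Qed.

Lemma irreducible_class P : (exists m e, Ecl M 0 m e /\ P = alpha_between e (cR M m e)) <->
  exists a, irreducible M a /\ P = Jint R M a /\
    Jint R M a `<=` [set q | qKL R M < q <= M.+1%:R].
Proof.
split=> [[m [e [E ->]]]|[a [hI [-> sub]]]].
  have [a [hI sa pa]] := irr_word E.1; have [ha _] := hI.
  by exists a; rewrite Jint_between // sa pa; split=> //; split=> //; exact: Ecl_above_KL E.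
have [ha I] := (irreducible_irr M a).1 hI.
exists (size a), (periodic a); rewrite -Jint_between //; split=> //; split=> //.
by have [//|ea] := irr_us M0 I; case: (@not_an_above_KL a 0 ha ea sub).
Qed.

Lemma n_irreducible_class n P :
  (exists m e, Ecl M n.+1 m e /\ P = alpha_between e (cR M m e)) <->
  exists a, n_irreducible M n.+1 a /\ P = Jint R M a /\
    Jint R M a `<=` [set q | qKL R M < q <= M.+1%:R].
Proof.
have [t1 t2 t3] := tower_word n M0.
have comp b : fundamental 1 b -> [/\ fundamental M (compose M (tower M n) b),
    size (compose M (tower M n) b) = (anl M n * size b)%N &
    periodic (compose M (tower M n) b) = psi M (anl M n) (anx M n) 0 (periodic b)].
  move=> hb; split; first exact: compose_fundamental.
    by rewrite compose_size // t2.
  by rewrite compose_periodic // t2 t3.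
split=> [[m [e [E ->]]]|[a [[ha [b [hI ea]]] [-> sub]]]].
  have [k [b' [I hu em ee]]] := E.
  have [b [hI sb pb]] := irr_word I; have [hb _] := hI; have [c1 c2 c3] := comp _ hb.
  have eJ : Jint R M (compose M (tower M n) b) = alpha_between e (cR M m e).
    by rewrite Jint_between // c2 c3 sb pb ee em.
  exists (compose M (tower M n) b); rewrite eJ; split; first by split=> //; exists b.
  by split=> //; exact: Ecl_above_KL E.
have [hb I] := (irreducible_irr 1 b).1 hI; have [c1 c2 c3] := comp _ hb.
rewrite -/(tower M n) in ea; rewrite ea in ha sub *.
exists (anl M n * size b)%N, (psi M (anl M n) (anx M n) 0 (periodic b)).
rewrite Jint_between // c2 c3; split=> //.
(* The other irreducible binary word is [10], and it leads to the next word of the tower. *)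
have [h|eb] := irr_us (isT : (0 < 1)%N) I; first by exists (size b), (periodic b).
by case: (@not_an_above_KL _ n.+1 ha _ sub); rewrite c3 eb -t10E.
Qed.

End Bases.

Unset Implicit Arguments.
Set Strict Implicit.

Theorem theorem3p7 (R : realType) (M : nat) : (1 <= M)%N ->
  (forall P : set R,
     (plateau R M P /\ P `<=` [set q | qT R M < q <= (M.+1)%:R]) <->
     (exists a, irreducible M a /\ P = Jint R M a /\
                Jint R M a `<=` [set q | qKL R M < q <= (M.+1)%:R]))
  /\
  (forall n : nat, (1 <= n)%N -> forall P : set R,
     (plateau R M P /\ P `<=` [set q | qprime R M n.+1 < q <= qprime R M n]) <->
     (exists a, n_irreducible M n a /\ P = Jint R M a /\
                Jint R M a `<=` [set q | qKL R M < q <= (M.+1)%:R])).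
Proof.
move=> M0; split=> [P|[//|n] _ P].
  have := plateau_range M0 0 P; rewrite -(rangeE R M0) => h1.
  have h2 := irreducible_class M0 P.
  by split=> [/h1/h2//|/h2/h1].
have h1 := plateau_range M0 n.+1 P; have h2 := n_irreducible_class M0 n P.
by rewrite (rangeE R M0); split=> [/h1/h2//|/h2/h1].
Qed.
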